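(* Let $\gamma\ge1$, let $\nabla_{\mathcal L}$ and $\mathcal L$ be the Heisenberg–Greiner gradient and operator on $\mathbb{R}^{2n+1}$, $\rho$ the associated homogeneous distance and $Q=2n+2\gamma$ the homogeneous dimension (see context). Let $p\ge2$ and $\theta\in\mathbb{R}$ satisfy $$(Q-p(\theta+2))(p\theta+Q(p-1))\ge0,\qquad Q>2p(2\gamma-1)+4(1-\gamma).$$ Then, for all $u\in C_c^\infty(\mathbb{R}^{2n+1}\setminus\{0\})$, $$\left(\frac{(Q-p(\theta+2))(p\theta+Q(p-1))}{p^2}\right)^p\int_{\mathbb{R}^{2n+1}}\frac{|u|^p}{\rho^{p(\theta+2)}}|\nabla_{\mathcal L}\rho|^2\,dz\,dt\le\int_{\mathbb{R}^{2n+1}}\frac{|\mathcal L u|^p}{\rho^{p\theta}}|\nabla_{\mathcal L}\rho|^{-2(p-1)}\,dz\,dt.$$ The constant is optimal and equality occurs, up to a multiplicative factor, for $u=\rho^{\frac{p(\theta+2)-Q}{p}}$.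
   Context: On $\mathbb{R}^{2n+1}$ with coordinates $(z,t)$, $z=(x,y)\in\mathbb{R}^{2n}$, $t\in\mathbb{R}$, and $\gamma\ge1$, set $$X_i=\frac{\partial}{\partial x_i}+2\gamma y_i|z|^{2\gamma-2}\frac{\partial}{\partial t},\qquad Y_i=\frac{\partial}{\partial y_i}-2\gamma x_i|z|^{2\gamma-2}\frac{\partial}{\partial t},\quad i=1,\dots,n,$$ $\nabla_{\mathcal L}=(X_1,\dots,X_n,Y_1,\dots,Y_n)$, $\mathcal L=\sum_{i=1}^n(X_i^2+Y_i^2)$, and $\rho(z,t)=(|z|^{4\gamma}+t^2)^{1/(4\gamma)}$, so that $|\nabla_{\mathcal L}\rho|=|z|^{2\gamma-1}/\rho^{2\gamma-1}$. The number $Q=2n+2\gamma$ is the homogeneous dimension determined by the dilations $\delta_\lambda(z,t)=(\lambda z,\lambda^{2\gamma}t)$, $\lambda>0$. *)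

(* Defs.v *)
From HB Require Import structures.
From mathcomp Require Import all_boot all_order all_algebra.
From mathcomp Require Import all_classical all_reals all_analysis.

Set Implicit Arguments.
Unset Strict Implicit.
Unset Printing Implicit Defensive.

Import Order.TTheory GRing.Theory Num.Theory.
Import numFieldNormedType.Exports.

Local Open Scope classical_set_scope.
Local Open Scope ring_scope.

(* The Borel sigma-algebra of R^m, generated by the coordinate functions, as
   the library does for tuples. *)
Section measurable_rV.
Context (R : realType) (m : nat).

Let coors : 'I_m -> 'rV[R]_m -> measurableTypeR R := fun i q => q ord0 i.

Let rV_set0 : g_sigma_preimage coors set0.
Proof. exact: sigma_algebra0. Qed.

Let rV_setC A : g_sigma_preimage coors A -> g_sigma_preimage coors (~` A).
Proof. exact: sigma_algebraC. Qed.

Let rV_bigcup (F : _^nat) : (forall i, g_sigma_preimage coors (F i)) ->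
  g_sigma_preimage coors (\bigcup_i (F i)).
Proof. exact: sigma_algebra_bigcup. Qed.

HB.instance Definition _ := @isMeasurable.Build default_measure_display
  'rV[R]_m (g_sigma_preimage coors) rV_set0 rV_setC rV_bigcup.

End measurable_rV.

Section lebesgue_rV.
Context (R : realType).

Definition cons_rV (m : nat) (q : measurableTypeR R * 'rV[R]_m) : 'rV[R]_m.+1 :=
  row_mx (const_mx q.1 : 'rV[R]_1) q.2.

Definition uncons_rV (m : nat) (q : 'rV[R]_m.+1) : measurableTypeR R * 'rV[R]_m :=
  (q ord0 ord0, \row_i q ord0 (lift ord0 i)).

Lemma cons_rV0 m (q : measurableTypeR R * 'rV[R]_m) : cons_rV q ord0 ord0 = q.1.
Proof. by rewrite /cons_rV mxE; case: splitP => j //=; rewrite mxE. Qed.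

Lemma cons_rVS m (q : measurableTypeR R * 'rV[R]_m) i :
  cons_rV q ord0 (lift ord0 i) = q.2 ord0 i.
Proof.
rewrite /cons_rV mxE; case: splitP => j /=.
  by case: j => -[|//] ? /=; rewrite /bump.
by rewrite /bump /= => -[] /ord_inj ->.
Qed.

Lemma cons_rVK m : cancel (@cons_rV m) (@uncons_rV m).
Proof.
move=> [a v]; rewrite /uncons_rV cons_rV0/=; congr pair.
by apply/rowP => i; rewrite mxE cons_rVS.
Qed.

Lemma measurable_coor m (i : 'I_m) :
  measurable_fun setT (fun q : 'rV[R]_m => q ord0 i : measurableTypeR R).
Proof.
move=> _ Y mY; rewrite setTI; apply: sub_sigma_algebra => /=.
rewrite -bigcup_seq/=; exists i => /=; first by rewrite mem_index_enum.
by exists Y => //; rewrite setTI.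
Qed.

Lemma measurable_fun_rVP d (T : measurableType d) m (f : T -> 'rV[R]_m) :
  (forall i, measurable_fun setT (fun x => f x ord0 i : measurableTypeR R)) ->
  measurable_fun setT f.
Proof.
move=> mf.
have H : g_sigma_preimage
    (fun i : 'I_m => (fun q : 'rV[R]_m => q ord0 i : measurableTypeR R) \o f)
    `<=` measurable.
  apply: smallest_sub; first exact: sigma_algebra_measurable.
  move=> A; rewrite -bigcup_seq/= => -[i _ [B mB <-]].
  exact: mf.
move=> _ A mA; apply: H; rewrite g_sigma_preimage_comp.
by exists A.
Qed.

Lemma measurable_cons_rV m : measurable_fun setT (@cons_rV m).
Proof.
apply: measurable_fun_rVP => i; case: (unliftP ord0 i) => [j|] ->.
  rewrite (_ : (fun _ => _) = (fun q : 'rV[R]_m => q ord0 j : measurableTypeR R) \o snd).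
    by apply: measurableT_comp => //; exact: measurable_coor.
  by apply/funext => q /=; rewrite cons_rVS.
rewrite (_ : (fun _ => _) = fst) //.
by apply/funext => q /=; rewrite cons_rV0.
Qed.

Lemma measurable_uncons_rV m : measurable_fun setT (@uncons_rV m).
Proof.
apply: measurable_fun_pair; first exact: measurable_coor.
apply: measurable_fun_rVP => i.
rewrite (_ : (fun _ => _) =
  (fun q : 'rV[R]_m.+1 => q ord0 (lift ord0 i) : measurableTypeR R)).
  exact: measurable_coor.
by apply/funext => q; rewrite mxE.
Qed.

Section succ.
Context (m : nat) (mu : {sigma_finite_measure set 'rV[R]_m -> \bar R}).
Local Open Scope ereal_scope.

Definition lebesgue_rV_succ : set 'rV[R]_m.+1 -> \bar R :=
  pushforward (lebesgue_measure \x mu) (@cons_rV m).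

Let lebesgue_rV_succ0 : lebesgue_rV_succ set0 = 0.
Proof. by rewrite /lebesgue_rV_succ /pushforward preimage_set0 measure0. Qed.

Let lebesgue_rV_succ_ge0 A : 0 <= lebesgue_rV_succ A.
Proof. by rewrite /lebesgue_rV_succ /pushforward measure_ge0. Qed.

Let lebesgue_rV_succ_sigma_additive : semi_sigma_additive lebesgue_rV_succ.
Proof.
move=> F mF tF mUF; rewrite /lebesgue_rV_succ /pushforward preimage_bigcup.
have mc A : measurable A -> measurable (@cons_rV m @^-1` A).
  by move=> mA; rewrite -[X in measurable X]setTI; exact: measurable_cons_rV.
apply: measure_semi_sigma_additive => [n||]; first exact: mc.
- apply/trivIsetP => /= i j _ _ ij; rewrite -preimage_setI.
  by move/trivIsetP : tF => /(_ _ _ _ _ ij) ->//; rewrite preimage_set0.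
- by rewrite -preimage_bigcup; exact: mc.
Qed.

HB.instance Definition _ := isMeasure.Build _ _ _ lebesgue_rV_succ
  lebesgue_rV_succ0 lebesgue_rV_succ_ge0 lebesgue_rV_succ_sigma_additive.

Let lebesgue_rV_succ_sigma_finite : sigma_finite setT lebesgue_rV_succ.
Proof.
have /sigma_finiteP[F [TF ndF Foo]] := sigma_finiteT (@lebesgue_measure R).
have /sigma_finiteP[G [TG ndG Goo]] := sigma_finiteT mu.
exists (fun k => @uncons_rV m @^-1` (F k `*` G k)).
  rewrite -preimage_bigcup [X in _ @^-1` X](_ : _ = setT) ?preimage_setT//.
  apply/seteqP; split => // -[x y] _.
  have [k _ Fkx] : (\bigcup_k F k) x by rewrite -TF.
  have [l _ Gly] : (\bigcup_k G k) y by rewrite -TG.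
  exists (maxn k l) => //; split => /=.
    by move: x Fkx; exact/subsetPset/ndF/leq_maxl.
  by move: y Gly; exact/subsetPset/ndG/leq_maxr.
move=> k; have [mF Fk] := Foo k; have [mG Gk] := Goo k; split.
  rewrite -[X in measurable X]setTI; apply: measurable_uncons_rV => //.
  exact: measurableX.
rewrite /lebesgue_rV_succ /pushforward (_ : _ @^-1` _ = F k `*` G k).
  by rewrite product_measure1E// lte_mul_pinfty// ge0_fin_numE.
by rewrite -comp_preimage (_ : _ \o _ = idfun)//; apply/funext => q; exact: cons_rVK.
Qed.

HB.instance Definition _ := Measure_isSigmaFinite.Build _ _ _ lebesgue_rV_succ
  lebesgue_rV_succ_sigma_finite.

End succ.

(* The Lebesgue measure of R^m: R^0 has unit mass, R^(1 + m) is R x R^m. *)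
Fixpoint lebesgue_rV (m : nat) : {sigma_finite_measure set 'rV[R]_m -> \bar R} :=
  if m is k.+1 then lebesgue_rV_succ (lebesgue_rV k)
  else \d_ (0 : 'rV[R]_0).

End lebesgue_rV.
Arguments lebesgue_rV {R} m.

Section smooth.
Context (R : realType) (m : nat).
Implicit Types (u : 'rV[R]_m -> R) (q : 'rV[R]_m).

Definition partial (i : 'I_m) u q : R := 'D_(delta_mx ord0 i) u q.

(* C^oo: all iterated partial derivatives exist everywhere and are continuous. *)
Definition smooth u := forall s : seq 'I_m,
  continuous (foldr partial u s : 'rV[R]_m -> R) /\
  forall i q, derivable (foldr partial u s : 'rV[R]_m -> R) q (delta_mx ord0 i).

Definition tsupport u : set 'rV[R]_m := closure [set q | u q != 0].

(* C_c^oo(R^m \ {0}), each function being extended by 0 at the origin. *)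
Definition test_fun u := [/\ smooth u, compact (tsupport u) & ~ tsupport u 0].

Definition enorm q : R := Num.sqrt (\sum_(i < m) q ord0 i ^+ 2).

End smooth.

(* A point of R^(2n+1) is a row ((x, y), t) of size n + n + 1. *)
Section greiner.
Context (R : realType) (n : nat) (gamma : R).
Implicit Types (q : 'rV[R]_(n + n + 1)) (u : 'rV[R]_(n + n + 1) -> R).

Definition idx_x (i : 'I_n) : 'I_(n + n + 1) := lshift 1 (lshift n i).
Definition idx_y (i : 'I_n) : 'I_(n + n + 1) := lshift 1 (rshift n i).
Definition idx_t : 'I_(n + n + 1) := rshift (n + n) ord0.

Definition zpart q : 'rV[R]_(n + n) := lsubmx q.

(* For gamma = 1 the factor |z|^(2 gamma - 2) is 1 also at z = 0, since
   0 `^ 0 = 1. *)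
Definition greinerX (i : 'I_n) u q : R :=
  partial (idx_x i) u q +
  2 * gamma * q ord0 (idx_y i) * enorm (zpart q) `^ (2 * gamma - 2) *
    partial idx_t u q.

Definition greinerY (i : 'I_n) u q : R :=
  partial (idx_y i) u q -
  2 * gamma * q ord0 (idx_x i) * enorm (zpart q) `^ (2 * gamma - 2) *
    partial idx_t u q.

Definition greiner_grad u q : 'rV[R]_(n + n) :=
  row_mx (\row_i greinerX i u q) (\row_i greinerY i u q).

Definition greiner_op u q : R :=
  \sum_(i < n) (greinerX i (greinerX i u) q + greinerY i (greinerY i u) q).

Definition rho q : R :=
  (enorm (zpart q) `^ (4 * gamma) + q ord0 idx_t ^+ 2) `^ (4 * gamma)^-1.

Definition hdim : R := 2 * n%:R + 2 * gamma.

(* The two sides of the inequality, restricted to a set A, with values in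
   [0, +oo].  The integrands involve junk divisions only on {z = 0}, which is
   negligible. *)
Definition rellich_lhs (p theta : R) (A : set 'rV[R]_(n + n + 1)) u : \bar R :=
  (\int[lebesgue_rV (n + n + 1)]_(q in A)
    (`|u q| `^ p / rho q `^ (p * (theta + 2)) *
     enorm (greiner_grad rho q) ^+ 2)%:E)%E.

Definition rellich_rhs (p theta : R) (A : set 'rV[R]_(n + n + 1)) u : \bar R :=
  (\int[lebesgue_rV (n + n + 1)]_(q in A)
    (`|greiner_op u q| `^ p / rho q `^ (p * theta) *
     enorm (greiner_grad rho q) `^ (- (2 * (p - 1))))%:E)%E.

Definition rellich_const (p theta : R) : R :=
  ((hdim - p * (theta + 2)) * (p * theta + hdim * (p - 1)) / p ^+ 2) `^ p.

End greiner.

(* Main.v *)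
(** Write [X_j] for the horizontal fields, [D = |grad rho|^2 / rho^(p (theta + 2))],
    and let [K^p] be the constant.  For
      [W = rho^(2 - p (theta + 2)) |u|^(p - 2) u grad u
           - c |u|^p rho^(1 - p (theta + 2)) grad rho]
    with the right [c], expanding [div W] and completing a square gives
      [rho^(2 - p (theta + 2)) |u|^(p - 2) u L u + K |u|^p D <= div W];
    the divergence integrates to 0, and Young's inequality for
    [|u|^(p - 1) |L u|] yields the inequality.  The power
    [v = rho^((p (theta + 2) - Q) / p)] satisfies
    [L v = - K |grad rho|^2 rho^(-2) v], hence equality of the integrands.
    Truncating [v] at [rho ~ 1] and at a large radius (and flattening
    [|z|^(4 gamma)] near [z = 0], where it need not be smooth) changes both
    sides by bounded amounts, whereas the integral of the scale invariant
    density [|grad rho|^2 rho^(-Q)] diverges logarithmically: the constant is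
    optimal. *)

Require Import Defs.
From HB Require Import structures.
From mathcomp Require Import all_boot all_order all_algebra.
From mathcomp Require Import all_classical all_reals all_analysis.
From mathcomp Require Import measurable_realfun.
From mathcomp Require Import ring lra.

Set Implicit Arguments.
Unset Strict Implicit.
Unset Printing Implicit Defensive.

Import Order.TTheory GRing.Theory Num.Theory.
Import numFieldNormedType.Exports.

Local Open Scope classical_set_scope.
Local Open Scope ring_scope.

(** After the square is completed, the coefficient of [|u|^p D] is a concave quadratic polynomial in
    the parameter [c] that enters the square, and [K] is its maximum. The obstacles lie in
    regularity. For non-integer [gamma] the coefficients [|z|^(2 gamma - 2)] are not smooth at
    [z = 0], so [X_j u] is only shown to be C^1, and only along [z_j] and [t]. This is enough: the
    j-th component of the field is differentiated in these two directions alone, and since the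
    coefficient of [X_j] is independent of [t], [X_j W_j] is a sum of two partial derivatives, each
    of integral 0. The set [z = 0] lies in a null hyperplane, and integrands are compared off it. In
    the optimality part the changes must be bounded uniformly in the truncation parameter [r].
    Cutoff estimates invariant under dilations serve this purpose, and the flattened slab around
    [z = 0] is given a width of order [1/r] to offset its extent of order [r] along [t]. *)

Section directional.
Context (R : realType) (V : normedModType R).
Implicit Types (f g : V -> R) (q v : V).

Lemma is_derive_line f q v (df : R) :
  is_derive q v f df <-> is_derive (0 : R) 1 (fun h : R => f (h *: v + q)) df.
Proof.
have E : 'D_v f q = 'D_1 (fun h : R => f (h *: v + q)) 0.
  rewrite /derive; set k1 := fun h => h^-1 *: _; set k2 := fun h => h^-1 *: _.
  suff -> : k1 = k2 by [].
  apply/funext => h; rewrite /k1 /k2 /=.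
  by rewrite addr0 scale0r add0r [_%:A]mulr1.
split => -[d <-].
- by apply: DeriveDef; [exact: (derivable1P f q v).1 | rewrite E].
- by apply: DeriveDef; [exact: (derivable1P f q v).2 | rewrite E].
Qed.

(** Restriction to the line through [q] along [v] reduces this to the one-variable chain rule, so a
    derivative of [f] along [v] alone suffices. *)
Lemma is_derive_comp1 f q v (df : R) (g : R -> R) (dg : R) :
  is_derive q v f df -> is_derive (f q) 1 g dg ->
  is_derive q v (g \o f) (dg * df).
Proof.
move=> /is_derive_line df1 dg1; apply/is_derive_line.
apply: (is_derive1_comp _ df1).
by rewrite scale0r add0r.
Qed.

End directional.

(** * Real powers of nonnegative functions, including at their zeros *)

Section power_rules.
Context (R : realType) (V : normedModType R).
Implicit Types (f : V -> R) (q v : V).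

Lemma powR_expR (x a : R) : 0 < x -> x `^ a = expR (a * ln x).
Proof. by move=> x0; rewrite /powR gt_eqF. Qed.

Lemma gt0_powRD (x a b c : R) : 0 < x -> c = a + b -> x `^ c = x `^ a * x `^ b.
Proof. by move=> x0 ->; rewrite powRD//; apply/implyP => _; rewrite gt_eqF. Qed.

Lemma gt0_powRS (x a c : R) : 0 < x -> c = 1 + a -> x `^ c = x * x `^ a.
Proof. by move=> x0 /(gt0_powRD x0) ->; rewrite powRr1// ltW. Qed.

Lemma gt0_powRSS (x a c : R) : 0 < x -> c = 2 + a -> x `^ c = x ^+ 2 * x `^ a.
Proof. by move=> x0 /(gt0_powRD x0) ->; rewrite powR_mulrn// ltW. Qed.

Lemma ge0_cvg_powR (T : Type) (F : set_system T) (FF : ProperFilter F)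
    (f : T -> R) (l r : R) : (forall x, 0 <= f x) -> 0 <= r ->
  f x @[x --> F] --> l -> f x `^ r @[x --> F] --> l `^ r.
Proof.
move=> f0 r0 fl.
have l0 : 0 <= l.
  rewrite -(cvg_lim _ fl)//; apply: limr_ge; first exact: cvgP fl.
  by near=> x.
have [->|rn0] := eqVneq r 0.
  by under eq_fun do rewrite powRr0; rewrite powRr0; exact: cvg_cst.
have {r0 rn0}r0 : 0 < r by rewrite lt_neqAle eq_sym rn0.
have [l00|ln0] := eqVneq l 0; last first.
  have {l0 ln0}l0 : 0 < l by rewrite lt_neqAle eq_sym ln0.
  have [d _] := is_derive1_powR r l0.
  have H : {for l, continuous (fun x : R => x `^ r)}.
    exact/differentiable_continuous/derivable1_diffP.
  exact: (cvg_comp _ _ fl H).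
move: fl; rewrite l00 powR0 ?gt_eqF// => fl.
apply/cvgrPdist_lt => e e0.
have e1 : 0 < e `^ r^-1 by rewrite powR_gt0.
move/cvgrPdist_lt : fl => /(_ _ e1); apply: filterS => h.
rewrite !sub0r !normrN !ger0_norm ?powR_ge0// => fe.
have -> : e = (e `^ r^-1) `^ r.
  by rewrite -powRrM mulVf ?gt_eqF// powRr1 ?ltW.
by apply: gt0_ltr_powR => //; rewrite ?nnegrE ?powR_ge0.
Unshelve. all: by end_near. Qed.

(** At a zero of [f] the difference quotient [f^r / h] factors as [(f / h) * f^(r - 1)]: the first
    factor converges and, for [1 < r], the second tends to 0. *)
Lemma ge0_is_derive_powR f q v (df r : R) : (forall x, 0 <= f x) -> 1 <= r ->
  is_derive q v f df ->
  is_derive q v (fun x => f x `^ r) (r * f q `^ (r - 1) * df).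
Proof.
move=> f0 r1 dfq.
have := f0 q; rewrite le_eqVlt => /predU1P[fq0|fq0]; last first.
  exact: (is_derive_comp1 dfq (is_derive1_powR r fq0)).
(* The exponent 1 is treated apart: there the second factor is the constant 1, not a null
   function. *)
have [->|r1'] := eqVneq r 1.
  rewrite subrr powRr0 !mul1r (_ : (fun _ => _) = f)//.
  by apply/funext => x; rewrite powRr1.
have {r1 r1'}r1 : 1 < r by rewrite lt_neqAle eq_sym r1'.
rewrite -fq0 powR0 ?subr_eq0 ?gt_eqF// mulr0 mul0r.
have cf : f (h *: v + q) @[h --> (0 : R)^'] --> (0 : R).
  have := (is_derive_line f q v df).1 dfq => -[dk _].
  have ck : f (h *: v + q) @[h --> (0 : R)] --> f (0 *: v + q).
    exact/differentiable_continuous/derivable1_diffP.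
  by move: ck; rewrite scale0r add0r -fq0 => ck A /ck; exact: nbhs_dnbhs.
have cp : f (h *: v + q) `^ (r - 1) @[h --> (0 : R)^'] --> (0 : R).
  rewrite -[X in _ --> X](@powR0 _ (r - 1)) ?subr_eq0 ?gt_eqF//.
  by apply: ge0_cvg_powR => //; rewrite subr_ge0 ltW.
have [/cvg_ex[l dl] El] := dfq.
have H : h^-1 *: (f (h *: v + q) `^ r - f q `^ r) @[h --> (0 : R)^'] --> l * 0.
  rewrite (_ : (fun h => _) = (fun h : R =>
    (h^-1 *: (f (h *: v + q) - f q)) * f (h *: v + q) `^ (r - 1))).
    exact: cvgM.
  apply/funext => h; rewrite -fq0 powR0 ?gt_eqF ?(lt_trans _ r1)// !subr0.
  by rewrite -scalerAl mulr_powRB1// (lt_trans _ r1).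
rewrite mulr0 in H; apply: DeriveDef; first by apply/cvg_ex; exists 0.
exact: cvg_lim.
Qed.

End power_rules.

(** * C^k calculus along a family of directions *)

Section Ck.
Context (R : realType) (V : normedModType R) (I : Type) (e : I -> V).
Implicit Types (f g : V -> R) (O : set V).

(* C^k on O, for derivatives in the directions e i only. *)
Fixpoint Ck k O f : Prop :=
  if k is k'.+1 then
    [/\ forall q, O q -> {for q, continuous f},
        forall i q, O q -> derivable f q (e i) &
        forall i, Ck k' O ('D_(e i) f)]
  else forall q, O q -> {for q, continuous f}.

Lemma Ck_continuous k O f q : Ck k O f -> O q -> {for q, continuous f}.
Proof. by case: k => [|k] /=; [exact | case => + _ _; exact]. Qed.

(** All derivatives are those of the globally defined [f], so each condition is pointwise and the
    two sets glue at once. *)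
Lemma Ck_setU k O O' f : Ck k O f -> Ck k O' f -> Ck k (O `|` O') f.
Proof.
elim: k f => [|k IH] f /=.
  by move=> h h' q [/h|/h'].
move=> [c d D] [c' d' D']; split => [q [/c|/c']//|i q [/d|/d']//|i].
exact: IH.
Qed.

Lemma Ck_sub k O O' f : O' `<=` O -> Ck k O f -> Ck k O' f.
Proof.
move=> OO'; elim: k f => [|k IH] f /=; first by move=> h q /OO'; exact: h.
by move=> [c d D]; split => [q /OO'|i q /OO'|i]; [exact: c|exact: d|exact: IH].
Qed.

Context (O : set V) (oO : open O).

(** Openness of [O] turns equality on [O] into equality near each of its points, which is what
    continuity and derivatives see. *)
Lemma Ck_eq k f g : (forall q, O q -> f q = g q) -> Ck k O f -> Ck k O g.
Proof.
have nO f1 g1 q : (forall q, O q -> f1 q = g1 q) -> O q -> \near q, f1 q = g1 q.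
  by move=> fg Oq; move: (open_nbhs_nbhs (conj oO Oq)); apply: filterS.
have nc f1 g1 q : (forall q, O q -> f1 q = g1 q) -> O q ->
    {for q, continuous f1} -> {for q, continuous g1}.
  move=> fg Oq; rewrite /prop_for /continuous_at -(fg _ Oq) => fc.
  apply: cvg_trans fc; apply: near_eq_cvg.
  by move: (nO _ _ _ fg Oq); apply: filterS.
elim: k f g => [|k IH] f g fg /=.
  by move=> h q Oq; apply: nc (h _ Oq).
move=> [c d D]; split => [q Oq|i q Oq|i].
- exact: nc (c _ Oq).
- by apply: near_eq_derivable (d i _ Oq); exact: nO.
- by apply: IH (D i) => q Oq; apply: near_eq_derive; exact: nO.
Qed.

Lemma Ck_pred k f : Ck k.+1 O f -> Ck k O f.
Proof.
elim: k f => [|k IH] f; first by case.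
by move=> [c d D]; split => // i; exact: IH.
Qed.

Lemma Ck_cst k c : Ck k O (fun=> c).
Proof.
elim: k c => [|k IH] c /=; first by move=> q _; exact: cst_continuous.
split => [q _|i q _|i]; first exact: cst_continuous.
- exact: derivable_cst.
- rewrite (_ : 'D_(e i) _ = fun=> 0); first exact: IH.
  by apply/funext => q; exact: derive_cst.
Qed.

Lemma CkD k f g : Ck k O f -> Ck k O g -> Ck k O (fun q => f q + g q).
Proof.
elim: k f g => [|k IH] f g /=.
  by move=> cf cg q Oq; apply: cvgD; [exact: cf | exact: cg].
move=> [cf df Df] [cg dg Dg]; split => [q Oq|i q Oq|i].
- by apply: cvgD; [exact: cf | exact: cg].
- by apply: derivableD; [exact: df | exact: dg].
- apply: Ck_eq (IH _ _ (Df i) (Dg i)) => q Oq.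
  by rewrite -deriveD//; [exact: df | exact: dg].
Qed.

Lemma CkM k f g : Ck k O f -> Ck k O g -> Ck k O (fun q => f q * g q).
Proof.
elim: k f g => [|k IH] f g.
  by move=> cf cg q Oq; apply: cvgM; [exact: cf | exact: cg].
move=> Cf Cg; have [cf df Df] := Cf; have [cg dg Dg] := Cg.
split => [q Oq|i q Oq|i].
- by apply: cvgM; [exact: cf | exact: cg].
- by apply: derivableM; [exact: df | exact: dg].
- have := CkD (IH _ _ (Ck_pred Cf) (Dg i)) (IH _ _ (Ck_pred Cg) (Df i)).
  apply: Ck_eq => q Oq /=.
  by rewrite [RHS]deriveM//; [exact: df | exact: dg].
Qed.

Lemma CkZ k c f : Ck k O f -> Ck k O (fun q => c * f q).
Proof. by move=> Cf; apply: CkM Cf; exact: Ck_cst. Qed.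

Lemma CkB k f g : Ck k O f -> Ck k O g -> Ck k O (fun q => f q - g q).
Proof.
move=> Cf Cg; apply: Ck_eq (CkD Cf (CkZ (-1) Cg)) => q _.
by rewrite mulN1r.
Qed.

Lemma Ck_sum k (J : Type) (s : seq J) (F : J -> V -> R) :
  (forall j, Ck k O (F j)) -> Ck k O (fun q => \sum_(j <- s) F j q).
Proof.
move=> CF; elim: s => [|j s IH].
  by apply: Ck_eq (Ck_cst k 0) => q _; rewrite big_nil.
by apply: Ck_eq (CkD (CF j) IH) => q _; rewrite big_cons.
Qed.

End Ck.

Section Ck_real.
Context (R : realType).

Definition Ck1 k (O : set R) (g : R -> R) := Ck (fun _ : unit => 1 : R) k O g.

Lemma Ck1S k (O : set R) (g dg : R -> R) : open O ->
  (forall x, O x -> is_derive x 1 g (dg x)) -> Ck1 k O dg -> Ck1 k.+1 O g.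
Proof.
move=> oO gdg Cdg; split => [q Oq|_ q Oq|_].
- have [d _] := gdg _ Oq.
  exact/differentiable_continuous/derivable1_diffP.
- by have [] := gdg _ Oq.
- by apply: Ck_eq Cdg => // q Oq; have [_ ->] := gdg _ Oq.
Qed.

Lemma Ck1_is_derive k (O : set R) (g : R -> R) x : Ck1 k.+1 O g -> O x ->
  is_derive x 1 g ('D_1 g x).
Proof. by move=> [_ d _] Ox; apply: derivableP; exact: d tt x Ox. Qed.

Lemma Ck1_id k (O : set R) : open O -> Ck1 k O id.
Proof.
case: k => [_ q _|k oO]; first exact: cvg_id.
by apply: (@Ck1S k O id (fun=> 1) oO); exact: Ck_cst.
Qed.

Lemma Ck_comp (V : normedModType R) (I : Type) (e : I -> V) k (O : set V)
    (O' : set R) (g : R -> R) (f : V -> R) : open O -> open O' ->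
  (forall q, O q -> O' (f q)) -> Ck1 k O' g -> Ck e k O f ->
  Ck e k O (fun q => g (f q)).
Proof.
move=> oO oO' OO'; elim: k g f OO' => [|k IH] g f OO'.
  move=> cg cf q Oq; apply: continuous_comp; first exact: cf.
  exact/cg/OO'.
move=> Cg Cf; have [cg dg Dg] := Cg; have [cf df Df] := Cf.
have H i q : O q -> is_derive q (e i) (fun q => g (f q)) ('D_1 g (f q) * 'D_(e i) f q).
  move=> Oq; apply: is_derive_comp1; first by apply: derivableP; exact: df.
  by apply: (Ck1_is_derive Cg); exact: OO'.
split => [q Oq|i q Oq|i].
- apply: continuous_comp; first exact: cf.
  exact/cg/OO'.
- by have [] := H i _ Oq.
- have := CkM oO (IH _ _ OO' (Dg tt) (Ck_pred Cf)) (Df i).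
  by apply: Ck_eq => // q Oq; have [_ ->] := H i _ Oq.
Qed.

Lemma Ck1_powR k (r : R) : Ck1 k `]0, +oo[ (fun x => x `^ r).
Proof.
have oI : open (`]0, +oo[%classic : set R) by exact: rray_open.
elim: k r => [|k IH] r.
  move=> x /=; rewrite in_itv/= andbT => x0; have [d _] := is_derive1_powR r x0.
  exact/differentiable_continuous/derivable1_diffP.
apply: (Ck1S oI (dg := fun x => r * x `^ (r - 1))).
  by move=> x /=; rewrite in_itv/= andbT => x0; exact: is_derive1_powR.
by apply: CkZ => //; exact: IH.
Qed.

Lemma Ck1_inv k : Ck1 k `]0, +oo[ (fun x : R => x^-1).
Proof.
have oI : open (`]0, +oo[%classic : set R) by exact: rray_open.
apply: (Ck_eq oI _ (Ck1_powR k (-1))) => x /=; rewrite in_itv/= andbT => x0.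
by rewrite powR_inv1// ltW.
Qed.

End Ck_real.

(** * Lebesgue measure on R^m *)

Section borel_rV.
Context (R : realType).

Lemma continuous_rowP (T : topologicalType) m (f : T -> 'rV[R]_m) :
  (forall i, continuous (fun x => f x ord0 i)) -> continuous f.
Proof.
move=> cf x; apply/cvg_ballP => e e0.
have H : \forall y \near x, forall i, ball (f x ord0 i) e (f y ord0 i).
  by apply: filter_forall => i; exact: (cvg_ball (cf i x)).
near=> y; split=> // i j; rewrite ord1.
by move: j {i}; near: y.
Unshelve. all: by end_near. Qed.

(** The sigma-algebra is generated by coordinates, so open sets have to be decomposed: each is the
    countable union of the grid cells of mesh [1/(k + 1)] that it contains. A point of a ball of
    radius [e] is reached as soon as [1/(k + 1) < e], because balls are those of the sup norm. *)
Lemma open_measurable_rV m (U : set 'rV[R]_m) : open U -> measurable U.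
Proof.
move=> oU.
pose cell (kw : nat * 'rV[int]_m) : set 'rV[R]_m :=
  [set q | forall i, Num.floor (q ord0 i * kw.1.+1%:R) = kw.2 ord0 i].
have mcell kw : measurable (cell kw).
  rewrite (_ : cell kw = \bigcap_(i in [set: 'I_m])
      [set q | Num.floor (q ord0 i * kw.1.+1%:R) = kw.2 ord0 i]); last first.
    by apply/seteqP; split => q /= h i; [move=> _; exact: h | exact: h].
  apply: fin_bigcap_measurable => // i _.
  have mfl : measurable_fun setT
      (fun q : 'rV[R]_m => q ord0 i * kw.1.+1%:R : measurableTypeR R).
    by apply: measurable_funM => //; exact: measurable_coor.
  rewrite [X in measurable X](_ : _ = setT `&` (fun q : 'rV[R]_m => q ord0 i * kw.1.+1%:R) @^-1`
      `[(kw.2 ord0 i)%:~R, (kw.2 ord0 i + 1)%:~R[).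
    by apply: mfl => //; exact: measurable_itv.
  rewrite setTI; apply/seteqP; split => q /=; rewrite in_itv/=.
    by move=> <-; exact: floor_itv.
  exact: floor_def.
rewrite (_ : U = \bigcup_kw (if asbool (cell kw `<=` U) then cell kw else set0)).
  apply: countable_bigcupT_measurable => // kw.
  by case: ifP => _; [exact: mcell | exact: measurable0].
apply/seteqP; split => [q Uq|q [kw _]]; last by case: ifPn => // /asboolP; exact.
have /nbhs_ballP[e /= e0 eU] := open_nbhs_nbhs (conj oU Uq).
pose k := Num.truncn e^-1.
have ke : e^-1 < k.+1%:R by exact: truncnS_gt.
pose w := \row_i Num.floor (q ord0 i * k.+1%:R).
have cq : cell (k, w) q by move=> i /=; rewrite mxE.
exists (k, w) => //; rewrite ifT//; apply/asboolP => q' cq'; apply: eU.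
split=> // i0 i; rewrite ord1 /ball/=.
have /andP[a1 b1] := floor_itv (q ord0 i * k.+1%:R).
have /andP[a2 b2] := floor_itv (q' ord0 i * k.+1%:R).
have k0 : 0 < k.+1%:R :> R by rewrite ltr0n.
have E : Num.floor (q' ord0 i * k.+1%:R) = Num.floor (q ord0 i * k.+1%:R).
  by rewrite cq' mxE.
rewrite E in a2 b2; rewrite intrD in b1 b2.
rewrite -(ltr_pM2r k0) -[X in _ * X < _](gtr0_norm k0) -normrM mulrBl.
have : 1 < e * k.+1%:R by rewrite mulrC -ltr_pdivrMr// div1r.
move: a1 b1 a2 b2; set F := (_%:~R); move=> a1 b1 a2 b2 h.
by rewrite ltr_norml; apply/andP; split; lra.
Qed.

Lemma continuous_measurable_rV m (O : set 'rV[R]_m) (f : 'rV[R]_m -> R) :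
  open O -> (forall q, O q -> {for q, continuous f}) ->
  measurable_fun O (f : _ -> measurableTypeR R).
Proof.
move=> oO cf; apply: (measurability _ (RGenOpens.measurableE R)).
move=> _ [_ [a [b ->] <-]]; apply: open_measurable_rV.
rewrite openE => q [Oq /= fq]; apply: filterI.
  exact: (open_nbhs_nbhs (conj oO Oq)).
apply: (cf q Oq); apply: open_nbhs_nbhs; split => //.
Qed.

End borel_rV.

Section lebesgue_rV_theory.
Context (R : realType).

Definition rV_box m (a b : 'I_m -> R) : set 'rV[R]_m :=
  [set q | forall i, a i <= q ord0 i <= b i].

Lemma measurable_rV_box m (a b : 'I_m -> R) : measurable (rV_box a b).
Proof.
rewrite (_ : rV_box a b = \bigcap_(i in [set: 'I_m])
    (setT `&` (fun q : 'rV[R]_m => q ord0 i) @^-1` `[a i, b i])); last first.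
  apply/seteqP; split => q /= h i; first by rewrite setTI /= in_itv/=.
  by have := h i Logic.I; rewrite setTI/= in_itv.
apply: fin_bigcap_measurable => // i _.
by apply: measurable_coor => //; exact: measurable_itv.
Qed.

Lemma compact_rV_box m (a b : 'I_m -> R) : compact (rV_box a b).
Proof.
rewrite (_ : rV_box a b =
    [set q : 'rV[R]_m | forall i, `[a i, b i]%classic (q ord0 i)]); last first.
  by apply/seteqP; split => q /= h i; have := h i; rewrite in_itv.
apply: (rV_compact (A := fun i => `[a i, b i]%classic)) => i.
exact: segment_compact.
Qed.

Lemma lebesgue_rVSE m (A : set 'rV[R]_m.+1) :
  lebesgue_rV m.+1 A = (lebesgue_measure \x lebesgue_rV m)%E (@cons_rV R m @^-1` A).
Proof. by []. Qed.

Lemma lebesgue_rV_box m (a b : 'I_m -> R) : (forall i, a i <= b i) ->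
  lebesgue_rV m (rV_box a b) = (\prod_(i < m) (b i - a i))%:E.
Proof.
elim: m a b => [|m IH] a b ab.
  rewrite big_ord0 /= diracE mem_set//; first by case.
rewrite lebesgue_rVSE (_ : _ @^-1` _ = `[a ord0, b ord0]%classic `*`
    rV_box (fun i => a (lift ord0 i)) (fun i => b (lift ord0 i))).
  rewrite product_measure1E//; last exact: measurable_rV_box.
  rewrite /= IH// lebesgue_measure_itv/= lte_fin big_ord_recl -EFinD EFinM.
  case: ltP => // ba; rewrite (_ : a ord0 = b ord0) ?subrr//.
  by apply/eqP; rewrite eq_le ab.
apply/seteqP; split => [[x v] /= h|[x v] [/= hx hv] i].
  by split => [|i] /=; [have := h ord0; rewrite cons_rV0 in_itv
    |have := h (lift ord0 i); rewrite cons_rVS].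
by case: (unliftP ord0 i) => [j|] ->; rewrite ?cons_rVS ?cons_rV0//=.
Qed.

Lemma lebesgue_rV_box_lty m (a b : 'I_m -> R) : (forall i, a i <= b i) ->
  (lebesgue_rV m (rV_box a b) < +oo)%E.
Proof. by move=> /lebesgue_rV_box ->; rewrite ltry. Qed.

(** The measure is built by splitting off the coordinate of index 0; for that index the hyperplane
    is the product of a point with [R^m]. *)
Lemma lebesgue_rV_hyperplane m (i : 'I_m) : val i = 0%N ->
  lebesgue_rV m [set q : 'rV[R]_m | q ord0 i = 0] = 0%E.
Proof.
case: m i => [[]//|m] i i0; rewrite (_ : i = ord0); last exact/val_inj.
rewrite lebesgue_rVSE (_ : _ @^-1` _ = [set 0] `*` setT).
  rewrite product_measure1E// [X in (X * _)%E](_ : _ = 0%E) ?mul0e//.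
  exact: lebesgue_measure_set1.
by apply/seteqP; split => -[x v] /=; rewrite cons_rV0 => // -[].
Qed.

Lemma continuous_cons_rVl m (v : 'rV[R]_m) : continuous (fun x : R => cons_rV (x, v)).
Proof.
apply: continuous_rowP => i; case: (unliftP ord0 i) => [j|] ->.
  by under eq_fun do rewrite cons_rVS; exact: cst_continuous.
by under eq_fun do rewrite cons_rV0; move=> x; exact: cvg_id.
Qed.

Lemma continuous_cons_rVr m (x : R) : continuous (fun v : 'rV[R]_m => cons_rV (x, v)).
Proof.
apply: continuous_rowP => i; case: (unliftP ord0 i) => [j|] ->.
  by under eq_fun do rewrite cons_rVS; exact: coord_continuous.
by under eq_fun do rewrite cons_rV0; exact: cst_continuous.
Qed.

Definition cube m (B : R) : set 'rV[R]_m := rV_box (fun=> - B) (fun=> B).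

Lemma integrable_cube m (g : 'rV[R]_m -> R) B : continuous g ->
  (forall q, ~ cube B q -> g q = 0) ->
  (lebesgue_rV m).-integrable setT (fun q => (g q)%:E).
Proof.
move=> cg g0; have mB : measurable (cube B : set 'rV[R]_m) by exact: measurable_rV_box.
rewrite (_ : (fun q => (g q)%:E) = (fun q => (g q)%:E) \_ (cube B)); last first.
  apply/funext => q; rewrite patchE; case: ifPn => // /negP qB.
  by rewrite g0// => qB'; apply: qB; rewrite inE.
apply/(integrable_mkcond _ mB).1.
apply: measurable_bounded_integrable => //.
- have [B0|B0] := leP 0 B.
    by apply: lebesgue_rV_box_lty => i; rewrite ge0_cp.
  (* For [B < 0] the cube is empty except in dimension 0, where its condition is vacuous and it is
     the whole one-point space. *)
  case: m g cg g0 mB => [|m] g cg g0 mB.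
    by apply: le_lt_trans (le_measure _ _ _ (subsetT _)) _; rewrite ?inE//= diracE ltry.
  rewrite (_ : cube B = set0) ?measure0//; apply/seteqP; split => // q /(_ ord0).
  by move=> /andP[] /le_trans /[apply]; rewrite -subr_ge0 opprK; lra.
- apply: measurable_funTS; apply: continuous_measurable_rV; first exact: openT.
  by move=> q _; exact: cg.
- have /compact_bounded : compact (g @` cube B).
    apply: (@continuous_compact _ _ g (cube B)); last exact: compact_rV_box.
    exact: continuous_subspaceT.
  move=> [M [Mr HM]]; exists M; split => // x Mx q qB.
  by apply: (HM x Mx); exists q.
Qed.

Lemma is_derive_cons_rVS m (f : 'rV[R]_m.+1 -> R) x (v : 'rV[R]_m) j (df : R) :
  is_derive (cons_rV (x, v)) (delta_mx ord0 (lift ord0 j)) f df <->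
  is_derive v (delta_mx ord0 j) (fun w => f (cons_rV (x, w))) df.
Proof.
apply: (iff_trans (is_derive_line _ _ _ _)).
apply: iff_sym; apply: (iff_trans (is_derive_line _ _ _ _)); apply: iff_sym.
suff -> : (fun h : R => f (h *: delta_mx ord0 (lift ord0 j) + cons_rV (x, v)))
  = (fun h : R => f (cons_rV (x, h *: delta_mx ord0 j + v))) by [].
apply/funext => h; congr f; apply/rowP => i.
rewrite [LHS]mxE [X in X + _]mxE [X in _ * X + _]mxE.
case: (unliftP ord0 i) => [k|] ->.
  by rewrite !cons_rVS !mxE /= (inj_eq lift_inj).
by rewrite !cons_rV0 eqxx /= mulr0 add0r.
Qed.

Lemma is_derive_cons_rV0 m (f : 'rV[R]_m.+1 -> R) x (v : 'rV[R]_m) (df : R) :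
  is_derive (cons_rV (x, v)) (delta_mx ord0 ord0) f df <->
  is_derive x 1 (fun y => f (cons_rV (y, v))) df.
Proof.
apply: (iff_trans (is_derive_line _ _ _ _)).
apply: iff_sym; apply: (iff_trans (is_derive_line _ _ _ _)); apply: iff_sym.
suff -> : (fun h : R => f (h *: delta_mx ord0 ord0 + cons_rV (x, v)))
  = (fun h : R => f (cons_rV (h *: 1 + x, v))) by [].
apply/funext => h; congr f; apply/rowP => i.
rewrite [LHS]mxE [X in X + _]mxE [X in _ * X + _]mxE.
case: (unliftP ord0 i) => [k|] ->.
  by rewrite !cons_rVS /= mulr0 add0r.
by rewrite !cons_rV0.
Qed.

Lemma integral_derive_eq0 (f df : R -> R) (B : R) : continuous df ->
  (forall x : R, is_derive x 1 f (df x)) -> (forall x, ~ `[- B, B]%classic x -> f x = 0) ->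
  (\int[lebesgue_measure]_x (df x)%:E)%E = 0%E.
Proof.
(* [[-C, C]] is nondegenerate whatever the sign of [B] and strictly contains [[-B, B]], so [f]
   vanishes at its ends and [df] outside it. *)
move=> cdf fdf f0; pose C := `|B| + 1.
have BC : B < C by rewrite /C (le_lt_trans (ler_norm B))// ltrDl.
have C0 : - C < C by rewrite -subr_gt0 opprK addr_gt0// /C ltr_wpDl.
have df0 x : ~ `[- C, C]%classic x -> df x = 0.
  move=> xC; have [_ <-] := fdf x.
  have oC : open (~` `[- B, B]%classic : set R) by apply: closed_openC; exact: interval_closed.
  have xB : (~` `[- B, B]%classic : set R) x.
    move=> xB; apply: xC; move: xB; rewrite /= !in_itv/= => /andP[x1 x2].
    by apply/andP; split; lra.
  rewrite (@near_eq_derive _ _ _ f (cst 0)) ?derive_cst//.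
  move: (open_nbhs_nbhs (conj oC xB)); apply: filterS => y yB.
  exact: f0.
have -> : (fun x => (df x)%:E) = (fun x => (df x)%:E) \_ `[- C, C].
  apply/funext => x; rewrite patchE; case: ifPn => // /negP xC.
  by rewrite df0// => xC'; apply: xC; rewrite inE.
have cf : continuous f.
  by move=> x; have [d _] := fdf x; exact/differentiable_continuous/derivable1_diffP.
rewrite -integral_mkcond (@continuous_FTC2 _ df f)//.
- by rewrite !f0 ?subee// /= in_itv/= => /andP[h1 h2]; move: BC; rewrite ltNge => /negP; apply; lra.
- exact: continuous_subspaceT.
- split; first by move=> x _; have [] := fdf x.
  + exact/cvg_at_right_filter/cf.
  + exact/cvg_at_left_filter/cf.
- by move=> x _; rewrite derive1E; have [] := fdf x.
Qed.

Lemma partial_off_cube m (i : 'I_m) (f : 'rV[R]_m -> R) B q :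
  (forall q, ~ cube B q -> f q = 0) -> ~ cube B q -> partial i f q = 0.
Proof.
move=> f0 qB; rewrite /partial.
rewrite (@near_eq_derive _ _ _ f (cst 0)) ?derive_cst//.
have oB : open (~` cube B : set 'rV[R]_m).
  apply: closed_openC; apply: compact_closed; first exact: norm_hausdorff.
  exact: compact_rV_box.
by move: (open_nbhs_nbhs (conj oB qB)); apply: filterS => y yB; exact: f0.
Qed.

(** By Fubini the variable of differentiation can be reached first: for the coordinate of index 0
    the inner integral vanishes by the fundamental theorem of calculus, for any other coordinate by
    induction on the slices. *)
Lemma integral_partial_eq0 m (i : 'I_m) (f : 'rV[R]_m -> R) B :
  (forall q, derivable f q (delta_mx ord0 i)) -> continuous (partial i f) ->
  (forall q, ~ cube B q -> f q = 0) ->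
  (\int[lebesgue_rV m]_q (partial i f q)%:E)%E = 0%E.
Proof.
elim: m i f => [[]//|m IH] i f df cdf f0.
have df0 q : ~ cube B q -> partial i f q = 0 by exact: partial_off_cube.
have iD := integrable_cube cdf df0.
have mD : measurable_fun setT (fun q => (partial i f q)%:E) by exact: measurable_int iD.
have iDc : (lebesgue_measure \x lebesgue_rV m)%E.-integrable setT
    ((fun q => (partial i f q)%:E) \o @cons_rV R m).
  apply/integrableP; split; first by apply: measurableT_comp => //; exact: measurable_cons_rV.
  case/integrableP : iD => _.
  rewrite (@ge0_integral_pushforward _ _ _ _ R _ (@measurable_cons_rV R m)
    (lebesgue_measure \x lebesgue_rV m)%E)//.
  exact: measurableT_comp.
transitivity (\int[(lebesgue_measure \x lebesgue_rV m)%E]_xv (partial i f (cons_rV xv))%:E)%E.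
  exact: (@integral_pushforward _ _ _ _ R _ (@measurable_cons_rV R m)
    (lebesgue_measure \x lebesgue_rV m)%E).
case: (unliftP ord0 i) => [j|] ij; subst i.
- rewrite -integral12_prod_meas1//.
  apply: integral0_eq => x _.
  have E : (fun v => partial (lift ord0 j) f (cons_rV (x, v))) =
      partial j (fun v => f (cons_rV (x, v))).
    apply/funext => v; apply/esym.
    have [_ H] := (is_derive_cons_rVS f x v j _).1 (derivableP (df _)).
    exact: H.
  rewrite /fubini_F /=; under eq_integral do rewrite (congr1 (fun k => k _) E).
  apply: IH.
  + by move=> v; have [] := (is_derive_cons_rVS f x v j _).1 (derivableP (df _)).
  + rewrite -E => v; apply: continuous_comp; last exact: cdf.
    exact: continuous_cons_rVr.
  + move=> v vB; apply: f0 => h; apply: vB => k.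
    by have := h (lift ord0 k); rewrite cons_rVS.
- rewrite -integral21_prod_meas1//.
  apply: integral0_eq => v _; rewrite /fubini_G /=.
  apply: (@integral_derive_eq0 (fun x => f (cons_rV (x, v))) _ B).
  + move=> x; apply: continuous_comp; last exact: cdf.
    exact: continuous_cons_rVl.
  + by move=> x; apply/is_derive_cons_rV0; exact: derivableP (df _).
  + move=> x xB; apply: f0 => h; apply: xB.
    by have := h ord0; rewrite cons_rV0 /= in_itv.
Qed.

End lebesgue_rV_theory.

(** * Comparison of integrals off a null set *)

Section integral_null.
Context d (T : measurableType d) (R : realType).
Variable mu : {measure set T -> \bar R}.
Local Open Scope ereal_scope.
Import HBNNSimple.

(** A simple function below [f], multiplied by the indicator of the complement of [N], lies below
    [g] everywhere and keeps its integral. *)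
Let le_integral_lowerT (f g : T -> \bar R) (N : set T) :
  measurable N -> mu N = 0 -> (forall x, 0 <= f x) -> (forall x, 0 <= g x) ->
  (forall x, ~ N x -> f x <= g x) -> \int[mu]_x f x <= \int[mu]_x g x.
Proof.
move=> mN N0 f0 g0 fg; rewrite !ge0_integralTE//.
apply: ge_ereal_sup => _ [h/= hf] <-.
have mC := measurableC mN.
pose s := mul_nnsfun h (indic_nnsfun R mC).
have sE x : s x = (h x * (x \in ~` N)%:R)%R by rewrite /s/= mindicE.
apply: le_ereal_sup_tmp; exists (sintegral mu s).
  exists s => // x; rewrite sE; case: (boolP (x \in ~` N)) => [|_]; rewrite ?mulr1 ?mulr0//.
  by rewrite inE => /fg fgx; exact: le_trans (hf x) fgx.
rewrite -!integralT_nnsfun (@ge0_negligible_integral _ _ _ mu setT N)//=; last 2 first.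
- by apply/measurable_EFinP; exact: measurable_funTS.
- by move=> x _; rewrite lee_fin; exact: fun_ge0.
rewrite integral_mkcond; apply: ge0_le_integral => //.
- by move=> x _; rewrite patchE; case: ifP => // _; rewrite lee_fin; exact: fun_ge0.
- apply/(measurable_restrictT _ _).1; first exact: measurableD.
  by apply/measurable_EFinP; exact: measurable_funTS.
- apply/measurable_EFinP.
  exact: (measurable_funTS (D := setT) (measurable_funPT s)).
- move=> x _; apply: (@le_trans _ _ (h x * (x \in ~` N)%:R)%:E); last by rewrite -sE.
  rewrite patchE setTD; case: ifP => _; rewrite ?mulr1//.
  by rewrite mulr0.
Qed.

(* The integral being a supremum over simple functions, no measurability is required. *)
Lemma ge0_le_integral_off (D N : set T) (f g : T -> \bar R) :
  measurable N -> mu N = 0 -> (forall x, 0 <= f x) -> (forall x, 0 <= g x) ->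
  (forall x, D x -> ~ N x -> f x <= g x) ->
  \int[mu]_(x in D) f x <= \int[mu]_(x in D) g x.
Proof.
move=> mN N0 f0 g0 fg; rewrite integral_mkcond [leRHS]integral_mkcond.
apply: (le_integral_lowerT mN N0).
- by move=> x; rewrite patchE; case: ifP.
- by move=> x; rewrite patchE; case: ifP.
- move=> x Nx; rewrite !patchE; case: ifPn => // xD.
  by apply: fg => //; rewrite inE in xD.
Qed.

Lemma ge0_eq_integral_off (D N : set T) (f g : T -> \bar R) :
  measurable N -> mu N = 0 -> (forall x, 0 <= f x) -> (forall x, 0 <= g x) ->
  (forall x, D x -> ~ N x -> f x = g x) ->
  \int[mu]_(x in D) f x = \int[mu]_(x in D) g x.
Proof.
move=> mN N0 f0 g0 fg; apply/eqP; rewrite eq_le; apply/andP; split.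
- by apply: (ge0_le_integral_off mN) => // x Dx Nx; rewrite fg.
- by apply: (ge0_le_integral_off mN) => // x Dx Nx; rewrite fg.
Qed.

End integral_null.

(** * The horizontal fields *)

Section horizontal.
Context (R : realType) (n : nat) (gamma : R).
Implicit Types (q : 'rV[R]_(n + n + 1)) (u f g : 'rV[R]_(n + n + 1) -> R).
Implicit Types (j k : 'I_(n + n)).

Definition zc j q : R := q ord0 (lshift 1 j).
Definition tc q : R := q ord0 (idx_t n).

(** The rotation [(x, y) -> (y, -x)], which collects the coefficients of all [X_i] and [Y_i]. It is
    isometric and [Jz] is orthogonal to [z]; these two facts reduce every sum over [j] below to an
    expression in [|z|] and [t]. *)
Definition Jz j q : R :=
  match fintype.split j with
  | inl i => q ord0 (idx_y i)
  | inr i => - q ord0 (idx_x i)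
  end.

(** [|z|^2] is a polynomial, whereas [|z|] is singular at 0; exponents of [|z|] are halved
    accordingly throughout. *)
Definition sqn q : R := \sum_j zc j q ^+ 2.

Definition hcoef j q : R := 2 * gamma * Jz j q * sqn q `^ (gamma - 1).

(* X_1, ..., X_n, Y_1, ..., Y_n as a single family. *)
Definition hfield j u q : R :=
  partial (lshift 1 j) u q + hcoef j q * partial (idx_t n) u q.

Lemma sqn_ge0 q : 0 <= sqn q.
Proof. by apply: sumr_ge0 => j _; exact: sqr_ge0. Qed.

Lemma zc_sqr_le_sqn j q : zc j q ^+ 2 <= sqn q.
Proof.
rewrite /sqn (bigD1 j)//= lerDl; apply: sumr_ge0 => k _; exact: sqr_ge0.
Qed.

Lemma Jz_lshift i q : Jz (lshift n i) q = q ord0 (idx_y i).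
Proof.
rewrite /Jz -[lshift n i]/(unsplit (inl i)) unsplitK//.
Qed.

Lemma Jz_rshift i q : Jz (rshift n i) q = - q ord0 (idx_x i).
Proof.
by rewrite /Jz -[rshift n i]/(unsplit (inr i)) unsplitK.
Qed.

Lemma sum_Jz_zc q : \sum_j Jz j q * zc j q = 0.
Proof.
rewrite big_split_ord/= -big_split/= big1// => i _.
by rewrite Jz_lshift Jz_rshift /zc /idx_x /idx_y mulNr mulrC subrr.
Qed.

Lemma sum_Jz_sqr q : \sum_j Jz j q ^+ 2 = sqn q.
Proof.
rewrite /sqn !big_split_ord/= addrC; congr (_ + _); apply: eq_bigr => i _.
  by rewrite Jz_rshift sqrrN.
by rewrite Jz_lshift.
Qed.

Lemma enorm_zpart q : enorm (zpart q) = Num.sqrt (sqn q).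
Proof. by congr Num.sqrt; apply: eq_bigr => j _; rewrite /zpart mxE. Qed.

Lemma enorm_zpart_powR q r : enorm (zpart q) `^ r = sqn q `^ (r / 2).
Proof.
by rewrite enorm_zpart -powR12_sqrt ?sqn_ge0// -powRrM mulrC.
Qed.

Lemma rhoE q : rho gamma q = (sqn q `^ (2 * gamma) + tc q ^+ 2) `^ (4 * gamma)^-1.
Proof.
rewrite /rho enorm_zpart_powR; congr ((_ `^ _ + _) `^ _).
by field.
Qed.

Lemma hfield_lshift i u : hfield (lshift n i) u = greinerX gamma i u.
Proof.
apply/funext => q; rewrite /hfield /greinerX /hcoef Jz_lshift enorm_zpart_powR.
by congr (_ + _ * _ `^ _ * _); field.
Qed.

Lemma hfield_rshift i u : hfield (rshift n i) u = greinerY gamma i u.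
Proof.
apply/funext => q; rewrite /hfield /greinerY /hcoef Jz_rshift enorm_zpart_powR.
rewrite mulrN !mulNr; congr (_ - _ * _ `^ _ * _); by field.
Qed.

Lemma greiner_opE u q : greiner_op gamma u q = \sum_j hfield j (hfield j u) q.
Proof.
rewrite big_split_ord/= -big_split/=; apply: eq_bigr => i _.
by rewrite !hfield_lshift !hfield_rshift.
Qed.

Lemma enorm_greiner_grad u q :
  enorm (greiner_grad gamma u q) = Num.sqrt (\sum_j hfield j u q ^+ 2).
Proof.
congr Num.sqrt; rewrite !big_split_ord/=; congr (_ + _); apply: eq_bigr => i _.
  by rewrite /greiner_grad row_mxEl mxE hfield_lshift.
by rewrite /greiner_grad row_mxEr mxE hfield_rshift.
Qed.

Lemma is_derive_coord m (q : 'rV[R]_m) (i k : 'I_m) :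
  is_derive q (delta_mx ord0 i) (fun x : 'rV[R]_m => x ord0 k) ((i == k)%:R).
Proof.
apply/is_derive_line.
have -> : (fun h : R => (h *: delta_mx ord0 i + q) ord0 k) =
    (fun h : R => (i == k)%:R * h + q ord0 k).
  by apply/funext => h; rewrite !mxE/= eq_sym mulrC.
by apply: is_derive_eq; rewrite !(scaler0, scale0r, addr0) /GRing.scale/= mulr1.
Qed.

(** A relation and not just the value of [hfield]: it records that both directional derivatives
    exist, so that the sum, product and chain rules compose without side conditions. *)
Definition hder j f q (d : R) := exists d1 d2,
  [/\ is_derive q (delta_mx ord0 (lshift 1 j)) f d1,
      is_derive q (delta_mx ord0 (idx_t n)) f d2 &
      d = d1 + hcoef j q * d2].

Lemma hderE j f q d : hder j f q d -> hfield j f q = d.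
Proof.
by move=> [d1 [d2 [[_ <-] [_ <-] ->]]].
Qed.

Lemma hder_hfield j f q : derivable f q (delta_mx ord0 (lshift 1 j)) ->
  derivable f q (delta_mx ord0 (idx_t n)) -> hder j f q (hfield j f q).
Proof. by move=> a b; do 2 eexists; split; [exact: derivableP|exact: derivableP|]. Qed.

Lemma hder_eq j f q d d' : hder j f q d -> d = d' -> hder j f q d'.
Proof. by move=> ? <-. Qed.

Lemma hder_near j f g q d : (\near q, f q = g q) -> hder j f q d -> hder j g q d.
Proof.
move=> fg [d1 [d2 [h1 h2 ->]]]; exists d1, d2; split => //.
- exact: near_eq_is_derive h1.
- exact: near_eq_is_derive h2.
Qed.

Lemma hder_cst j q c : hder j (fun=> c) q 0.
Proof.
by exists 0, 0; split; [exact: is_derive_cst|exact: is_derive_cst|rewrite mulr0 addr0].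
Qed.

Lemma hderD j f g q d d' : hder j f q d -> hder j g q d' ->
  hder j (fun q => f q + g q) q (d + d').
Proof.
move=> [d1 [d2 [h1 h2 ->]]] [d3 [d4 [h3 h4 ->]]].
exists (d1 + d3), (d2 + d4); split; [exact: is_deriveD|exact: is_deriveD|].
by rewrite mulrDr addrACA.
Qed.

Lemma hderM j f g q d d' : hder j f q d -> hder j g q d' ->
  hder j (fun q => f q * g q) q (d * g q + f q * d').
Proof.
move=> [d1 [d2 [h1 h2 ->]]] [d3 [d4 [h3 h4 ->]]].
exists (f q * d3 + g q * d1), (f q * d4 + g q * d2).
by split; [exact: is_deriveM|exact: is_deriveM|ring].
Qed.

Lemma hderZ j f q d c : hder j f q d -> hder j (fun q => c * f q) q (c * d).
Proof.
by move=> h; apply: hder_eq (hderM (hder_cst j q c) h) _; rewrite mul0r add0r.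
Qed.

Lemma hderB j f g q d d' : hder j f q d -> hder j g q d' ->
  hder j (fun q => f q - g q) q (d - d').
Proof.
move=> h /(hderZ (-1)) /(hderD h); rewrite mulN1r.
by under [X in hder _ X]eq_fun do rewrite mulN1r.
Qed.

Lemma hder_comp j f q d (F : R -> R) dF : hder j f q d ->
  is_derive (f q) 1 F dF -> hder j (fun q => F (f q)) q (dF * d).
Proof.
move=> [d1 [d2 [h1 h2 ->]]] hF; exists (dF * d1), (dF * d2).
by split; [exact: is_derive_comp1|exact: is_derive_comp1|ring].
Qed.

Lemma hder_sum j (I : Type) (s : seq I) (F : I -> 'rV[R]_(n + n + 1) -> R) q
    (dF : I -> R) : (forall i, hder j (F i) q (dF i)) ->
  hder j (fun q => \sum_(i <- s) F i q) q (\sum_(i <- s) dF i).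
Proof.
move=> FdF; elim: s => [|i s IH].
  rewrite big_nil; under [X in hder _ X]eq_fun do rewrite big_nil.
  exact: hder_cst.
rewrite big_cons; under [X in hder _ X]eq_fun do rewrite big_cons.
exact: hderD.
Qed.

Lemma hder_zc j k q : hder j (zc k) q (j == k)%:R.
Proof.
exists (j == k)%:R, 0; split.
- by apply: is_derive_eq (is_derive_coord _ _ _) _; rewrite (inj_eq (@lshift_inj _ _)).
- by apply: is_derive_eq (is_derive_coord _ _ _) _; rewrite eq_rlshift.
- by rewrite mulr0 addr0.
Qed.

Lemma hder_tc j q : hder j tc q (hcoef j q).
Proof.
exists 0, 1; split; last by rewrite mulr1 add0r.
- by apply: is_derive_eq (is_derive_coord _ _ _) _; rewrite eq_lrshift.
- by apply: is_derive_eq (is_derive_coord _ _ _) _; rewrite eqxx.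
Qed.

Lemma hder_sqn j q : hder j sqn q (2 * zc j q).
Proof.
have H k : hder j (fun q => zc k q ^+ 2) q (2 * zc k q * (j == k)%:R).
  rewrite (_ : (fun q => _) = (fun q => zc k q * zc k q)).
    by apply: hder_eq (hderM (hder_zc j k q) (hder_zc j k q)) _; ring.
  by apply/funext => ?; rewrite expr2.
apply: hder_eq (hder_sum _ H) _.
rewrite (bigD1 j)//= eqxx mulr1 big1 ?addr0// => k kj.
by rewrite eq_sym (negbTE kj) mulr0.
Qed.

(** The j-th entry of [Jz] is, up to sign, the coordinate paired with [z_j], and [X_j]
    differentiates only along [z_j] and [t]. *)
Lemma hder_Jz j q : hder j (Jz j) q 0.
Proof.
case: (split_ordP j) => i ->.
  rewrite (_ : Jz _ = zc (rshift n i)).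
    by apply: hder_eq (hder_zc _ _ _) _; rewrite eq_lrshift.
  by apply/funext => x; rewrite Jz_lshift.
rewrite (_ : Jz _ = fun q => (-1) * zc (lshift n i) q).
  by apply: hder_eq (hderZ _ (hder_zc _ _ _)) _; rewrite eq_rlshift mulr0.
by apply/funext => x; rewrite Jz_rshift mulN1r.
Qed.

Lemma hder_hcoef j q : 0 < sqn q -> hder j (hcoef j) q
  (4 * gamma * (gamma - 1) * sqn q `^ (gamma - 2) * (Jz j q * zc j q)).
Proof.
move=> N0.
have := hderZ (2 * gamma) (hderM (hder_Jz j q)
  (hder_comp (hder_sqn j q) (is_derive1_powR (gamma - 1) N0))).
rewrite (_ : (fun q => _) = hcoef j); last first.
  by apply/funext => x; rewrite /hcoef !mulrA.
move=> h; apply: hder_eq h _.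
by rewrite (_ : gamma - 1 - 1 = gamma - 2); [ring|ring].
Qed.

Lemma sum_hcoef_zc q : \sum_j hcoef j q * zc j q = 0.
Proof.
rewrite (eq_bigr (fun j => 2 * gamma * sqn q `^ (gamma - 1) * (Jz j q * zc j q))).
  by rewrite -mulr_sumr sum_Jz_zc mulr0.
by move=> j _; rewrite /hcoef; ring.
Qed.

Lemma sum_hcoef_sqr q : 0 < sqn q ->
  \sum_j hcoef j q ^+ 2 = 4 * gamma ^+ 2 * sqn q `^ (2 * gamma - 1).
Proof.
move=> N0; rewrite (eq_bigr (fun j => 4 * gamma ^+ 2 * (sqn q `^ (gamma - 1)) ^+ 2 * Jz j q ^+ 2)).
  rewrite -mulr_sumr sum_Jz_sqr -mulrA; congr (_ * _).
  rewrite -powR_mulrn ?powR_ge0// -powRrM -[X in _ * X]powRr1 ?ltW// -powRD.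
    by congr (_ `^ _); ring.
  by apply/implyP => _; rewrite gt_eqF.
by move=> j _; rewrite /hcoef; ring.
Qed.

Lemma continuous_zc j : continuous (zc j).
Proof. exact: coord_continuous. Qed.

Lemma continuous_tc : continuous tc.
Proof. exact: coord_continuous. Qed.

Lemma continuous_sqn : continuous sqn.
Proof.
move=> q; apply: (@Ck_sum R _ unit (fun=> 0) setT openT 0 _ _
  (fun j q => zc j q ^+ 2)) => // j {}q _.
rewrite (_ : (fun q => _) = (fun q => zc j q * zc j q)).
  exact: (cvgM (@continuous_zc j q) (@continuous_zc j q)).
by apply/funext => x; rewrite expr2.
Qed.

Lemma open_sqn_gt0 : open [set q | 0 < sqn q].
Proof.
rewrite (_ : [set q | _] = sqn @^-1` `]0, +oo[).
  by apply: open_comp; [move=> q _; exact: continuous_sqn | exact: rray_open].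
by apply/seteqP; split => q /=; rewrite in_itv/= andbT.
Qed.

End horizontal.

(** * Functions of [|z|] and [t]: gradient and operator *)

Section radial.
Context (R : realType) (n : nat) (gamma : R).
Hypothesis gamma_ge1 : 1 <= gamma.
Implicit Types (q : 'rV[R]_(n + n + 1)) (u : 'rV[R]_(n + n + 1) -> R).
Implicit Types (j : 'I_(n + n)).

Local Notation N := (@sqn R n).
Local Notation t := (@tc R n).
Local Notation zc := (@zc R n).
Local Notation hcoef := (@hcoef R n gamma).

Let g0 : gamma != 0. Proof. by rewrite gt_eqF// (lt_le_trans ltr01). Qed.

Lemma hder_radius j (h h1 : R -> R) q : is_derive (N q) 1 h (h1 (N q)) ->
  hder gamma j (fun q => h (N q) + t q ^+ 2) q
    (2 * h1 (N q) * zc j q + 2 * t q * hcoef j q).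
Proof.
move=> hh1; rewrite (_ : (fun q => _) = (fun q => h (N q) + t q * t q)).
  apply: hder_eq (hderD (hder_comp (hder_sqn gamma j q) hh1)
    (hderM (hder_tc gamma j q) (hder_tc gamma j q))) _.
  by ring.
by apply/funext => x; rewrite expr2.
Qed.

Lemma sum_radial_sqr (a b : R) q : 0 < N q ->
  \sum_j (a * zc j q + b * hcoef j q) ^+ 2 =
  a ^+ 2 * N q + b ^+ 2 * (4 * gamma ^+ 2 * N q `^ (2 * gamma - 1)).
Proof.
move=> N0; rewrite (eq_bigr (fun j => a ^+ 2 * zc j q ^+ 2 + b ^+ 2 * hcoef j q ^+ 2 +
    2 * a * b * (hcoef j q * zc j q))); last by move=> j _; ring.
by rewrite !big_split/= -!mulr_sumr sum_hcoef_zc mulr0 addr0 sum_hcoef_sqr.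
Qed.

Lemma sum_sqn_cst (a b : R) q : \sum_j (a * zc j q ^+ 2 + b) = a * N q + 2 * n%:R * b.
Proof.
rewrite big_split/= -mulr_sumr; congr (_ + _).
by rewrite sumr_const card_ord -[b *+ _]mulr_natl natrD; ring.
Qed.

Section operator.
Variables F F1 F2 h h1 h2 : R -> R.
Let r q := h (N q) + t q ^+ 2.
Hypothesis hh1 : forall x : R, 0 < x -> is_derive x 1 h (h1 x).
Hypothesis hh2 : forall x : R, 0 < x -> is_derive x 1 h1 (h2 x).
Hypothesis FF1 : forall q, 0 < N q -> is_derive (r q) 1 F (F1 (r q)).
Hypothesis FF2 : forall q, 0 < N q -> is_derive (r q) 1 F1 (F2 (r q)).

Lemma hfield_radial j q : 0 < N q -> hfield gamma j (fun q => F (r q)) q =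
  F1 (r q) * (2 * h1 (N q) * zc j q + 2 * t q * hcoef j q).
Proof.
move=> N0; apply: hderE.
exact: hder_comp (hder_radius j (hh1 N0)) (FF1 N0).
Qed.

(** [h] stays abstract because the formula serves twice: with [h x = x^(2 gamma)] for the powers of
    [rho], and with the flattened [hcut] for the test functions. The mixed terms drop out by
    orthogonality of [z] and [Jz]. *)
Lemma greiner_op_radial q : 0 < N q -> greiner_op gamma (fun q => F (r q)) q =
  F2 (r q) * (4 * h1 (N q) ^+ 2 * N q
              + 16 * gamma ^+ 2 * N q `^ (2 * gamma - 1) * t q ^+ 2)
  + F1 (r q) * (4 * h2 (N q) * N q + 4 * n%:R * h1 (N q)
              + 8 * gamma ^+ 2 * N q `^ (2 * gamma - 1)).
Proof.
move=> N0; rewrite greiner_opE.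
pose b := 4 * gamma * (gamma - 1) * N q `^ (gamma - 2).
pose G j q := 2 * h1 (N q) * zc j q + 2 * t q * hcoef j q.
have H j : hfield gamma j (hfield gamma j (fun q => F (r q))) q =
    F2 (r q) * G j q ^+ 2 + F1 (r q) * ((4 * h2 (N q) * zc j q ^+ 2 + 2 * h1 (N q))
      + 2 * hcoef j q ^+ 2 + 2 * t q * b * (Jz j q * zc j q)).
  apply: hderE.
  apply: (@hder_near _ _ _ _ (fun q => F1 (r q) * G j q)).
    move: (open_nbhs_nbhs (conj (@open_sqn_gt0 R n) N0)); apply: filterS => x x0.
    by rewrite hfield_radial.
  have d1 := hder_comp (hder_radius j (hh1 N0)) (FF2 N0).
  have d2 := hderM (hderZ 2 (hder_comp (hder_sqn gamma j q) (hh2 N0))) (hder_zc gamma j j q).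
  have d3 := hderM (hderZ 2 (hder_tc gamma j q)) (hder_hcoef gamma j N0).
  apply: hder_eq (hderM d1 (hderD d2 d3)) _.
  by rewrite eqxx mulr1 /G /b -/(r q); ring.
under eq_bigr do rewrite H.
rewrite big_split/= -!mulr_sumr; congr (_ * _ + _ * _).
  by rewrite sum_radial_sqr//; ring.
rewrite 2!big_split/= sum_sqn_cst -!mulr_sumr sum_Jz_zc mulr0 addr0.
by rewrite sum_hcoef_sqr//; ring.
Qed.

End operator.

(** This is [rho^(4 gamma)], that is [rho] before the root is taken; a power [rho^a] becomes
    [rad^(a / (4 gamma))]. *)
Definition rad q : R := N q `^ (2 * gamma) + t q ^+ 2.

Lemma rad_ge q : N q `^ (2 * gamma) <= rad q.
Proof. by rewrite lerDl sqr_ge0. Qed.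

Lemma rad_gt0 q : 0 < N q -> 0 < rad q.
Proof. by move=> N0; rewrite (lt_le_trans _ (rad_ge q))// powR_gt0. Qed.

Lemma rho_powR q a : rho gamma q `^ a = rad q `^ (a / (4 * gamma)).
Proof. by rewrite rhoE -/(rad q) -powRrM [_^-1 * a]mulrC. Qed.

Let is_derive_h (x : R) : 0 < x ->
  is_derive x 1 (fun x => x `^ (2 * gamma)) (2 * gamma * x `^ (2 * gamma - 1)).
Proof. by move=> x0; exact: is_derive1_powR. Qed.

Let is_derive_h1 (x : R) : 0 < x ->
  is_derive x 1 (fun x => 2 * gamma * x `^ (2 * gamma - 1))
    (2 * gamma * ((2 * gamma - 1) * x `^ (2 * gamma - 2))).
Proof.
move=> x0; have := is_derive1_powR (2 * gamma - 1) x0.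
rewrite (_ : _ - 1 - 1 = 2 * gamma - 2); last by ring.
by move=> ?; apply: is_deriveZ.
Qed.

Let is_derive_F (c al x : R) : 0 < x ->
  is_derive x 1 (fun x => c * x `^ al) (c * (al * x `^ (al - 1))).
Proof.
by move=> x0; have := is_derive1_powR al x0 => ?; apply: is_deriveZ.
Qed.

(** The last factor is [|grad rho|^2 rho^(a - 2)]: up to the coefficient [a (a + Q - 2)], powers of
    [rho] behave as radial powers do under a Laplacian in dimension [Q]. *)
Lemma greiner_op_power c a q : 0 < N q ->
  greiner_op gamma (fun q => c * rho gamma q `^ a) q =
  c * (a * (a + hdim n gamma - 2)) *
    (N q `^ (2 * gamma - 1) * rad q `^ (a / (4 * gamma) - 1)).
Proof.
move=> N0; set al := a / (4 * gamma).
have -> : (fun q => c * rho gamma q `^ a) = (fun q => c * rad q `^ al).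
  by apply/funext => x; rewrite rho_powR.
have FF1 x : 0 < N x -> is_derive (rad x) 1 (fun x => c * x `^ al)
    (c * (al * rad x `^ (al - 1))).
  by move=> x0; exact: is_derive_F (rad_gt0 x0).
have FF2 x : 0 < N x -> is_derive (rad x) 1 (fun x => c * (al * x `^ (al - 1)))
    (c * (al * ((al - 1) * rad x `^ (al - 2)))).
  move=> x0; have := is_derive_F (c * al) (al - 1) (rad_gt0 x0).
  rewrite (_ : al - 1 - 1 = al - 2); last by ring.
  by under eq_fun do rewrite -mulrA; rewrite -mulrA.
have -> := greiner_op_radial (F := fun x => c * x `^ al)
    (F1 := fun x => c * (al * x `^ (al - 1)))
    (F2 := fun x => c * (al * ((al - 1) * x `^ (al - 2))))
    is_derive_h is_derive_h1 FF1 FF2 N0.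
rewrite -/(rad q) (_ : a = 4 * gamma * al); last by rewrite /al; field.
have -> : rad q `^ (al - 1) = rad q * rad q `^ (al - 2).
  by apply: gt0_powRS; [exact: rad_gt0 | ring].
have -> : N q `^ (2 * gamma - 1) = N q * N q `^ (2 * gamma - 2).
  by apply: gt0_powRS => //; ring.
have E : rad q = N q ^+ 2 * N q `^ (2 * gamma - 2) + t q ^+ 2.
  by rewrite /rad -(gt0_powRSS (c := 2 * gamma))//; ring.
rewrite -/(rad q) /hdim; set X := rad q `^ (al - 2); rewrite E; ring.
Qed.

(** The closed form [|z|^(4 gamma - 2) / rho^(4 gamma - 2)] of [|grad rho|^2], valid where [z] is
    nonzero. *)
Definition weight q : R := N q `^ (2 * gamma - 1) * rad q `^ ((2 * gamma)^-1 - 1).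

Lemma weight_gt0 q : 0 < N q -> 0 < weight q.
Proof. by move=> N0; rewrite mulr_gt0// powR_gt0// rad_gt0. Qed.

Lemma enorm_grad_rho q : 0 < N q ->
  enorm (greiner_grad gamma (rho gamma) q) = Num.sqrt (weight q).
Proof.
move=> N0; rewrite enorm_greiner_grad; congr Num.sqrt.
set al := (4 * gamma)^-1.
have -> : rho gamma = (fun q => 1 * rad q `^ al).
  by apply/funext => x; rewrite rhoE mul1r.
have FF1 x : 0 < N x -> is_derive (rad x) 1 (fun x => 1 * x `^ al)
    (1 * (al * rad x `^ (al - 1))).
  by move=> x0; exact: is_derive_F (rad_gt0 x0).
under eq_bigr => j _.
  rewrite (hfield_radial (F := fun x => 1 * x `^ al)
    (F1 := fun x => 1 * (al * x `^ (al - 1))) is_derive_h FF1 j N0).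
  rewrite exprMn; over.
rewrite -/(rad q) -mulr_sumr sum_radial_sqr// /weight.
have -> : rad q `^ ((2 * gamma)^-1 - 1) = (rad q `^ (al - 1)) ^+ 2 * rad q.
  rewrite -powR_mulrn ?powR_ge0// -powRrM [RHS]mulrC.
  by apply: gt0_powRS; [exact: rad_gt0 | rewrite /al; field].
have -> : N q `^ (2 * gamma - 1) = N q * N q `^ (2 * gamma - 2).
  by apply: gt0_powRS => //; ring.
have E : rad q = N q ^+ 2 * N q `^ (2 * gamma - 2) + t q ^+ 2.
  by rewrite /rad -(gt0_powRSS (c := 2 * gamma))//; ring.
set X := rad q `^ (al - 1); rewrite E /al; field.
exact: g0.
Qed.

Lemma enorm_grad_rho_sqr q : 0 < N q ->
  enorm (greiner_grad gamma (rho gamma) q) ^+ 2 = weight q.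
Proof. by move=> N0; rewrite enorm_grad_rho// sqr_sqrtr// ltW// weight_gt0. Qed.

Lemma enorm_grad_rho_powR q s : 0 < N q ->
  enorm (greiner_grad gamma (rho gamma) q) `^ (- (2 * s)) = weight q `^ (- s).
Proof.
move=> N0; rewrite enorm_grad_rho// -powR12_sqrt ?ltW ?weight_gt0// -powRrM.
by congr (_ `^ _); field.
Qed.

End radial.

(** * Closed forms of the two integrands, and the equality case *)

Section integrands.
Context (R : realType) (n : nat) (gamma p theta : R).
Hypotheses (n_gt0 : (0 < n)%N) (gamma_ge1 : 1 <= gamma).
Implicit Types (q : 'rV[R]_(n + n + 1)) (u : 'rV[R]_(n + n + 1) -> R).
Implicit Types (A : set 'rV[R]_(n + n + 1)).

Local Notation N := (@sqn R n).
Local Notation mu := (lebesgue_rV (n + n + 1)).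

Let g0 : gamma != 0. Proof. by rewrite gt_eqF// (lt_le_trans ltr01). Qed.

(** A null set containing [z = 0]. The coordinate [x_1] is the one of index 0, for which the null
    measure was computed. *)
Definition hyper0 : set 'rV[R]_(n + n + 1) :=
  [set q | q ord0 (idx_x (Ordinal n_gt0)) = 0].

Lemma hyper0_null : mu hyper0 = 0%E.
Proof. exact: lebesgue_rV_hyperplane. Qed.

Lemma measurable_hyper0 : measurable hyper0.
Proof.
rewrite (_ : hyper0 = setT `&` (fun q => q ord0 (idx_x (Ordinal n_gt0))) @^-1` [set 0]).
  by apply: measurable_coor => //; exact: measurable_set1.
by rewrite setTI.
Qed.

Lemma sqn_gt0 q : ~ hyper0 q -> 0 < N q.
Proof.
move=> qH; apply: lt_le_trans (zc_sqr_le_sqn (lshift n (Ordinal n_gt0)) q).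
by rewrite exprn_even_gt0//; apply/eqP.
Qed.

Definition lhs_density q : R :=
  weight gamma q * rad gamma q `^ (- (p * (theta + 2) / (4 * gamma))).
Definition rhs_density q : R :=
  rad gamma q `^ (- (p * theta / (4 * gamma))) * weight gamma q `^ (- (p - 1)).

Lemma lhs_density_ge0 q : 0 <= lhs_density q.
Proof. by rewrite !mulr_ge0// powR_ge0. Qed.

Lemma rhs_density_ge0 q : 0 <= rhs_density q.
Proof. by rewrite mulr_ge0// powR_ge0. Qed.

Lemma rellich_lhsE A u : rellich_lhs gamma p theta A u =
  (\int[mu]_(q in A) (`|u q| `^ p * lhs_density q)%:E)%E.
Proof.
apply: (ge0_eq_integral_off measurable_hyper0 hyper0_null).
- by move=> q; rewrite lee_fin mulr_ge0 ?sqr_ge0// divr_ge0// powR_ge0.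
- by move=> q; rewrite lee_fin mulr_ge0 ?powR_ge0// lhs_density_ge0.
- move=> q _ /sqn_gt0 N0; rewrite enorm_grad_rho_sqr// rho_powR -powRN.
  by rewrite -mulrA [_ `^ _ * weight _ _]mulrC.
Qed.

Lemma rellich_rhsE A u : rellich_rhs gamma p theta A u =
  (\int[mu]_(q in A) (`|greiner_op gamma u q| `^ p * rhs_density q)%:E)%E.
Proof.
apply: (ge0_eq_integral_off measurable_hyper0 hyper0_null).
- by move=> q; rewrite lee_fin mulr_ge0 ?powR_ge0// divr_ge0// powR_ge0.
- by move=> q; rewrite lee_fin mulr_ge0 ?powR_ge0// rhs_density_ge0.
- move=> q _ /sqn_gt0 N0; rewrite enorm_grad_rho_powR// rho_powR -powRN.
  by rewrite mulrA.
Qed.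

Lemma measurable_sqn D : measurable_fun D (N : _ -> measurableTypeR R).
Proof.
apply: measurable_funTS; apply: continuous_measurable_rV; first exact: openT.
by move=> q _; exact: continuous_sqn.
Qed.

Lemma measurable_rad D : measurable_fun D (@rad R n gamma : _ -> measurableTypeR R).
Proof.
apply: measurable_funD.
  by apply: (measurableT_comp (measurable_powR _)); exact: measurable_sqn.
by apply: measurable_funX; apply: measurable_funTS; exact: measurable_coor.
Qed.

Lemma measurable_rad_powR D a :
  measurable_fun D (fun q => rad gamma q `^ a : measurableTypeR R).
Proof. by apply: (measurableT_comp (measurable_powR _)); exact: measurable_rad. Qed.

Lemma measurable_weight D : measurable_fun D (@weight R n gamma : _ -> measurableTypeR R).
Proof.
apply: measurable_funM; last exact: measurable_rad_powR.
apply: (measurableT_comp (measurable_powR _)); exact: measurable_sqn.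
Qed.

Lemma measurable_lhs_density D : measurable_fun D (lhs_density : _ -> measurableTypeR R).
Proof.
by apply: measurable_funM; [exact: measurable_weight|exact: measurable_rad_powR].
Qed.

Lemma measurable_rhs_density D : measurable_fun D (rhs_density : _ -> measurableTypeR R).
Proof.
apply: measurable_funM; first exact: measurable_rad_powR.
by apply: (measurableT_comp (measurable_powR _)); exact: measurable_weight.
Qed.

Lemma lhs_integrand_ge0 u q : (0 <= (`|u q| `^ p * lhs_density q)%:E)%E.
Proof. by rewrite lee_fin mulr_ge0 ?powR_ge0 ?lhs_density_ge0. Qed.

Lemma rhs_integrand_ge0 u q : (0 <= (`|u q| `^ p * rhs_density q)%:E)%E.
Proof. by rewrite lee_fin mulr_ge0 ?powR_ge0 ?rhs_density_ge0. Qed.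

Lemma measurable_norm_powR D u : measurable_fun D (u : _ -> measurableTypeR R) ->
  measurable_fun D (fun q => `|u q| `^ p : measurableTypeR R).
Proof.
move=> mu_; apply: (measurableT_comp (measurable_powR p)).
exact: measurableT_comp.
Qed.

Lemma measurable_lhs_integrand D u : measurable_fun D (u : _ -> measurableTypeR R) ->
  measurable_fun D (fun q => (`|u q| `^ p * lhs_density q)%:E).
Proof.
move=> mu_; apply/measurable_EFinP; apply: measurable_funM; last exact: measurable_lhs_density.
exact: measurable_norm_powR.
Qed.

(* [D] is the density of the scale invariant measure [|grad rho|^2 rho^-Q]. *)
Definition hdensity q : R :=
  N q `^ (2 * gamma - 1) * rad gamma q `^ (- (hdim n gamma / (4 * gamma) + 1 - (2 * gamma)^-1)).

Hypothesis p_ge2 : 2 <= p.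

Let p0 : p != 0. Proof. by rewrite gt_eqF// (lt_le_trans _ p_ge2). Qed.

Definition crit_exp : R := (p * (theta + 2) - hdim n gamma) / p.

(** At the critical exponent the powers of [rho] combine into [hdensity]. The same density results
    on the other side in [rhs_densityE], which is why the two sides can be equal. *)
Lemma lhs_densityE (x : R) q : 0 <= x -> 0 < N q ->
  (x * rad gamma q `^ (crit_exp / (4 * gamma))) `^ p * lhs_density q = x `^ p * hdensity q.
Proof.
move=> x0 N0; have S0 := rad_gt0 gamma N0.
rewrite powRM ?powR_ge0// -mulrA; congr (_ * _).
rewrite /lhs_density /weight /hdensity -powRrM.
rewrite !powR_expR// -!expRD; congr expR; rewrite /crit_exp; field.
by rewrite g0 p0.
Qed.

Lemma rhs_densityE (x : R) q : 0 <= x -> 0 < N q ->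
  (x * (N q `^ (2 * gamma - 1) * rad gamma q `^ (crit_exp / (4 * gamma) - 1))) `^ p *
    rhs_density q = x `^ p * hdensity q.
Proof.
move=> x0 N0; have S0 := rad_gt0 gamma N0.
rewrite powRM ?mulr_ge0 ?powR_ge0// -mulrA; congr (_ * _).
rewrite /rhs_density /weight /hdensity !powRM ?powR_ge0// -!powRrM.
rewrite !powR_expR// -!expRD; congr expR; rewrite /crit_exp; field.
by rewrite g0 p0.
Qed.

Let K := (hdim n gamma - p * (theta + 2)) * (p * theta + hdim n gamma * (p - 1)) / p ^+ 2.

Hypothesis const_ge0 : 0 <= (hdim n gamma - p * (theta + 2)) *
                      (p * theta + hdim n gamma * (p - 1)).

Lemma rellich_K_ge0 : 0 <= K.
Proof. by rewrite divr_ge0// sqr_ge0. Qed.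

Lemma crit_expE : crit_exp * (crit_exp + hdim n gamma - 2) = - K.
Proof. by rewrite /crit_exp /K; field. Qed.

(** The integrands coincide off [hyper0], so the identity holds over every measurable [A]; letting
    [A] vary gives it content although the integrals over the whole space may diverge. *)
Theorem rellich_equality (c : R) A : measurable A ->
  let v := fun q => c * rho gamma q `^ crit_exp in
  ((rellich_const n gamma p theta)%:E * rellich_lhs gamma p theta A v
   = rellich_rhs gamma p theta A v)%E.
Proof.
move=> mA v; rewrite rellich_lhsE rellich_rhsE -ge0_integralZl//; last 3 first.
- apply: measurable_lhs_integrand.
  apply: measurable_funM => //.
  rewrite (_ : (fun _ => _) = (fun q => rad gamma q `^ (crit_exp / (4 * gamma)))).
    exact: measurable_rad_powR.
  by apply/funext => q; rewrite rho_powR.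
- by move=> q _; exact: lhs_integrand_ge0.
- by rewrite lee_fin powR_ge0.
apply: (ge0_eq_integral_off measurable_hyper0 hyper0_null).
- by move=> q; rewrite mule_ge0 ?lhs_integrand_ge0// lee_fin powR_ge0.
- by move=> q; exact: rhs_integrand_ge0.
move=> q _ /sqn_gt0 N0; rewrite /v greiner_op_power// crit_expE -EFinM; congr EFin.
rewrite rho_powR !normrM normrN (ger0_norm rellich_K_ge0).
rewrite !(ger0_norm (powR_ge0 _ _)).
rewrite lhs_densityE// (rhs_densityE (mulr_ge0 (normr_ge0 c) rellich_K_ge0) N0).
by rewrite (@powRM _ `|c| K) ?rellich_K_ge0// mulrA [_ * `|c| `^ p]mulrC.
Qed.

End integrands.

(** * Regularity of the horizontal fields *)

Section signed_power.
Context (R : realType).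
Implicit Types x p r : R.

Definition spow p x : R := `|x| `^ (p - 2) * x.

(** Trades the norm, not differentiable at 0, for a power of a smooth nonnegative function. *)
Lemma norm_powR_sqr x r : `|x| `^ r = (x ^+ 2) `^ (r / 2).
Proof.
rewrite -[in RHS]real_normK ?num_real// -powR_mulrn// -powRrM.
by congr (_ `^ _); field.
Qed.

Lemma is_derive_sqr x : is_derive x 1 (fun y : R => y ^+ 2) (2 * x).
Proof.
rewrite (_ : (fun y => _) = id * id); last by apply/funext => y; rewrite expr2.
apply: is_derive_eq (is_deriveM (is_derive_id x 1) (is_derive_id x 1)) _.
by rewrite /GRing.scale/= !mulr1 mulr2n mulrDl mul1r.
Qed.

Lemma is_derive_norm_powR p x : 2 <= p ->
  is_derive x 1 (fun y => `|y| `^ p) (p * spow p x).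
Proof.
move=> p2; under eq_fun do rewrite norm_powR_sqr.
have p1 : 1 <= p / 2 by rewrite ler_pdivlMr// mul1r.
have H := ge0_is_derive_powR (fun y : R => sqr_ge0 y) p1 (is_derive_sqr x).
apply: is_derive_eq H _; rewrite /spow norm_powR_sqr (_ : p / 2 - 1 = (p - 2) / 2); last by field.
by field.
Qed.

Lemma is_derive_spow p x : 2 <= p ->
  is_derive x 1 (spow p) ((p - 1) * `|x| `^ (p - 2)).
Proof.
move=> p2; have [->|x0] := eqVneq x 0.
  have q0 : 0 <= p - 2 by rewrite subr_ge0.
  have H : h^-1 *: (spow p (h *: 1 + 0) - spow p 0) @[h --> (0 : R)^'] -->
      (p - 1) * `|0 : R| `^ (p - 2).
    have -> : (p - 1) * `|0 : R| `^ (p - 2) = `|0 : R| `^ (p - 2).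
      rewrite normr0; have [->|p2'] := eqVneq p 2; first by ring.
      by rewrite powR0 ?subr_eq0// mulr0.
    apply: (@cvg_trans _ (`|h| `^ (p - 2) @[h --> (0 : R)^'])).
      apply: near_eq_cvg; near=> h.
      have h0 : h != 0 by near: h; exact: nbhs_dnbhs_neq.
      rewrite /spow mulr0 subr0 addr0 /GRing.scale/= mulr1.
      by rewrite mulrCA mulVf// mulr1.
    apply: ge0_cvg_powR => // A HA; apply: nbhs_dnbhs.
    exact: (@norm_continuous _ R (0 : R) A HA).
  by apply: DeriveDef; [apply/cvg_ex; eexists; exact: H | exact: cvg_lim].
have x20 : 0 < x ^+ 2 by rewrite exprn_even_gt0.
rewrite /spow; under eq_fun do rewrite norm_powR_sqr.
have d1 := is_derive_comp1 (is_derive_sqr x) (is_derive1_powR ((p - 2) / 2) x20).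
have d2 := is_deriveM d1 (is_derive_id x 1).
apply: is_derive_eq d2 _; rewrite /GRing.scale/= mulr1 norm_powR_sqr.
have -> : (x ^+ 2) `^ ((p - 2) / 2) = x ^+ 2 * (x ^+ 2) `^ ((p - 2) / 2 - 1).
  by apply: gt0_powRS => //; ring.
by field.
Unshelve. all: by end_near. Qed.

Lemma Ck1_norm_powR p : 2 <= p -> Ck1 1 setT (fun x => `|x| `^ p).
Proof.
move=> p2; apply: (Ck1S openT (dg := fun x => p * spow p x)).
  by move=> x _; exact: is_derive_norm_powR.
move=> x _; have [d _] := is_derive_spow x p2.
have c : {for x, continuous (spow p)} by exact/differentiable_continuous/derivable1_diffP.
exact: (cvgM (cvg_cst _) c).
Qed.

Lemma Ck1_spow p : 2 <= p -> Ck1 1 setT (spow p).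
Proof.
move=> p2; apply: (Ck1S openT (dg := fun x => (p - 1) * `|x| `^ (p - 2))).
  by move=> x _; exact: is_derive_spow.
move=> x _; apply: (cvgM (cvg_cst _)).
have p0 : 0 <= p - 2 by rewrite subr_ge0.
rewrite /=; apply: (@ge0_cvg_powR R R (nbhs x) _ Num.norm `|x| (p - 2)) => //.
exact: (@norm_continuous _ R x).
Qed.

End signed_power.

Section smooth_Ck.
Context (R : realType) (m : nat).
Implicit Types (u : 'rV[R]_m -> R).

Definition axis (i : 'I_m) : 'rV[R]_m := delta_mx ord0 i.

Lemma smooth_partial i u : smooth u -> smooth (partial i u).
Proof.
move=> su s; have := su (rcons s i).
by rewrite foldr_rcons.
Qed.

Lemma smooth_Ck (I : Type) (s : I -> 'I_m) k u : smooth u -> Ck (axis \o s) k setT u.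
Proof.
elim: k u => [|k IH] u su /=.
  by move=> q _; have [c _] := su [::]; exact: c.
have [c d] := su [::]; split => [q _|i q _|i]; first exact: c.
- exact: d.
- exact/IH/smooth_partial.
Qed.

Lemma Ck_smooth u : (forall k, Ck axis k setT u) -> smooth u.
Proof.
move=> Cu s; elim/last_ind: s u Cu => [|s i IH] u Cu.
  by have [c d _] := Cu 1%N; split => [q|i q]; [exact: c | exact: d].
rewrite foldr_rcons; apply: IH => k.
by have [_ _ D] := Cu k.+1; exact: D.
Qed.

Lemma Ck_coord (I : Type) (s : I -> 'I_m) k O (l : 'I_m) : open O ->
  Ck (axis \o s) k O (fun q => q ord0 l).
Proof.
move=> oO; case: k => [|k]; first by move=> q _; exact: coord_continuous.
split => [q _|i q _|i]; first exact: coord_continuous.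
- by have [] := is_derive_coord q (s i) l.
- apply: (@Ck_eq _ _ _ _ _ oO k (fun=> (s i == l)%:R)); last exact: Ck_cst.
  by move=> q _; have [_ ->] := is_derive_coord q (s i) l.
Qed.

End smooth_Ck.

Section Ck_more.
Context (R : realType) (V : normedModType R) (I : Type) (e : I -> V).

Lemma Ck1_ge0_powR (O : set V) (f : V -> R) (r : R) : open O ->
  (forall x, 0 <= f x) -> 1 <= r -> Ck e 1 O f -> Ck e 1 O (fun x => f x `^ r).
Proof.
move=> oO f0 r1 Cf; have [c d D] := Cf.
have cr s : 0 <= s -> Ck e 0 O (fun x => f x `^ s).
  by move=> s0 q Oq; apply: ge0_cvg_powR => //; exact: c.
have H i q : O q -> is_derive q (e i) (fun x => f x `^ r) (r * f q `^ (r - 1) * 'D_(e i) f q).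
  by move=> Oq; apply: ge0_is_derive_powR => //; exact: derivableP (d i q Oq).
split => [||i]; first exact/cr/(le_trans ler01).
- by move=> i q Oq; have [] := H i q Oq.
- apply: (Ck_eq oO (f := fun q => r * f q `^ (r - 1) * 'D_(e i) f q)).
    by move=> q Oq; have [_ ->] := H i q Oq.
  have r0 : 0 <= r - 1 by rewrite subr_ge0.
  exact: (CkM oO (CkZ oO r (cr _ r0)) (D i)).
Qed.

(** Near [x] the function is constant, and the complement of [x] together with such a neighbourhood
    covers the space. *)
Lemma Ck_extend0 k (f : V -> R) (x : V) : Ck e k (~` [set x]) f ->
  (\forall y \near x, f y = 0) -> Ck e k setT f.
Proof.
move=> Cf /nbhs_interior/nbhs_singleton fx.
set U := interior [set y | f y = 0] in fx.
apply: (@Ck_sub _ _ _ _ _ ((~` [set x]) `|` U)).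
  by move=> y _; have [->|/eqP yx] := eqVneq y x; [right|left].
have oU : open U by exact: open_interior.
apply: Ck_setU => //; apply: (Ck_eq oU (f := fun=> 0)); last exact: Ck_cst.
by move=> y /interior_subset ->.
Qed.

End Ck_more.

Section horizontal_regularity.
Context (R : realType) (n : nat) (gamma : R).
Hypothesis gamma_ge1 : 1 <= gamma.
Variable j : 'I_(n + n).
Implicit Types (q : 'rV[R]_(n + n + 1)) (u : 'rV[R]_(n + n + 1) -> R).

Local Notation N := (@sqn R n).
Local Notation t := (@tc R n).
Local Notation zc := (@zc R n).
Local Notation hcoef := (@hcoef R n gamma).

(** The two directions in which [X_j] differentiates. Regularity is tracked only along them, and
    [Jz j] is constant in both. *)
Definition hdir (b : bool) : 'I_(n + n + 1) := if b then lshift 1 j else idx_t n.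

Local Notation Cj := (Ck (@axis R (n + n + 1) \o hdir)).

Lemma Ck_sqn (I : Type) (s : I -> 'I_(n + n + 1)) k : Ck (@axis R (n + n + 1) \o s) k setT N.
Proof.
apply: Ck_sum => [|i]; first exact: openT.
apply: (Ck_eq openT (f := fun q => zc i q * zc i q)) => [q _|]; first by rewrite expr2.
by apply: CkM; [exact: openT|exact/Ck_coord/openT|exact/Ck_coord/openT].
Qed.

Lemma Ck_Jz (I : Type) (s : I -> 'I_(n + n + 1)) k :
  Ck (@axis R (n + n + 1) \o s) k setT (@Jz R n j).
Proof.
rewrite /Jz; case: fintype.split => i; first exact/Ck_coord/openT.
apply: (Ck_eq openT (f := fun q => (-1) * q ord0 (idx_x i))) => [q _|].
  by rewrite mulN1r.
by apply: CkZ; [exact: openT | exact/Ck_coord/openT].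
Qed.

Lemma Jz_zc_le_sqn q : `|Jz j q * zc j q| <= N q.
Proof.
have h1 : Jz j q ^+ 2 <= N q.
  rewrite -sum_Jz_sqr (bigD1 j)//= lerDl; apply: sumr_ge0 => i _; exact: sqr_ge0.
have h2 := zc_sqr_le_sqn j q.
have s1 := sqr_ge0 (Jz j q - zc j q).
have s2 := sqr_ge0 (Jz j q + zc j q).
by rewrite ler_norml; apply/andP; split; nra.
Qed.

Let dh q := 4 * gamma * (gamma - 1) * N q `^ (gamma - 2) * (Jz j q * zc j q).

Lemma is_derive_hcoef_t q : is_derive q (axis R (idx_t n)) (hcoef j) 0.
Proof.
apply/is_derive_line; rewrite (_ : (fun h => _) = fun=> hcoef j q).
  exact: is_derive_cst.
apply/funext => h.
have E (i : 'I_(n + n)) : (h *: axis R (idx_t n) + q) ord0 (lshift 1 i) = q ord0 (lshift 1 i).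
  by rewrite !mxE eq_lrshift andbF mulr0 add0r.
rewrite /hcoef /sqn /zc /Jz; congr (_ * _ * _ `^ _).
  by case: fintype.split => i; rewrite E.
by apply: eq_bigr => i _; rewrite E.
Qed.

Lemma Jz_line q (h : R) : Jz j (h *: axis R (lshift 1 j) + q) = Jz j q.
Proof.
case: (split_ordP j) => i ->.
  by rewrite !Jz_lshift !mxE (inj_eq (@lshift_inj _ _)) eq_rlshift andbF mulr0 add0r.
by rewrite !Jz_rshift !mxE (inj_eq (@lshift_inj _ _)) eq_lrshift andbF mulr0 add0r.
Qed.

Lemma is_derive_hcoef q : is_derive q (axis R (lshift 1 j)) (hcoef j) (dh q).
Proof.
(* If [Jz j] vanishes at [q] it vanishes on the whole line along [z_j], and so does the coefficient;
   this covers the points with [z = 0]. Otherwise [0 < N q] and the rule for powers applies. *)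
have [J0|J0] := eqVneq (Jz j q) 0.
  rewrite /dh J0 mul0r mulr0; apply/is_derive_line.
  rewrite (_ : (fun h => _) = fun=> 0); first exact: is_derive_cst.
  by apply/funext => h; rewrite /hcoef Jz_line J0 mulr0 mul0r.
have N0 : 0 < N q.
  rewrite -sum_Jz_sqr (bigD1 j)//= ltr_wpDr//; first by apply: sumr_ge0 => i _; exact: sqr_ge0.
  by rewrite exprn_even_gt0.
have [d1 [d2 [h1 h2 E]]] := hder_hcoef gamma j N0.
have d20 : d2 = 0.
  by have [_ <-] := h2; have [_ ->] := is_derive_hcoef_t q.
by rewrite /dh E d20 mulr0 addr0.
Qed.

(** At [z = 0] the power [N^(gamma - 2)] may blow up, but [|Jz j * zc j| <= N] bounds [dh] by a
    multiple of [N^(gamma - 1)], which tends to 0 if [1 < gamma]. For [gamma = 1] the factor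
    [gamma - 1] makes [dh] vanish identically. *)
Lemma continuous_dh : continuous dh.
Proof.
have cN := @continuous_sqn R n.
have cJz : continuous (fun q => Jz j q * zc j q).
  move=> q; have /Ck_continuous := Ck_Jz (fun _ : unit => idx_t n) 0.
  by move=> /(_ q I) c; exact: (cvgM c (@continuous_zc R n j q)).
move=> q; have [N0|N0] := eqVneq (N q) 0; last first.
  have {}N0 : 0 < N q by rewrite lt_neqAle eq_sym N0 sqn_ge0.
  apply: (cvgM _ (cJz q)); apply: (cvgM (cvg_cst _)).
  have [d _] := is_derive1_powR (gamma - 2) N0.
  have c : {for N q, continuous (fun x : R => x `^ (gamma - 2))}.
    exact/differentiable_continuous/derivable1_diffP.
  exact: (cvg_comp _ _ (cN q) c).
have [g1|g1] := eqVneq gamma 1.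
  rewrite (_ : dh = fun=> 0); first exact: cst_continuous.
  by apply/funext => x; rewrite /dh g1 subrr mulr0 !mul0r.
have {}g1 : 0 < gamma - 1 by rewrite subr_gt0 lt_neqAle eq_sym g1.
have dh0 : dh q = 0.
  apply/eqP; rewrite /dh mulf_eq0; apply/orP; right; rewrite -normr_le0 -N0.
  exact: Jz_zc_le_sqn.
have dhN x : `|dh x| <= 4 * gamma * (gamma - 1) * N x `^ (gamma - 1).
  have c0 : 0 <= 4 * gamma * (gamma - 1).
    by apply: mulr_ge0; [apply: mulr_ge0 => //; exact: le_trans gamma_ge1|exact: ltW].
  rewrite /dh normrM normrM (ger0_norm c0) (ger0_norm (powR_ge0 _ _)) -mulrA ler_wpM2l//.
  have [x0|x0] := eqVneq (N x) 0.
    by rewrite x0 (le_trans (ler_wpM2l (powR_ge0 _ _) (Jz_zc_le_sqn x)))// x0 mulr0 powR_ge0.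
  have {}x0 : 0 < N x by rewrite lt_neqAle eq_sym x0 sqn_ge0.
  rewrite (gt0_powRS (c := gamma - 1) (a := gamma - 2) x0); last by ring.
  by rewrite mulrC ler_wpM2r ?powR_ge0// Jz_zc_le_sqn.
have H : 4 * gamma * (gamma - 1) * N x `^ (gamma - 1) @[x --> q] --> (0 : R).
  have -> : (0 : R) = 4 * gamma * (gamma - 1) * N q `^ (gamma - 1).
    by rewrite N0 powR0 ?mulr0// gt_eqF.
  exact: (cvgM (cvg_cst _) (ge0_cvg_powR _ (@sqn_ge0 R n) (ltW g1) (cN q))).
rewrite /continuous_at dh0.
have nr : \forall x \near q, (0 : R) <= `|dh x| <= 4 * gamma * (gamma - 1) * N x `^ (gamma - 1).
  by near=> x; rewrite normr_ge0 dhN.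
exact: (norm_cvg0 (squeeze_cvgr nr (cvg_cst (0 : R)) H)).
Unshelve. all: by end_near. Qed.

Lemma Ck1_hcoef : Cj 1 setT (hcoef j).
Proof.
split.
- have g1 : 0 <= gamma - 1 by rewrite subr_ge0.
  have CN : Cj 0 setT (fun q => N q `^ (gamma - 1)).
    by move=> q _; exact: (ge0_cvg_powR _ (@sqn_ge0 R n) g1 (@continuous_sqn R n q)).
  exact: (CkM openT (CkZ openT (2 * gamma) (Ck_Jz hdir 0)) CN).
- move=> [] q _.
    by have [] := is_derive_hcoef q.
  by have [] := is_derive_hcoef_t q.
- move=> [] q _.
    rewrite (_ : 'D__ _ = dh); first exact: continuous_dh.
    by apply/funext => x; have [_ <-] := is_derive_hcoef x.
  rewrite (_ : 'D__ _ = fun=> 0); first exact: cst_continuous.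
  by apply/funext => x; have [_ <-] := is_derive_hcoef_t x.
Qed.

Lemma Ck1_hfield u : smooth u -> Cj 1 setT (hfield gamma j u).
Proof.
move=> su; apply: CkD => //; first exact: openT.
  exact/smooth_Ck/smooth_partial.
by apply: CkM => //; [exact: openT | exact: Ck1_hcoef | exact/smooth_Ck/smooth_partial].
Qed.

Lemma Ck1_sqn_powR r : 1 <= r -> Cj 1 setT (fun q => N q `^ r).
Proof.
by move=> r1; apply: Ck1_ge0_powR => //; [exact: openT|exact: sqn_ge0|exact: Ck_sqn].
Qed.

Lemma Ck1_rad : Cj 1 setT (@rad R n gamma).
Proof.
have g1 : 1 <= 2 * gamma by move: gamma_ge1; lra.
have Ct : Cj 1 setT (fun q => t q ^+ 2).
  apply: (Ck_eq openT (f := fun q => t q * t q)) => [q _|]; first by rewrite expr2.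
  by apply: CkM; [exact: openT|exact/Ck_coord/openT|exact/Ck_coord/openT].
exact: (CkD openT (Ck1_sqn_powR g1) Ct).
Qed.

Lemma neq0_rad_gt0 q : q != 0 -> 0 < rad gamma q.
Proof.
move=> q0; have [N0|N0] := eqVneq (N q) 0; last first.
  by apply: rad_gt0; rewrite lt_neqAle eq_sym N0 sqn_ge0.
have [t0|t0] := eqVneq (t q) 0; last first.
  by rewrite ltr_wpDl ?powR_ge0// exprn_even_gt0.
move/eqP: q0; case; apply/rowP => i; rewrite mxE.
case: (split_ordP i) => k ->; last by rewrite ord1.
apply/eqP; rewrite -sqrf_eq0 eq_le sqr_ge0 andbT -N0.
exact: zc_sqr_le_sqn.
Qed.

Lemma open_neq0 : open (~` [set (0 : 'rV[R]_(n + n + 1))]).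
Proof.
apply: closed_openC; apply: accessible_closed_set1; apply: hausdorff_accessible.
exact: norm_hausdorff.
Qed.

Lemma Ck1_rad_powR b : Cj 1 (~` [set 0]) (fun q => rad gamma q `^ b).
Proof.
have oI : open (`]0, +oo[%classic : set R) by exact: rray_open.
have H q : (~` [set 0]) q -> (`]0, +oo[%classic : set R) (rad gamma q).
  by move=> /eqP q0; rewrite /= in_itv/= andbT neq0_rad_gt0.
exact: (Ck_comp open_neq0 oI H (Ck1_powR 1 b) (Ck_sub (@subsetT _ _) Ck1_rad)).
Qed.

End horizontal_regularity.

(** * The inequality *)

Section divergence.
Context (R : realType) (n : nat) (gamma : R).
Hypothesis gamma_ge1 : 1 <= gamma.
Implicit Types (q : 'rV[R]_(n + n + 1)) (u W : 'rV[R]_(n + n + 1) -> R).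
Implicit Types (j : 'I_(n + n)).
Local Notation mu := (lebesgue_rV (n + n + 1)).

Lemma continuous_hfield j W :
  Ck (@axis R (n + n + 1) \o hdir j) 1 setT W -> continuous (hfield gamma j W).
Proof.
move=> [_ _ D] q.
have Cc := Ck_pred (Ck1_hcoef gamma_ge1 j).
have D1 : Ck (@axis R (n + n + 1) \o hdir j) 0 setT (partial (lshift 1 j) W) := D true.
have D2 : Ck (@axis R (n + n + 1) \o hdir j) 0 setT (partial (idx_t n) W) := D false.
have H : Ck (@axis R (n + n + 1) \o hdir j) 0 setT (hfield gamma j W).
  exact: (CkD openT D1 (CkM openT Cc D2)).
exact: (H q I).
Qed.

(** As [hcoef j] does not depend on [t], it can be moved under the derivative in [t]; [X_j W] is
    then a sum of two partial derivatives of C^1 functions with bounded support. *)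
Lemma integral_hfield j W B :
  Ck (@axis R (n + n + 1) \o hdir j) 1 setT W -> (forall q, ~ cube B q -> W q = 0) ->
  mu.-integrable setT (fun q => (hfield gamma j W q)%:E) /\
  (\int[mu]_q (hfield gamma j W q)%:E = 0)%E.
Proof.
move=> CW W0; have [_ d D] := CW.
have Ch := Ck1_hcoef gamma_ge1 j.
have [_ dh Dh] := CkM openT Ch CW.
have D1 : continuous (partial (lshift 1 j) W) by move=> q; exact: (D true q I).
have D2 : continuous (partial (idx_t n) (fun q => hcoef gamma j q * W q)).
  by move=> q; exact: (Dh false q I).
have hW0 q : ~ cube B q -> hcoef gamma j q * W q = 0.
  by move=> /W0 ->; rewrite mulr0.
have E q : hfield gamma j W q = partial (lshift 1 j) W q +
    partial (idx_t n) (fun q => hcoef gamma j q * W q) q.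
  congr (_ + _); have h1 := is_derive_hcoef_t gamma j q.
  have h2 := derivableP (d false q I).
  have [_] := is_deriveM h1 h2; rewrite /partial => ->.
  by rewrite scaler0 addr0.
have i1 := integrable_cube D1 (fun q => partial_off_cube (lshift 1 j) W0).
have i2 := integrable_cube D2 (fun q => partial_off_cube (idx_t n) hW0).
have -> : (fun q => (hfield gamma j W q)%:E) =
    (fun q => (partial (lshift 1 j) W q)%:E) \+
    (fun q => (partial (idx_t n) (fun q => hcoef gamma j q * W q) q)%:E).
  by apply/funext => q; rewrite E EFinD.
split; first exact: integrableD.
rewrite integralD// (integral_partial_eq0 (fun q => d true q I) D1 W0).
by rewrite (integral_partial_eq0 (fun q => dh false q I) D2 hW0) adde0.
Qed.

Lemma test_fun_cube m (u : 'rV[R]_m -> R) : test_fun u ->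
  exists B, forall q : 'rV[R]_m, ~ cube B q -> u q = 0.
Proof.
move=> [_ /compact_bounded [M [Mr HM]] _]; exists (M + 1) => q qB.
apply/eqP; apply/negPn/negP => uq; apply: qB => i /=.
rewrite -ler_norml; apply: le_trans (HM (M + 1) _ q _).
- rewrite [leRHS]mx_normrE.
  exact: (le_bigmax _ (fun ij : 'I_1 * 'I_m => `|q ij.1 ij.2|) (ord0, i)).
- by rewrite ltrDl.
- exact: subset_closure.
Qed.

Lemma test_fun_near0 m (u : 'rV[R]_m -> R) : test_fun u ->
  \forall q \near (0 : 'rV[R]_m), u q = 0.
Proof.
move=> [_ _ u0]; have oU : open (~` tsupport u) by apply: closed_openC; exact: closed_closure.
move: (open_nbhs_nbhs (conj oU u0)); apply: filterS => q qU.
apply/eqP; apply/negPn/negP => uq; apply: qU; exact: subset_closure.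
Qed.

Lemma young_powR (p x z : R) : 1 < p -> 0 <= x -> 0 <= z ->
  p * x * z `^ (p - 1) <= x `^ p + (p - 1) * z `^ p.
Proof.
move=> p1 x0 z0; have p0 : 0 < p by rewrite (lt_trans _ p1).
have q0 : 0 < p - 1 by rewrite subr_gt0.
have := @conjugate_powR _ x (z `^ (p - 1)) p (p / (p - 1)) x0 (powR_ge0 _ _) p0 (divr_gt0 p0 q0).
rewrite -powRrM (_ : (p - 1) * (p / (p - 1)) = p); last by field; rewrite gt_eqF.
move=> /(_ _)/wrap[|h]; first by field; rewrite !gt_eqF.
rewrite -mulrA -ler_pdivlMl//; apply: le_trans h _.
rewrite le_eqVlt; apply/orP; left; apply/eqP; field.
by rewrite !gt_eqF.
Qed.

End divergence.

Section rellich_inequality.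
Context (R : realType) (n : nat) (gamma p theta : R).
Hypotheses (n_gt0 : (0 < n)%N) (gamma_ge1 : 1 <= gamma) (p_ge2 : 2 <= p).
Implicit Types (q : 'rV[R]_(n + n + 1)) (u : 'rV[R]_(n + n + 1) -> R).
Implicit Types (j : 'I_(n + n)).

Local Notation N := (@sqn R n).
Local Notation S := (@rad R n gamma).
Local Notation t := (@tc R n).
Local Notation zc := (@zc R n).
Local Notation hcoef := (@hcoef R n gamma).
Local Notation D := (lhs_density gamma p theta).

Let g0 : gamma != 0. Proof. by rewrite gt_eqF// (lt_le_trans ltr01). Qed.
Let p0 : p != 0. Proof. by rewrite gt_eqF// (lt_le_trans _ p_ge2). Qed.

Let b : R := 2 - p * (theta + 2).
Let b' : R := b / (4 * gamma).
Let M : R := hdim n gamma - p * (theta + 2).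
(** [kap] is chosen so that [b - kap p = 2 c (p - 1)], which is the cross term of the square. What
    then remains in front of [|u|^p D] is [- kap M - (p - 1) c^2], a quadratic in [c] with maximum
    [K] at [c = M / p]. *)
Let c : R := M / p.
Let kap : R := (b - 2 * c * (p - 1)) / p.
Let K : R := (hdim n gamma - p * (theta + 2)) * (p * theta + hdim n gamma * (p - 1)) / p ^+ 2.

(* [grad S / (4 gamma)] *)
Definition grad_rad j q : R :=
  zc j q * N q `^ (2 * gamma - 1) + t q * ((2 * gamma)^-1 * hcoef j q).

(* [rho ^ (b - 1) grad rho] with [b = 2 - p (theta + 2)]. *)
Definition hardy_field j q : R := S q `^ (b' - 1) * grad_rad j q.

Definition rellich_field u j q : R :=
  S q `^ b' * spow p (u q) * hfield gamma j u q - kap * (`|u q| `^ p * hardy_field j q).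

Lemma hder_rad j q : 0 < N q -> hder gamma j S q (4 * gamma * grad_rad j q).
Proof.
move=> N0.
have := hder_radius gamma j (h := fun x => x `^ (2 * gamma))
  (h1 := fun x => 2 * gamma * x `^ (2 * gamma - 1)) (is_derive1_powR (2 * gamma) N0).
move=> h; apply: hder_eq h _; rewrite /grad_rad; field.
exact: g0.
Qed.

Lemma sum_grad_rad_sqr q : 0 < N q ->
  \sum_j grad_rad j q ^+ 2 = N q `^ (2 * gamma - 1) * S q.
Proof.
move=> N0; rewrite /grad_rad.
under eq_bigr => j _ do rewrite [_ * _ `^ _]mulrC [in X in _ + X]mulrA.
rewrite sum_radial_sqr// /rad (gt0_powRSS (c := 2 * gamma) (a := 2 * gamma - 2) N0); last by ring.
rewrite (gt0_powRS (c := 2 * gamma - 1) (a := 2 * gamma - 2) N0); last by ring.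
by field.
Qed.

Lemma densityE q : 0 < N q -> D q = S q `^ (b' - 1) * N q `^ (2 * gamma - 1).
Proof.
move=> N0; have S0 := rad_gt0 gamma N0; rewrite /lhs_density /weight !powR_expR// -!expRD.
by congr expR; rewrite /b' /b; field.
Qed.

Lemma sum_hardy_field_sqr q : 0 < N q ->
  \sum_j hardy_field j q ^+ 2 = S q `^ b' * D q.
Proof.
move=> N0; have S0 := rad_gt0 gamma N0.
under eq_bigr do rewrite exprMn.
rewrite -mulr_sumr sum_grad_rad_sqr// densityE//.
rewrite (gt0_powRS (c := b') (a := b' - 1) S0); last by ring.
by ring.
Qed.

Lemma hder_hardy_field j q : 0 < N q -> hder gamma j (hardy_field j) q
  ((b' - 1) * (S q `^ (b' - 2) * (4 * gamma)) * grad_rad j q ^+ 2 +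
   S q `^ (b' - 1) * ((N q `^ (2 * gamma - 1) +
      2 * (2 * gamma - 1) * N q `^ (2 * gamma - 2) * zc j q ^+ 2) +
      (2 * gamma)^-1 * hcoef j q ^+ 2 +
      t q * ((2 * gamma)^-1 * (4 * gamma * (gamma - 1) * N q `^ (gamma - 2))) * (Jz j q * zc j q))).
Proof.
move=> N0; have S0 := rad_gt0 gamma N0.
have d1 := hder_comp (hder_rad j N0) (is_derive1_powR (b' - 1) S0).
have d2 := hderM (hder_zc gamma j j q)
  (hder_comp (hder_sqn gamma j q) (is_derive1_powR (2 * gamma - 1) N0)).
have d3 := hderM (hder_tc gamma j q) (hderZ (2 * gamma)^-1 (hder_hcoef gamma j N0)).
apply: hder_eq (hderM d1 (hderD d2 d3)) _.
rewrite eqxx mul1r (_ : 2 * gamma - 1 - 1 = 2 * gamma - 2); last by ring.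
rewrite (_ : b' - 1 - 1 = b' - 2); last by ring.
rewrite -/(grad_rad j q); ring.
Qed.

(** For [b <> 0] the field is [grad (rho^b) / b], and the formula for powers gives the factor
    [b + Q - 2 = M]. The direct computation includes [b = 0]. *)
Lemma sum_hfield_hardy_field q : 0 < N q ->
  \sum_j hfield gamma j (hardy_field j) q = M * D q.
Proof.
move=> N0; have S0 := rad_gt0 gamma N0.
under eq_bigr => j _ do rewrite (hderE (hder_hardy_field j N0)).
rewrite big_split/= -!mulr_sumr sum_grad_rad_sqr//.
rewrite 2!big_split/= -!mulr_sumr sum_Jz_zc mulr0 addr0 sum_hcoef_sqr//.
under eq_bigr => j _ do rewrite addrC.
rewrite sum_sqn_cst densityE//.
rewrite (gt0_powRS (c := b' - 1) (a := b' - 2) S0); last by ring.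
rewrite (gt0_powRS (c := 2 * gamma - 1) (a := 2 * gamma - 2) N0); last by ring.
by rewrite /b' /M /b /hdim; field.
Qed.

Lemma derivable_smooth u q i : smooth u -> derivable u q (axis R i).
Proof. by move=> su; have [_ d] := su [::]; exact: d. Qed.

Lemma hder_smooth j u q : smooth u -> hder gamma j u q (hfield gamma j u q).
Proof. by move=> su; apply: hder_hfield; exact: derivable_smooth. Qed.

Lemma hder_hfield_smooth j u q : smooth u ->
  hder gamma j (hfield gamma j u) q (hfield gamma j (hfield gamma j u) q).
Proof.
move=> su; have [_ d _] := Ck1_hfield gamma_ge1 j su.
by apply: hder_hfield; [exact: (d true q I)|exact: (d false q I)].
Qed.

Lemma hder_rellich_field u j q : smooth u -> 0 < N q ->
  hder gamma j (rellich_field u j) q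
    ((b - kap * p) * spow p (u q) * (hfield gamma j u q * hardy_field j q) +
     S q `^ b' * ((p - 1) * `|u q| `^ (p - 2)) * hfield gamma j u q ^+ 2 +
     S q `^ b' * spow p (u q) * hfield gamma j (hfield gamma j u) q
     - kap * `|u q| `^ p * hfield gamma j (hardy_field j) q).
Proof.
move=> su N0; have S0 := rad_gt0 gamma N0.
have du := hder_smooth j q su.
have d1 := hder_comp (hder_rad j N0) (is_derive1_powR b' S0).
have d2 := hder_comp du (is_derive_spow (u q) p_ge2).
have d3 := hder_comp du (is_derive_norm_powR (u q) p_ge2).
have d4 : hder gamma j (hardy_field j) q (hfield gamma j (hardy_field j) q).
  by rewrite (hderE (hder_hardy_field j N0)); exact: hder_hardy_field.
have d5 := hderM (hderM d1 d2) (hder_hfield_smooth j q su).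
apply: hder_eq (hderB d5 (hderZ kap (hderM d3 d4))) _.
rewrite (_ : b = 4 * gamma * b'); last by rewrite /b'; field.
by rewrite /hardy_field; ring.
Qed.

Let KE : K = - (b * M / p) + (p - 1) * c ^+ 2.
Proof. by rewrite /K /c /b /M; field. Qed.

(* Completing the square in [(S^b' grad u + c u V) ^ 2], where [V] is the
   Hardy field, is what produces the sharp constant. *)
Lemma divergence_rellich_field u q : smooth u -> 0 < N q ->
  S q `^ b' * spow p (u q) * greiner_op gamma u q + K * (`|u q| `^ p * D q)
  <= \sum_j hfield gamma j (rellich_field u j) q.
Proof.
move=> su N0; have S0 := rad_gt0 gamma N0.
under eq_bigr => j _ do rewrite (hderE (hder_rellich_field j su N0)).
rewrite big_split/= sumrN 2!big_split/= -!mulr_sumr sum_hfield_hardy_field//.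
rewrite -greiner_opE.
set m := \sum_j (_ * hardy_field j q).
set A := \sum_j hfield gamma j u q ^+ 2.
have sq : 0 <= S q `^ b' * A + 2 * c * u q * m + (c * u q) ^+ 2 * D q.
  have : 0 <= \sum_j (S q `^ b' * hfield gamma j u q + c * u q * hardy_field j q) ^+ 2.
    by apply: sumr_ge0 => j _; exact: sqr_ge0.
  rewrite (eq_bigr (fun j => (S q `^ b') ^+ 2 * hfield gamma j u q ^+ 2 +
     2 * c * u q * S q `^ b' * (hfield gamma j u q * hardy_field j q) +
     (c * u q) ^+ 2 * hardy_field j q ^+ 2)); last by move=> j _; ring.
  rewrite 2!big_split/= -!mulr_sumr -/m -/A sum_hardy_field_sqr// => h.
  rewrite -(pmulr_rge0 _ (powR_gt0 b' S0)); apply: le_trans h _.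
  by rewrite le_eqVlt; apply/orP; left; apply/eqP; ring.
have E0 : 0 <= (p - 1) * `|u q| `^ (p - 2).
  by rewrite mulr_ge0 ?powR_ge0// subr_ge0 (le_trans _ p_ge2)// ler1n.
have Eu : `|u q| `^ p = `|u q| `^ (p - 2) * u q ^+ 2.
  have [->|u0] := eqVneq (u q) 0; first by rewrite normr0 powR0// expr0n mulr0.
  rewrite (gt0_powRSS (c := p) (a := p - 2)) ?normr_gt0//; last by ring.
  by rewrite real_normK ?num_real// mulrC.
rewrite -subr_ge0; apply: le_trans (mulr_ge0 E0 sq) _.
rewrite le_eqVlt; apply/orP; left; apply/eqP.
by rewrite Eu KE /spow /kap /c; field.
Qed.

End rellich_inequality.

Section rellich_inequality_integrated.
Context (R : realType) (n : nat) (gamma p theta : R).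
Hypotheses (n_gt0 : (0 < n)%N) (gamma_ge1 : 1 <= gamma) (p_ge2 : 2 <= p).
Hypothesis const_ge0 : 0 <= (hdim n gamma - p * (theta + 2)) *
                      (p * theta + hdim n gamma * (p - 1)).
Implicit Types (q : 'rV[R]_(n + n + 1)) (u : 'rV[R]_(n + n + 1) -> R).
Implicit Types (j : 'I_(n + n)).

Local Notation mu := (lebesgue_rV (n + n + 1)).
Local Notation N := (@sqn R n).
Local Notation D := (lhs_density gamma p theta).
Local Notation W := (rellich_field gamma p theta).

Let g0 : gamma != 0. Proof. by rewrite gt_eqF// (lt_le_trans ltr01). Qed.
Let p1 : 1 < p. Proof. by rewrite (lt_le_trans _ p_ge2)// ltr1n. Qed.
Let p0 : 0 < p. Proof. exact: lt_trans p1. Qed.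

Let K : R := (hdim n gamma - p * (theta + 2)) * (p * theta + hdim n gamma * (p - 1)) / p ^+ 2.
Let K0 : 0 <= K. Proof. by rewrite divr_ge0// sqr_ge0. Qed.

Lemma rellich_field_off u j q : u q = 0 -> W u j q = 0.
Proof.
by move=> u0; rewrite /rellich_field u0 /spow !mulr0 mul0r normr0 powR0 ?gt_eqF// mul0r mulr0 subr0.
Qed.

(** The powers of [rad] are regular off the origin only, but [u], and with it the field, vanishes
    near the origin. *)
Lemma Ck1_rellich_field u j : test_fun u ->
  Ck (@axis R (n + n + 1) \o hdir j) 1 setT (W u j).
Proof.
move=> tu; have [su _ _] := tu.
apply: (@Ck_extend0 _ _ _ _ _ _ 0); last first.
  by apply: filterS (test_fun_near0 tu) => q; exact: rellich_field_off.
have oO := @open_neq0 R n.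
have g1 : 1 <= 2 * gamma - 1 by move: gamma_ge1; lra.
have Cu : Ck (@axis R (n + n + 1) \o hdir j) 1 (~` [set 0]) u.
  exact: Ck_sub (@subsetT _ _) (smooth_Ck _ _ su).
have C1 := Ck_comp oO openT (fun q _ => I) (Ck1_spow p_ge2) Cu.
have C2 := Ck_comp oO openT (fun q _ => I) (Ck1_norm_powR p_ge2) Cu.
have Ch := Ck_sub (@subsetT _ (~` [set 0])) (Ck1_hfield gamma_ge1 j su).
have C3 := Ck_sub (@subsetT _ (~` [set 0])) (Ck1_sqn_powR j g1).
have C4 := Ck_sub (@subsetT _ (~` [set 0])) (Ck1_hcoef gamma_ge1 j).
have C5 := @Ck_coord R _ _ (hdir j) 1 _ (lshift 1 j) oO.
have C6 := @Ck_coord R _ _ (hdir j) 1 _ (idx_t n) oO.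
have Cg := CkD oO (CkM oO C5 C3) (CkM oO C6 (CkZ oO (2 * gamma)^-1 C4)).
have CV := CkM oO (Ck1_rad_powR gamma_ge1 j ((2 - p * (theta + 2)) / (4 * gamma) - 1)) Cg.
have CS := Ck1_rad_powR gamma_ge1 j ((2 - p * (theta + 2)) / (4 * gamma)).
exact: (CkB oO (CkM oO (CkM oO CS C1) Ch) (CkZ oO _ (CkM oO C2 CV))).
Qed.

(** Young's inequality is applied to [x = L r^(1/p)] and [z = k a d^(1/p)]. Adding [p k^(p - 1)]
    times the last hypothesis cancels the mixed term and leaves [k^p a^p d] with coefficient
    [p - (p - 1) = 1]. *)
Lemma young_density (L a r d s k G : R) : 0 <= L -> 0 <= a -> 0 < r -> 0 < d -> 0 <= k ->
  r `^ p^-1 * d `^ (p^-1 * (p - 1)) = s ->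
  k * (a `^ p * d) - s * (a `^ (p - 1) * L) <= G ->
  k `^ p * (a `^ p * d) <= L `^ p * r + p * k `^ (p - 1) * G.
Proof.
move=> L0 a0 r0 d0 k0 sE h3.
have rp : (r `^ p^-1) `^ p = r by rewrite -powRrM mulVf ?gt_eqF// powRr1// ltW.
have dp : (d `^ p^-1) `^ p = d by rewrite -powRrM mulVf ?gt_eqF// powRr1// ltW.
have h2 := young_powR p1 (mulr_ge0 L0 (powR_ge0 r p^-1))
  (mulr_ge0 k0 (mulr_ge0 a0 (powR_ge0 d p^-1))).
rewrite !powRM ?mulr_ge0 ?powR_ge0// rp dp -(powRrM d) in h2.
have h4 := ler_wpM2l (mulr_ge0 (ltW p0) (powR_ge0 k (p - 1))) h3.
have KK : k `^ p = k * k `^ (p - 1) by rewrite mulr_powRB1.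
rewrite KK in h2 *; rewrite -sE in h4.
rewrite -lerBlDl; apply: le_trans h4; rewrite lerBlDl -lerBlDr.
rewrite -subr_ge0 in h2; rewrite -subr_ge0; apply: le_trans h2 _.
by rewrite le_eqVlt; apply/orP; left; apply/eqP; ring.
Qed.

Lemma powR_monomials (s m a b c d e h k : R) : 0 < s -> 0 < m ->
  (s `^ a * (m `^ c * s `^ d) `^ b) `^ h * (m `^ c * s `^ d * s `^ e) `^ k =
  m `^ (c * b * h + c * k) * s `^ (a * h + d * b * h + d * k + e * k).
Proof.
move=> s0 m0.
rewrite !(powRM _ (powR_ge0 m _) (powR_ge0 s _)).
rewrite (powRM _ (powR_ge0 s _) (mulr_ge0 (powR_ge0 _ _) (powR_ge0 _ _))).
rewrite (powRM _ (mulr_ge0 (powR_ge0 m _) (powR_ge0 s _)) (powR_ge0 s _)).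
rewrite !(powRM _ (powR_ge0 _ _) (powR_ge0 _ _)).
rewrite -5!(powRrM s) -3!(powRrM m) !powR_expR// -!expRD.
by congr expR; ring.
Qed.

(** The geometric mean that Young's inequality produces from the two densities: the powers of
    [|grad rho|] cancel and exactly the factor of [|u|^(p - 1) |L u|] in the divergence inequality
    is left. *)
Lemma density_interpolation q : 0 < N q ->
  rhs_density gamma p theta q `^ p^-1 * D q `^ (p^-1 * (p - 1)) =
  rad gamma q `^ ((2 - p * (theta + 2)) / (4 * gamma)).
Proof.
move=> N0; have S0 := rad_gt0 gamma N0.
rewrite /rhs_density /lhs_density /weight powR_monomials//.
rewrite [X in N q `^ X](_ : _ = 0) ?powRr0 ?mul1r; last by ring.
by congr (_ `^ _); field; rewrite g0 gt_eqF.
Qed.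

Lemma norm_spow x : `|spow p x| = `|x| `^ (p - 1).
Proof.
rewrite /spow normrM (ger0_norm (powR_ge0 _ _)).
have [->|x0] := eqVneq x 0; first by rewrite normr0 mulr0 powR0// subr_eq0 gt_eqF.
by rewrite mulrC -(gt0_powRS (c := p - 1)) ?normr_gt0//; ring.
Qed.

Lemma rellich_pointwise u q : smooth u -> 0 < N q ->
  rellich_const n gamma p theta * (`|u q| `^ p * D q) <=
  `|greiner_op gamma u q| `^ p * rhs_density gamma p theta q +
  p * K `^ (p - 1) * \sum_j hfield gamma j (W u j) q.
Proof.
move=> su N0; have S0 := rad_gt0 gamma N0; have w0 := weight_gt0 gamma N0.
have D0 : 0 < D q by rewrite mulr_gt0 ?powR_gt0.
have r0 : 0 < rhs_density gamma p theta q by rewrite mulr_gt0 ?powR_gt0.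
apply: (young_density (normr_ge0 _) (normr_ge0 _) r0 D0 K0 (density_interpolation N0)).
apply: le_trans (divergence_rellich_field theta gamma_ge1 p_ge2 su N0).
rewrite addrC lerD2r -mulrN -mulrA ler_wpM2l ?powR_ge0//.
by rewrite -norm_spow -normrM lerNl -normrN ler_norm.
Qed.

Theorem rellich_inequality u : test_fun u ->
  ((rellich_const n gamma p theta)%:E * rellich_lhs gamma p theta [set: _] u
   <= rellich_rhs gamma p theta [set: _] u)%E.
Proof.
move=> tu; have [su _ _] := tu; have [B uB] := test_fun_cube tu.
have Cu : continuous u by move=> q; have [h _] := su [::]; exact: h.
have mD : measurable_fun setT (u : _ -> measurableTypeR R).
  by apply: continuous_measurable_rV; [exact: openT | move=> q _; exact: Cu].
rewrite rellich_lhsE// rellich_rhsE// -ge0_integralZl//; last 3 first.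
- exact: measurable_lhs_integrand.
- by move=> q _; exact: lhs_integrand_ge0.
- by rewrite lee_fin powR_ge0.
set f1 := fun q => _; set f2 := fun q => _.
have f10 q : (0 <= f1 q)%E by rewrite /f1 mule_ge0 ?lhs_integrand_ge0// lee_fin powR_ge0.
have f20 q : (0 <= f2 q)%E by exact: rhs_integrand_ge0.
have mf1 : measurable_fun setT f1.
  by apply: measurable_funeM; exact: measurable_lhs_integrand.
have mL : measurable_fun setT (greiner_op gamma u : _ -> measurableTypeR R).
  rewrite (_ : greiner_op gamma u = fun q => \sum_j hfield gamma j (hfield gamma j u) q).
    apply: measurable_sum => j; apply: continuous_measurable_rV; first exact: openT.
    by move=> q _; apply: continuous_hfield => //; exact: Ck1_hfield.
  by apply/funext => q; rewrite greiner_opE.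
have mf2 : measurable_fun setT f2.
  apply/measurable_EFinP; apply: measurable_funM; last exact: measurable_rhs_density.
  exact: measurable_norm_powR.
pose g q := p * K `^ (p - 1) * \sum_j hfield gamma j (W u j) q.
have Hj j := integral_hfield gamma_ge1 (Ck1_rellich_field j tu)
  (fun q qB => rellich_field_off j (uB q qB)).
have gE : (fun q => (g q)%:E) =
    (fun q => (p * K `^ (p - 1))%:E * \sum_j (hfield gamma j (W u j) q)%:E)%E.
  by apply/funext => q; rewrite /g EFinM sumEFin.
have ig : mu.-integrable setT (fun q => (g q)%:E).
  rewrite gE; apply: integrableZl => //.
  by apply: integrable_sum => // j _; exact: (Hj j).1.
have g00 : (\int[mu]_q (g q)%:E = 0)%E.
  rewrite gE integralZl//; last by apply: integrable_sum => // j _; exact: (Hj j).1.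
  rewrite integral_sum//; last by move=> j; exact: (Hj j).1.
  by rewrite big1 ?mule0// => j _; exact: (Hj j).2.
(* The integral of [f2] is not known to be finite, so nothing is subtracted from it. The pointwise
   bound is read as [f1 + G^- <= f2 + G^+], and the integrals of [G^+] and [G^-] are finite and
   equal. *)
pose G q := (g q)%:E.
have mG : measurable_fun setT G by exact: measurable_int ig.
have Gfin : (\int[mu]_q G^\- q)%E \is a fin_num by exact: integrable_neg_fin_num.
have GE : (\int[mu]_q G^\+ q = \int[mu]_q G^\- q)%E.
  by move: g00; rewrite integralE -/G => g00; rewrite -[LHS](subeK _ Gfin) g00 add0e.
rewrite -(leeD2rE _ _ Gfin) -{2}GE -!ge0_integralD//; last 2 first.
- by move=> q _; exact: f10.
- exact: measurable_funeneg.
  apply: (@ge0_le_integral_off _ _ _ mu setT (@hyper0 R n n_gt0)) => [||q|q|q].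
  - exact: measurable_hyper0.
  - exact: hyper0_null.
  - by rewrite adde_ge0// ?funeneg_ge0//; exact: f10.
  - by rewrite adde_ge0// ?funepos_ge0//; exact: f20.
move=> _ /sqn_gt0 N0; rewrite /f1 /f2 /G.
have := rellich_pointwise su N0; rewrite -/(g q) => h.
rewrite funeposE funenegE /= -!EFin_max -!EFinM -!EFinD lee_fin.
move: h; set X := _ * _; set Y := _ * rhs_density _ _ _ _; move: X Y (g q) => X Y G'.
rewrite !maxEle; case: ifP => h1; case: ifP => h2; move: h1 h2; lra.
- by move=> q _; exact: f20.
- exact: measurable_funepos.
Qed.

End rellich_inequality_integrated.

(** * Truncated powers *)

Section flat_function.
Context (R : realType).
Implicit Types (P : {poly R}) (x y : R).

(** Each multiplication by [y] is paid for with half of the exponential; hence the induction must be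
    over all rates [a]. *)
Lemma poly_expRN_bounded P (a : R) : 0 < a ->
  exists C, forall y, 0 < y -> `|P.[y]| * expR (- (a * y)) <= C.
Proof.
elim/poly_ind: P a => [|P c IH] a a0.
  by exists 0 => y _; rewrite horner0 normr0 mul0r.
have a20 : 0 < a / 2 by rewrite divr_gt0.
have [C HC] := IH _ a20; exists (C * (2 / a) + `|c|) => y y0.
have C0 : 0 <= C by apply: le_trans (HC _ y0); rewrite mulr_ge0 ?expR_ge0.
rewrite hornerMXaddC.
have e1 : expR (- (a * y)) <= 1 by rewrite expR_le1 oppr_le0 mulr_ge0 ?ltW.
apply: (@le_trans _ _ (`|P.[y] * y| * expR (- (a * y)) + `|c| * expR (- (a * y)))).
  by rewrite -mulrDl ler_wpM2r ?expR_ge0 ?ler_normD.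
apply: lerD; last by rewrite ler_piMr.
have -> : expR (- (a * y)) = expR (- (a / 2 * y)) * expR (- (a / 2 * y)).
  by rewrite -expRD; congr expR; field.
have ye : y * expR (- (a / 2 * y)) <= 2 / a.
  rewrite expRN ler_pdivrMr ?expR_gt0//.
  have h : a / 2 * y <= expR (a / 2 * y).
    by apply: le_trans (expR_ge1Dx _); rewrite lerDr.
  rewrite -ler_pdivrMl ?divr_gt0//; apply: le_trans h.
  by rewrite le_eqVlt; apply/orP; left; apply/eqP; field; rewrite gt_eqF.
rewrite normrM (ger0_norm (ltW y0)).
have := ler_pM (mulr_ge0 (normr_ge0 P.[y]) (expR_ge0 (- (a / 2 * y))))
  (mulr_ge0 (ltW y0) (expR_ge0 _)) (HC _ y0) ye.
by apply: le_trans; rewrite le_eqVlt; apply/orP; left; apply/eqP; ring.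
Qed.

(** The polynomial parameter makes the family closed under differentiation, which turns the
    smoothness of [exp (-1/x)] into an induction on the order. *)
Definition flat P x : R := if 0 < x then P.[x^-1] * expR (- x^-1) else 0.

Lemma gt0_is_derive_inv x : 0 < x -> is_derive x 1 (fun y : R => y^-1) (- x ^- 2).
Proof.
move=> x0; have h := is_derive1_powR (-1) x0.
have -> : - x ^- 2 = -1 * x `^ (-1 - 1).
  by rewrite mulN1r (_ : -1 - 1 = - 2%:R); [rewrite powR_invn// ltW|ring].
apply: near_eq_is_derive h; near=> y; rewrite powR_inv1//.
by apply: ltW; near: y; exact: lt_nbhsr.
Unshelve. all: by end_near. Qed.

Lemma is_derive_flat P x :
  is_derive x 1 (flat P) (flat ('X^2 * (P - P^`())) x).
Proof.
have [x0|x0|->] := ltgtP x 0.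
- rewrite [X in is_derive _ _ _ X](_ : _ = 0); last by rewrite /flat ltNge (ltW x0).
  apply: near_eq_is_derive (is_derive_cst (0 : R) x (1 : R)).
  near=> y; rewrite /flat ltNge (_ : y <= 0)//; apply: ltW; near: y; exact: lt_nbhsl.
- have dV := gt0_is_derive_inv x0.
  have d1 := is_derive_comp1 dV (is_derive_poly P x^-1).
  have d2 := is_derive_comp1 (is_deriveN dV) (is_derive_expR (- x^-1)).
  apply: (@near_eq_is_derive _ _ _ (fun y => P.[y^-1] * expR (- y^-1))).
    near=> y; rewrite /flat ifT//; near: y; exact: lt_nbhsr.
  apply: is_derive_eq (is_deriveM d1 d2) _.
  rewrite /flat x0 hornerM hornerXn hornerD hornerN /GRing.scale/= exprVn.
  by ring.
rewrite [X in is_derive _ _ _ X](_ : _ = 0); last by rewrite /flat ltxx.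
(* The extra factor ['X^2] makes the bound read [|flat P h| <= C h^2], so the difference quotient at
   0 is [O(|h|)]. *)
have [C HC] := poly_expRN_bounded ('X^2 * P) ltr01.
have H : h^-1 *: (flat P (h *: 1 + 0) - flat P 0) @[h --> (0 : R)^'] --> (0 : R).
  have C0 : 0 <= C by apply: le_trans (HC _ ltr01); rewrite mulr_ge0 ?expR_ge0.
  have HC0 : C * `|h| @[h --> (0 : R)^'] --> (0 : R).
    rewrite -[X in _ --> X](mulr0 C); apply: cvgM; first exact: cvg_cst.
    move=> A HA; apply: nbhs_dnbhs; apply: (@norm_continuous _ R (0 : R)).
    by rewrite normr0.
  have nr : \forall h \near (0 : R)^',
      (0 : R) <= `|h^-1 *: (flat P (h *: 1 + 0) - flat P 0)| <= C * `|h|.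
    near=> h; rewrite normr_ge0/= /flat ltxx subr0 addr0 /GRing.scale/= mulr1.
    case: ifPn => h0; last by rewrite mulr0 normr0 mulr_ge0.
    have := HC h^-1; rewrite invr_gt0 => /(_ h0).
    rewrite hornerM hornerXn mul1r => hC.
    rewrite (ger0_norm (ltW h0)) -ler_pdivrMr//; apply: le_trans hC.
    have h1 : 0 <= h^-1 by rewrite invr_ge0 ltW.
    rewrite !normrM ?normrX (ger0_norm h1).
    by rewrite (ger0_norm (expR_ge0 _)) le_eqVlt; apply/orP; left; apply/eqP; ring.
  exact: (norm_cvg0 (squeeze_cvgr nr (cvg_cst (0 : R)) HC0)).
by apply: DeriveDef; [apply/cvg_ex; eexists; exact: H | exact: cvg_lim].
Unshelve. all: by end_near. Qed.

Lemma Ck1_flat k P : Ck1 k setT (flat P).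
Proof.
elim: k P => [|k IH] P.
  move=> x _; have [d _] := is_derive_flat P x.
  exact/differentiable_continuous/derivable1_diffP.
by apply: (Ck1S openT (dg := flat ('X^2 * (P - P^`())))) => // x _; exact: is_derive_flat.
Qed.

Lemma flat1_gt0 x : 0 < x -> 0 < flat 1 x.
Proof. by move=> x0; rewrite /flat x0 hornerC mul1r expR_gt0. Qed.

Lemma flat1_ge0 x : 0 <= flat 1 x.
Proof. by rewrite /flat; case: ifP => // _; rewrite hornerC mul1r expR_ge0. Qed.

Lemma flat_le0 P x : x <= 0 -> flat P x = 0.
Proof. by move=> x0; rewrite /flat ltNge x0. Qed.

Definition step x : R := flat 1 (x - 1) / (flat 1 (x - 1) + flat 1 (2 - x)).

Let den_gt0 x : 0 < flat 1 (x - 1) + flat 1 (2 - x).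
Proof.
have [x1|x1] := ltP 1 x.
  by rewrite ltr_pwDl ?flat1_ge0// flat1_gt0// subr_gt0.
by rewrite ltr_wpDl ?flat1_ge0// flat1_gt0//; move: x1; lra.
Qed.

Lemma step_ge0 x : 0 <= step x.
Proof. by rewrite divr_ge0 ?flat1_ge0// ltW. Qed.

Lemma step_le1 x : step x <= 1.
Proof. by rewrite ler_pdivrMr// mul1r lerDl flat1_ge0. Qed.

Lemma step_eq0 x : x <= 1 -> step x = 0.
Proof. by move=> x1; rewrite /step flat_le0 ?mul0r// subr_le0. Qed.

Lemma step_eq1 x : 2 <= x -> step x = 1.
Proof.
move=> x2; have := den_gt0 x; rewrite /step (@flat_le0 1 (2 - x)) ?subr_le0// addr0 => h.
by rewrite divff// gt_eqF.
Qed.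

Lemma Ck1_affine k (O : set R) (a b : R) : open O -> Ck1 k O (fun x => a * x + b).
Proof.
by move=> oO; apply: CkD => //; [apply: CkZ => //; exact: Ck1_id | exact: Ck_cst].
Qed.

Lemma Ck1_comp k (f g : R -> R) : Ck1 k setT g -> Ck1 k setT f -> Ck1 k setT (fun x => g (f x)).
Proof. by move=> Cg Cf; exact: (Ck_comp openT openT (fun q _ => I) Cg Cf). Qed.

Lemma Ck1_step k : Ck1 k setT step.
Proof.
have C1 : Ck1 k setT (fun x => flat 1 (x - 1)).
  have h := Ck1_comp (Ck1_flat k 1) (Ck1_affine k 1 (-1) openT).
  by apply: (Ck_eq openT _ h) => x _; rewrite mul1r.
have C2 : Ck1 k setT (fun x => flat 1 (2 - x)).
  have h := Ck1_comp (Ck1_flat k 1) (Ck1_affine k (-1) 2 openT).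
  by apply: (Ck_eq openT _ h) => x _; rewrite mulN1r addrC.
have oI : open (`]0, +oo[%classic : set R) by exact: rray_open.
have H x : setT x -> (`]0, +oo[%classic : set R) (flat 1 (x - 1) + flat 1 (2 - x)).
  by move=> _; rewrite /= in_itv/= andbT.
have C3 := CkD openT C1 C2.
exact: (CkM openT C1 (Ck_comp openT oI H (Ck1_inv R k) C3)).
Qed.

End flat_function.

(** * Cutoffs with dilation invariant bounds *)

Section multipliers.
Context (R : realType).
Implicit Types (A B : R -> R) (c r x : R).

(* The bounds are invariant under dilations. *)
Definition multiplier c A A1 A2 := forall x, 0 < x ->
  [/\ is_derive x 1 A (A1 x), is_derive x 1 A1 (A2 x) &
      [/\ `|A x| <= c, `|x * A1 x| <= c & `|x ^+ 2 * A2 x| <= c]].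

Lemma multiplier_ge0 c A A1 A2 : multiplier c A A1 A2 -> 0 <= c.
Proof. by move=> /(_ 1 ltr01)[_ _ [h _ _]]; exact: le_trans h. Qed.

Lemma multiplier_dilate c r A A1 A2 : 0 < r -> multiplier c A A1 A2 ->
  multiplier c (fun x => A (x / r)) (fun x => A1 (x / r) / r) (fun x => A2 (x / r) / r / r).
Proof.
move=> r0 mA x x0; have [d1 d2 [b0 b1 b2]] := mA _ (divr_gt0 x0 r0).
have dr : is_derive x 1 (fun x => x / r) r^-1.
  rewrite (_ : (fun x => _) = r^-1 *: id); last by apply/funext => y; rewrite mulrC.
  by apply: is_derive_eq (is_deriveZ _ (is_derive_id x 1)) _; rewrite /GRing.scale/= mulr1.
split; [exact: is_derive_comp1 dr d1| |split => //].
- have h := is_derive_comp1 dr d2.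
  rewrite (_ : (fun x => _) = r^-1 *: (A1 \o (fun x => x / r))); last first.
    by apply/funext => y; rewrite mulrC.
  by apply: is_derive_eq (is_deriveZ _ h) _; rewrite /GRing.scale/= mulrC.
- by rewrite (_ : x * _ = x / r * A1 (x / r))//; ring.
- by rewrite (_ : x ^+ 2 * _ = (x / r) ^+ 2 * A2 (x / r))//; field; rewrite gt_eqF.
Qed.

Lemma multiplier_compl c A A1 A2 : multiplier c A A1 A2 ->
  multiplier (1 + c) (fun x => 1 - A x) (fun x => - A1 x) (fun x => - A2 x).
Proof.
move=> mA x x0; have [d1 d2 [b0 b1 b2]] := mA _ x0.
split; [|exact: is_deriveN|split].
- by apply: is_derive_eq (is_deriveB (is_derive_cst (1 : R) x (1 : R)) d1) _; rewrite sub0r.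
- by apply: le_trans (ler_normB _ _) _; rewrite normr1 lerD2l.
- by rewrite mulrN normrN (le_trans b1)// lerDr.
- by rewrite mulrN normrN (le_trans b2)// lerDr.
Qed.

(** The second derivative of a product has [1 + 2 + 1] terms, each bounded by [c * c']; hence the
    4. *)
Lemma multiplierM c c' A A1 A2 B B1 B2 : multiplier c A A1 A2 -> multiplier c' B B1 B2 ->
  multiplier (4 * (c * c')) (fun x => A x * B x) (fun x => A1 x * B x + A x * B1 x)
    (fun x => A2 x * B x + 2 * (A1 x * B1 x) + A x * B2 x).
Proof.
move=> mA mB x x0; have [d1 d2 [b0 b1 b2]] := mA _ x0.
have [d1' d2' [b0' b1' b2']] := mB _ x0.
have cc0 : 0 <= c * c' by rewrite mulr_ge0 ?(multiplier_ge0 mA) ?(multiplier_ge0 mB).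
have P y z : `|y| <= c -> `|z| <= c' -> `|y * z| <= c * c'.
  by move=> hy hz; rewrite normrM ler_pM.
split; [| |split].
- by apply: is_derive_eq (is_deriveM d1 d1') _; rewrite /GRing.scale/= addrC mulrC.
- apply: is_derive_eq (is_deriveD (is_deriveM d2 d1') (is_deriveM d1 d2')) _.
  by rewrite /GRing.scale/=; ring.
- by apply: le_trans (P _ _ b0 b0') _; rewrite ler_peMl// ler1n.
- rewrite mulrDr mulrA mulrCA; apply: le_trans (ler_normD _ _) _.
  by have := P _ _ b1 b0'; have := P _ _ b0 b1'; move: cc0; lra.
- rewrite (_ : _ * _ = x ^+ 2 * A2 x * B x + 2 * (x * A1 x * (x * B1 x)) +
    A x * (x ^+ 2 * B2 x)); last by ring.
  apply: le_trans (ler_normD _ _) _; rewrite -lerBrDr; apply: le_trans (ler_normD _ _) _.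
  rewrite [`|2 * _|]normrM (ger0_norm (ler0n _ 2)).
  by have := P _ _ b2 b0'; have := P _ _ b1 b1'; have := P _ _ b0 b2'; lra.
Qed.

Section power_times_multiplier.
Variables (b c : R) (A A1 A2 : R -> R).
Hypothesis mA : multiplier c A A1 A2.

Definition pm_d1 x := b * x `^ (b - 1) * A x + x `^ b * A1 x.
Definition pm_d2 x :=
  b * (b - 1) * x `^ (b - 2) * A x + 2 * (b * x `^ (b - 1) * A1 x) + x `^ b * A2 x.

Lemma is_derive_pm x : 0 < x -> is_derive x 1 (fun x => x `^ b * A x) (pm_d1 x).
Proof.
move=> x0; have [d1 d2 _] := mA x0.
apply: is_derive_eq (is_deriveM (is_derive1_powR b x0) d1) _.
by rewrite /pm_d1 /GRing.scale/=; ring.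
Qed.

Lemma is_derive_pm_d1 x : 0 < x -> is_derive x 1 pm_d1 (pm_d2 x).
Proof.
move=> x0; have [d1 d2 _] := mA x0.
have e1 := is_derive1_powR b x0.
have e2 : is_derive x 1 (fun x => b * x `^ (b - 1)) (b * ((b - 1) * x `^ (b - 1 - 1))).
  by have ? := is_derive1_powR (b - 1) x0; exact: is_deriveZ.
apply: is_derive_eq (is_deriveD (is_deriveM e2 d1) (is_deriveM e1 d2)) _.
rewrite /pm_d2 /GRing.scale/= (_ : b - 1 - 1 = b - 2); last by ring.
by ring.
Qed.

Lemma pm_d1_bound x : 0 < x -> `|pm_d1 x| <= c * (`|b| + 1) * x `^ (b - 1).
Proof.
move=> x0; have [_ _ [b0 b1 _]] := mA x0.
rewrite /pm_d1 (gt0_powRS (c := b) (a := b - 1) x0); last by ring.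
set y := x `^ (b - 1); have y0 : 0 <= y by exact: powR_ge0.
rewrite (_ : _ + _ = (b * A x + x * A1 x) * y); last by ring.
rewrite normrM (ger0_norm y0) ler_wpM2r//; apply: le_trans (ler_normD _ _) _.
by rewrite normrM mulrDr mulr1 lerD// mulrC ler_wpM2r.
Qed.

Lemma pm_d2_bound x : 0 < x ->
  `|pm_d2 x| <= c * (`|b| * `|b - 1| + 2 * `|b| + 1) * x `^ (b - 2).
Proof.
move=> x0; have [_ _ [b0 b1 b2]] := mA x0.
rewrite /pm_d2 (gt0_powRSS (c := b) (a := b - 2) x0); last by ring.
rewrite (gt0_powRS (c := b - 1) (a := b - 2) x0); last by ring.
set y := x `^ (b - 2); have y0 : 0 <= y by exact: powR_ge0.
rewrite (_ : _ + _ + _ = (b * (b - 1) * A x + 2 * b * (x * A1 x) +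
    x ^+ 2 * A2 x) * y); last by ring.
rewrite normrM (ger0_norm y0) ler_wpM2r//; apply: le_trans (ler_normD _ _) _.
rewrite [leRHS]mulrDr mulr1 lerD//; apply: le_trans (ler_normD _ _) _.
rewrite [leRHS]mulrDr lerD//.
  by rewrite !normrM mulrC ler_wpM2r ?mulr_ge0.
by rewrite 2!normrM (ger0_norm (ler0n _ 2)) mulrC ler_wpM2r ?mulr_ge0.
Qed.

End power_times_multiplier.

Definition step1 : R -> R := 'D_1 (@step R).
Definition step2 : R -> R := 'D_1 step1.

Lemma is_derive_step x : is_derive x 1 (@step R) (step1 x).
Proof. exact: (Ck1_is_derive (Ck1_step R 1) (I : setT x)). Qed.

Lemma Ck1_step1 k : Ck1 k setT step1.
Proof. by have [_ _ h] := Ck1_step R k.+1; exact: (h tt). Qed.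

Lemma is_derive_step1 x : is_derive x 1 step1 (step2 x).
Proof. exact: (Ck1_is_derive (Ck1_step1 1) (I : setT x)). Qed.

Lemma derive1_near_cst (f : R -> R) (a x : R) : (\forall y \near x, f y = a) -> 'D_1 f x = 0.
Proof. by move=> fa; rewrite (@near_eq_derive _ _ _ f (cst a)) ?derive_cst. Qed.

Lemma step1_off x : x < 1 \/ 2 < x -> step1 x = 0.
Proof.
move=> [x1|x2].
  apply: (@derive1_near_cst _ 0); near=> y; apply: step_eq0; apply: ltW.
  by near: y; exact: lt_nbhsl.
apply: (@derive1_near_cst _ 1); near=> y; apply: step_eq1; apply: ltW.
by near: y; exact: lt_nbhsr.
Unshelve. all: by end_near. Qed.

Lemma step2_off x : x < 1 \/ 2 < x -> step2 x = 0.
Proof.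
move=> [x1|x2]; apply: (@derive1_near_cst _ 0); near=> y; apply: step1_off.
  by left; near: y; exact: lt_nbhsl.
by right; near: y; exact: lt_nbhsr.
Unshelve. all: by end_near. Qed.

Lemma off_bounded (f : R -> R) : continuous f -> (forall x, x < 1 \/ 2 < x -> f x = 0) ->
  exists c, forall x, `|f x| <= c.
Proof.
move=> cf f0; have : compact (f @` `[1, 2]).
  apply: (@continuous_compact _ _ f `[1, 2]); last exact: segment_compact.
  exact: continuous_subspaceT.
move=> /compact_bounded [M [Mr HM]]; exists (`|M| + 1) => x.
have [x1|x1] := ltP x 1; first by rewrite f0 ?normr0 ?addr_ge0//; left.
have [x2|x2] := ltP 2 x; first by rewrite f0 ?normr0 ?addr_ge0//; right.
apply: (HM (`|M| + 1)); first by rewrite (le_lt_trans (ler_norm M))// ltrDl.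
by exists x => //=; rewrite in_itv/= x1 x2.
Qed.

Lemma multiplier_step : exists c, multiplier c (@step R) step1 step2.
Proof.
have [c1 H1] : exists c, forall x, `|x * step1 x| <= c.
  apply: off_bounded => [x|x xo]; last by rewrite step1_off// mulr0.
  have h : Ck1 0 setT (fun x => x * step1 x).
    exact: (CkM openT (Ck1_id 0 openT) (Ck1_step1 0)).
  exact: (h x I).
have [c2 H2] : exists c, forall x, `|x ^+ 2 * step2 x| <= c.
  apply: off_bounded => [x|x xo]; last by rewrite step2_off// mulr0.
  have [_ _ D] := Ck1_step1 1; have C2 : Ck1 0 setT step2 := D tt.
  have C1 := Ck1_id 0 (@openT R).
  have h : Ck1 0 setT (fun x => x * x * step2 x).
    exact: (CkM openT (CkM openT C1 C1) C2).
  exact: (h x I).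
exists (Num.max 1 (Num.max c1 c2)) => x x0; split.
- exact: is_derive_step.
- exact: is_derive_step1.
- split; rewrite !le_max ?H1 ?H2 ?orbT//.
  by rewrite ger0_norm ?step_ge0// step_le1.
Qed.

(** The step vanishes for [x < d], which removes the singularity of the power at 0. *)
Lemma Ck1_powR_step k (b d : R) : 0 < d -> Ck1 k setT (fun x => x `^ b * step (x / d)).
Proof.
move=> d0; apply: (@Ck_sub _ _ _ _ _ (`]-oo, d[%classic `|` `]0, +oo[%classic)).
  move=> x _; have [xd|xd] := ltP x d; [left|right]; rewrite /= in_itv//= andbT.
  exact: lt_le_trans xd.
have Cs : Ck1 k setT (fun x => step (x / d)).
  have h := Ck1_comp (Ck1_step R k) (Ck1_affine k d^-1 0 openT).
  by apply: (Ck_eq openT _ h) => x _; rewrite addr0 mulrC.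
apply: Ck_setU.
  have oI : open (`]-oo, d[%classic : set R) by exact: lray_open.
  apply: (Ck_eq oI (f := fun=> 0)); last exact: Ck_cst.
  move=> x /=; rewrite in_itv/= => xd; rewrite step_eq0 ?mulr0//.
  by rewrite ler_pdivrMr// mul1r ltW.
have oI : open (`]0, +oo[%classic : set R) by exact: rray_open.
exact: (CkM oI (Ck1_powR k b) (Ck_sub (@subsetT _ _) Cs)).
Qed.

End multipliers.

(** * Truncated powers of [rho] as test functions *)

Section test_functions.
Context (R : realType) (n : nat) (gamma p theta : R).
Hypothesis gamma_ge1 : 1 <= gamma.
Implicit Types (q : 'rV[R]_(n + n + 1)) (u v : 'rV[R]_(n + n + 1) -> R).
Implicit Types (j : 'I_(n + n)) (d r s x y : R).

Local Notation N := (@sqn R n).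
Local Notation t := (@tc R n).
Local Notation S := (@rad R n gamma).

Let al : R := crit_exp n gamma p theta / (4 * gamma).

Lemma greiner_op_near u v q : (\forall q' \near q, u q' = v q') ->
  greiner_op gamma u q = greiner_op gamma v q.
Proof.
move=> uv.
have E j (f g : 'rV[R]_(n + n + 1) -> R) q' : (\forall x \near q', f x = g x) ->
    hfield gamma j f q' = hfield gamma j g q'.
  by move=> fg; rewrite /hfield /partial !(near_eq_derive _ fg).
rewrite !greiner_opE; apply: eq_bigr => j _; apply: (E).
move: uv => /nbhs_interior; apply: filterS => x xuv.
exact: (E).
Qed.

(** Taking logarithms handles both signs of [b]; the sign of the exponents [al - 1] and [al - 2]
    used later is not known. *)
Lemma powR_comparable x y (b : R) : 0 < x -> x <= y -> y <= 2 * x ->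
  x `^ b <= 2 `^ `|b| * y `^ b.
Proof.
move=> x0 xy yx; have y0 : 0 < y by exact: lt_le_trans xy.
have l1 : ln x <= ln y by rewrite ler_ln.
have l2 : ln y <= ln 2 + ln x by rewrite -lnM ?posrE// ler_ln// posrE mulr_gt0.
rewrite !powR_expR// -expRD ler_expR.
have h1 := ler_norm b; have h2 := ler_norm (- b); rewrite normrN in h2.
by nra.
Qed.

(* Flattening [|z|^(4 gamma)] near [z = 0] makes functions of it smooth. *)
Definition hcut d x : R := x `^ (2 * gamma) * step (x / d).

Definition radc d q : R := hcut d (N q) + t q ^+ 2.

(** For [s = rho^(4 gamma)] the power [s^al] is the extremal [rho^crit_exp]; the cutoffs act on
    [1 <= s <= 2] and [r <= s <= 2 r]. *)
Definition prof r s : R := s `^ al * (step s * (1 - step (s / r))).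

Definition ctest d r q : R := prof r (radc d q).

Lemma Ck1_prof k r : 0 < r -> Ck1 k setT (prof r).
Proof.
move=> r0.
have C1 : Ck1 k setT (fun s => 1 - step (s / r)).
  apply: (CkB openT (Ck_cst _ _ _ _)).
  by apply: (Ck_eq openT _ (Ck1_powR_step k 0 r0)) => x _; rewrite powRr0 mul1r.
have C2 := CkM openT (Ck1_powR_step k al (@ltr01 R)) C1.
by apply: (Ck_eq openT _ C2) => x _; rewrite /prof divr1 mulrA.
Qed.

Lemma Ck_radc (J : Type) (s : J -> 'I_(n + n + 1)) k d : 0 < d ->
  Ck (@axis R (n + n + 1) \o s) k setT (radc d).
Proof.
move=> d0.
have C1 := Ck_comp openT openT (fun q _ => I) (Ck1_powR_step k (2 * gamma) d0) (Ck_sqn R s k).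
have C2 := @Ck_coord R _ _ s k _ (idx_t n) openT.
have C3 := CkD openT C1 (CkM openT C2 C2).
by apply: (Ck_eq openT _ C3) => x _; rewrite /radc /hcut /tc expr2.
Qed.

Lemma continuous_radc d : 0 < d -> continuous (radc d).
Proof. by move=> d0 q; have := Ck_radc (fun _ : unit => idx_t n) 0 d0; move=> /(_ q I). Qed.

Lemma smooth_ctest d r : 0 < d -> 0 < r -> smooth (ctest d r).
Proof.
move=> d0 r0; apply: Ck_smooth => k.
exact: (Ck_comp openT openT (fun q _ => I) (Ck1_prof k r0) (Ck_radc id k d0)).
Qed.

Lemma prof_off r s : 1 <= r -> s <= 1 \/ 2 * r <= s -> prof r s = 0.
Proof.
move=> r1 [s1|sr]; first by rewrite /prof step_eq0// mul0r mulr0.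
have r0 : 0 < r by exact: lt_le_trans r1.
by rewrite /prof [step (s / r)]step_eq1 ?subrr ?mulr0// ler_pdivlMr.
Qed.

Lemma hcut_le d x : hcut d x <= x `^ (2 * gamma).
Proof. by rewrite /hcut ler_piMr ?powR_ge0 ?step_le1. Qed.

Lemma hcut_ge0 d x : 0 <= hcut d x.
Proof. by rewrite mulr_ge0 ?powR_ge0 ?step_ge0. Qed.

Lemma hcut_far d x : 0 < d -> 2 * d <= x -> hcut d x = x `^ (2 * gamma).
Proof. by move=> d0 dx; rewrite /hcut step_eq1 ?mulr1// ler_pdivlMr. Qed.

Lemma radc_le d q : radc d q <= S q.
Proof. by rewrite lerD2r hcut_le. Qed.

(** Flattening acts only where [N < 2 d <= 1]. There it removes at most 1, which is at most [radc]
    itself. *)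
Lemma rad_le_radc d q : 0 < d -> d <= 2^-1 -> 1 <= radc d q -> S q <= 2 * radc d q.
Proof.
move=> d0 d1 c1; have g1 : 0 <= 2 * gamma by move: gamma_ge1; lra.
have [Nd|Nd] := leP (2 * d) (N q).
  have -> : S q = radc d q by rewrite /radc hcut_far.
  by move: c1; lra.
have N1 : N q `^ (2 * gamma) <= 1.
  apply: (@le_trans _ _ (1 `^ (2 * gamma))); last by rewrite powR1.
  apply: ge0_ler_powR => //; rewrite ?nnegrE ?sqn_ge0//.
  by move: Nd d1; lra.
have := hcut_ge0 d (N q); move: c1; rewrite /radc /rad => h1 h2.
by move: h1 h2 N1; lra.
Qed.

Lemma le_powR1 x (b : R) : 1 <= b -> 1 <= x -> x <= x `^ b.
Proof. by move=> b1 x1; exact: le1r_powR. Qed.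

Lemma radc_bounded d r q : 0 < d -> d <= 2^-1 -> 1 <= r -> radc d q <= 2 * r ->
  cube (2 * r) q.
Proof.
move=> d0 d1 r1 cr.
have tb : t q ^+ 2 <= 2 * r.
  by apply: le_trans cr; rewrite /radc lerDr hcut_ge0.
have Nb : N q <= 2 * r.
  have [N1|N1] := leP (N q) 1; first by move: N1 r1; lra.
  have g1 : 1 <= 2 * gamma by move: gamma_ge1; lra.
  apply: le_trans (le_powR1 g1 (ltW N1)) _; apply: le_trans cr.
  by rewrite /radc hcut_far ?lerDl ?sqr_ge0//; move: d1 N1; lra.
have sq x : x ^+ 2 <= 2 * r -> - (2 * r) <= x <= 2 * r.
  move=> xr; rewrite -ler_norml -(@ler_pXn2r _ 2) ?nnegrE//; last by move: r1; lra.
  by rewrite real_normK ?num_real//; nra.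
move=> i; case: (split_ordP i) => k ->; apply: sq.
  exact: le_trans (zc_sqr_le_sqn k q) Nb.
by rewrite (ord1 k); exact: tb.
Qed.

(** The support lies where [1 <= radc <= 2 r]: this set is closed and bounded, and it misses the
    origin because [radc] vanishes there. *)
Lemma test_fun_ctest d r : 0 < d -> d <= 2^-1 -> 1 <= r -> test_fun (ctest d r).
Proof.
move=> d0 d1 r1; have r0 : 0 < r by exact: lt_le_trans r1.
pose G : set 'rV[R]_(n + n + 1) := radc d @^-1` `[1, 2 * r].
have cG : closed G.
  apply: closed_comp; last exact: interval_closed.
  by move=> q _; exact: continuous_radc.
have uG : tsupport (ctest d r) `<=` G.
  rewrite [X in _ `<=` X](closure_id G).1//; apply: closure_subset => q /= uq.
  rewrite /G /= in_itv/=; apply/andP; split; rewrite leNgt; apply/negP => h.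
    by move/eqP: uq; apply; apply: prof_off => //; left; exact: ltW.
  by move/eqP: uq; apply; apply: prof_off => //; right; exact: ltW.
split; first exact: smooth_ctest.
- apply: (@subclosed_compact _ _ (cube (2 * r))).
  + exact: closed_closure.
  + exact: compact_rV_box.
  + by move=> q /uG; rewrite /G /= in_itv/= => /andP[_]; exact: radc_bounded.
- move=> /uG; rewrite /G /= in_itv/= => /andP[+ _].
  have -> : radc d 0 = 0.
    rewrite /radc /tc mxE expr0n addr0 /hcut (_ : N 0 = 0) ?powR0 ?mul0r//.
      by rewrite gt_eqF//; move: gamma_ge1; lra.
    by rewrite /sqn big1// => j _; rewrite /zc mxE expr0n.
  by rewrite ler10.
Qed.

End test_functions.

(** * The operator on truncated powers *)

Section operator_on_test_functions.
Context (R : realType) (n : nat) (gamma p theta : R).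
Hypothesis gamma_ge1 : 1 <= gamma.
Implicit Types (q : 'rV[R]_(n + n + 1)) (u v : 'rV[R]_(n + n + 1) -> R).
Implicit Types (j : 'I_(n + n)) (d r s x y : R).

Local Notation N := (@sqn R n).
Local Notation t := (@tc R n).
Local Notation S := (@rad R n gamma).
Local Notation prof := (prof n gamma p theta).
Local Notation ctest := (ctest (n := n) gamma p theta).

Let al : R := crit_exp n gamma p theta / (4 * gamma).

Lemma prof_bounds c r : 0 < r -> multiplier c (@step R) (@step1 R) (@step2 R) ->
  let c4 := 4 * (c * (1 + c)) in forall s, 0 < s ->
  `|'D_1 (prof r) s| <= c4 * (`|al| + 1) * s `^ (al - 1) /\
  `|'D_1 ('D_1 (prof r)) s| <= c4 * (`|al| * `|al - 1| + 2 * `|al| + 1) * s `^ (al - 2).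
Proof.
move=> r0 mc c4 s s0.
have mA := multiplierM mc (multiplier_compl (multiplier_dilate r0 mc)).
set A := fun x => _ * _ in mA; set A1 := fun x => _ + _ in mA; set A2 := fun x => _ + _ + _ in mA.
have E1 x : 0 < x -> 'D_1 (prof r) x = pm_d1 al A A1 x.
  by move=> x0; have [_ <-] := is_derive_pm al mA x0.
have E2 : 'D_1 ('D_1 (prof r)) s = pm_d2 al A A1 A2 s.
  have [_ <-] := is_derive_pm_d1 al mA s0; apply: near_eq_derive.
  by near=> y; apply: E1; near: y; exact: lt_nbhsr.
rewrite E2 E1//; split; first exact: pm_d1_bound mA s s0.
exact: pm_d2_bound mA s s0.
Unshelve. all: by end_near. Qed.

Lemma greiner_op_ctest c d r q (F1 := 'D_1 (prof r)) (F2 := 'D_1 F1)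
    (s1 := fun x => step1 (x / d) / d) (s2 := fun x => step2 (x / d) / d / d)
    (h1 := pm_d1 (2 * gamma) (fun x => step (x / d)) s1)
    (h2 := pm_d2 (2 * gamma) (fun x => step (x / d)) s1 s2) :
  multiplier c (@step R) (@step1 R) (@step2 R) -> 0 < d -> 0 < r -> 0 < N q ->
  greiner_op gamma (ctest d r) q =
  F2 (radc gamma d q) * (4 * h1 (N q) ^+ 2 * N q
              + 16 * gamma ^+ 2 * N q `^ (2 * gamma - 1) * t q ^+ 2)
  + F1 (radc gamma d q) * (4 * h2 (N q) * N q + 4 * n%:R * h1 (N q)
              + 8 * gamma ^+ 2 * N q `^ (2 * gamma - 1)).
Proof.
move=> mc d0 r0 N0.
have mh := multiplier_dilate d0 mc.
have hh1 x : 0 < x -> is_derive x 1 (hcut gamma d) (h1 x).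
  by move=> x0; exact: (is_derive_pm (2 * gamma) mh x0).
have hh2 x : 0 < x -> is_derive x 1 h1 (h2 x).
  by move=> x0; exact: (is_derive_pm_d1 (2 * gamma) mh x0).
have hF1 x : is_derive x 1 (prof r) (F1 x).
  exact: (Ck1_is_derive (Ck1_prof n gamma p theta 1 r0) (I : setT _)).
have hF2 x : is_derive x 1 F1 (F2 x).
  have [_ _ D] := Ck1_prof n gamma p theta 2 r0.
  exact: (Ck1_is_derive (D tt : Ck1 1 setT F1) (I : setT _)).
exact: (greiner_op_radial gamma hh1 hh2 (fun q _ => hF1 _) (fun q _ => hF2 _) N0).
Qed.

(** The derivatives of the profile and of [hcut] obey the bounds of pure powers, with constants free
    of [d] and [r] by dilation invariance. Each term of the radial formula is then at most a
    constant times [N^(2 gamma - 1) S^(al - 1)], the size of the operator on the untruncated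
    power. *)
Lemma greiner_op_ctest_bound : exists2 C, 0 <= C & forall d r q,
  0 < d -> d <= 2^-1 -> 1 <= r -> 0 < N q -> 1 <= radc gamma d q ->
  `|greiner_op gamma (ctest d r) q| <= C * (N q `^ (2 * gamma - 1) * S q `^ (al - 1)).
Proof.
have [c mc] := @multiplier_step R.
have c0 := multiplier_ge0 mc.
pose C1 := 4 * (c * (1 + c)) * (`|al| + 1).
pose C2 := 4 * (c * (1 + c)) * (`|al| * `|al - 1| + 2 * `|al| + 1).
pose H1 := c * (`|2 * gamma| + 1).
pose H2 := c * (`|2 * gamma| * `|2 * gamma - 1| + 2 * `|2 * gamma| + 1).
have cc0 : 0 <= 4 * (c * (1 + c)) by rewrite mulr_ge0// mulr_ge0// addr_ge0.
have C10 : 0 <= C1 by do !(apply: addr_ge0 || apply: mulr_ge0) => //; exact: normr_ge0.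
have C20 : 0 <= C2 by do !(apply: addr_ge0 || apply: mulr_ge0) => //; exact: normr_ge0.
have H10 : 0 <= H1 by do !(apply: addr_ge0 || apply: mulr_ge0) => //; exact: normr_ge0.
have H20 : 0 <= H2 by do !(apply: addr_ge0 || apply: mulr_ge0) => //; exact: normr_ge0.
pose E2 := C2 * 2 `^ `|al - 2| * (4 * H1 ^+ 2 + 16 * gamma ^+ 2).
pose E1 := C1 * 2 `^ `|al - 1| * (4 * H2 + 4 * n%:R * H1 + 8 * gamma ^+ 2).
have sg : 0 <= gamma ^+ 2 by exact: sqr_ge0.
have E20 : 0 <= E2.
  by do !(apply: addr_ge0 || apply: mulr_ge0) => //; rewrite ?powR_ge0 ?sqr_ge0.
have E10 : 0 <= E1.
  by do !(apply: addr_ge0 || apply: mulr_ge0) => //; rewrite ?powR_ge0 ?ler0n.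
exists (E2 + E1); first exact: addr_ge0.
move=> d r q d0 d1 r1 N0 s1.
have r0 : 0 < r by exact: lt_le_trans r1.
have s0 : 0 < radc gamma d q by exact: lt_le_trans s1.
have S0 := rad_gt0 gamma N0.
have sS := radc_le gamma d q.
have Ss := rad_le_radc gamma_ge1 d0 d1 s1.
have mh := multiplier_dilate d0 mc.
rewrite (greiner_op_ctest mc d0 r0 N0).
have := pm_d1_bound (2 * gamma) mh N0; have := pm_d2_bound (2 * gamma) mh N0.
rewrite -/H1 -/H2.
move: (pm_d1 _ _ _ _) (pm_d2 _ _ _ _ _) => h1 h2 bh2 bh1.
have [bF1 bF2] := prof_bounds r0 mc s0.
move: bF1 bF2; rewrite -/C1 -/C2.
set F1 := ('D_(1 : R) (prof r) (radc gamma d q)).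
set F2 := ('D_(1 : R) ('D_(1 : R) (prof r)) (radc gamma d q)).
move: F1 F2 => F1 F2 bF1 bF2.
have p1 := powR_comparable (al - 1) s0 sS Ss.
have p2 := powR_comparable (al - 2) s0 sS Ss.
set X := N q `^ (2 * gamma - 1) in bh1 *.
set Y := N q `^ (2 * gamma - 2) in bh2 *.
have XY : X = N q * Y by apply: gt0_powRS => //; ring.
have NX : N q `^ (2 * gamma) = N q * X by apply: gt0_powRS => //; ring.
have X0 : 0 <= X by exact: powR_ge0.
have Y0 : 0 <= Y by exact: powR_ge0.
have St : S q = N q * X + t q ^+ 2 by rewrite /rad NX.
have SS : S q `^ (al - 1) = S q * S q `^ (al - 2) by apply: gt0_powRS => //; ring.
set T1 := S q `^ (al - 1) in p1 SS *; set T2 := S q `^ (al - 2) in p2 SS *.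
have T20 : 0 <= T2 by exact: powR_ge0.
have T10 : 0 <= T1 by exact: powR_ge0.
have t20 := sqr_ge0 (t q).
have bF1' : `|F1| <= C1 * (2 `^ `|al - 1| * T1).
  by apply: le_trans bF1 _; rewrite ler_wpM2l.
have bF2' : `|F2| <= C2 * (2 `^ `|al - 2| * T2).
  by apply: le_trans bF2 _; rewrite ler_wpM2l.
have g1 : `|4 * h1 ^+ 2 * N q + 16 * gamma ^+ 2 * X * t q ^+ 2| <=
    (4 * H1 ^+ 2 + 16 * gamma ^+ 2) * (X * S q).
  rewrite ger0_norm; last first.
    have i1 : 0 <= h1 ^+ 2 * N q by rewrite mulr_ge0 ?sqr_ge0 ?(ltW N0).
    have i2 : 0 <= gamma ^+ 2 * (X * t q ^+ 2) by rewrite mulr_ge0// mulr_ge0.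
    by move: i1 i2; lra.
  have h1s : h1 ^+ 2 <= (H1 * X) ^+ 2.
    by rewrite -[h1 ^+ 2]real_normK ?num_real// ler_pXn2r ?nnegrE// mulr_ge0.
  have e1 : h1 ^+ 2 * N q <= H1 ^+ 2 * (X * S q).
    apply: (@le_trans _ _ ((H1 * X) ^+ 2 * N q)); first by rewrite ler_wpM2r// ltW.
    rewrite (_ : _ * N q = H1 ^+ 2 * (X * (N q * X))); last by ring.
    by rewrite ler_wpM2l ?sqr_ge0// ler_wpM2l// St lerDl.
  have e2 : X * t q ^+ 2 <= X * S q.
    by rewrite ler_wpM2l// St lerDr mulr_ge0// ltW.
  have e3 : gamma ^+ 2 * (X * t q ^+ 2) <= gamma ^+ 2 * (X * S q) by rewrite ler_wpM2l.
  by move: e1 e3; lra.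
have g2 : `|4 * h2 * N q + 4 * n%:R * h1 + 8 * gamma ^+ 2 * X| <=
    (4 * H2 + 4 * n%:R * H1 + 8 * gamma ^+ 2) * X.
  apply: le_trans (ler_normD _ _) _; rewrite [leRHS]mulrDl lerD//; last first.
    by rewrite ger0_norm// mulr_ge0// mulr_ge0.
  have e1 : `|h2| * N q <= H2 * X.
    apply: le_trans (ler_wpM2r (ltW N0) bh2) _.
    by rewrite XY le_eqVlt; apply/orP; left; apply/eqP; ring.
  have e2 : n%:R * `|h1| <= n%:R * (H1 * X) by rewrite ler_wpM2l.
  apply: le_trans (ler_normD _ _) _.
  rewrite !normrM (ger0_norm (ler0n _ 4)) (ger0_norm (ler0n _ n)) (ger0_norm (ltW N0)).
  by move: e1 e2; lra.
apply: le_trans (ler_normD _ _) _; rewrite [leRHS]mulrDl; apply: lerD.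
  rewrite normrM; apply: le_trans (ler_pM (normr_ge0 _) (normr_ge0 _) bF2' g1) _.
  by rewrite le_eqVlt; apply/orP; left; apply/eqP; rewrite SS /E2; ring.
rewrite normrM; apply: le_trans (ler_pM (normr_ge0 _) (normr_ge0 _) bF1' g2) _.
by rewrite le_eqVlt; apply/orP; left; apply/eqP; rewrite /E1; ring.
Qed.

Lemma greiner_op_ctest_off d r q : 0 < d -> 1 <= r -> 0 < N q ->
  radc gamma d q < 1 \/ 2 * r < radc gamma d q -> greiner_op gamma (ctest d r) q = 0.
Proof.
move=> d0 r1 N0 off.
have c := @continuous_radc R n gamma d d0 q.
(* The zero function is written as a multiple of a power so that [greiner_op_power] evaluates the
   operator on it. *)
rewrite (@greiner_op_near _ _ _ _ (fun q => 0 * rho gamma q `^ 1)).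
  by rewrite greiner_op_power// !mul0r.
case: off => off.
- near=> x; rewrite mul0r; apply: prof_off => //; left; apply: ltW.
  by near: x; exact: (cvgr_lt _ c).
- near=> x; rewrite mul0r; apply: prof_off => //; right; apply: ltW.
  by near: x; exact: (cvgr_gt _ c).
Unshelve. all: by end_near. Qed.

Lemma ctest_exact d r q : 0 < d -> 0 < r -> 2 * d <= N q -> 2 <= S q <= r ->
  ctest d r q = S q `^ al.
Proof.
move=> d0 r0 Nd /andP[S2 Sr].
have -> : ctest d r q = prof r (radc gamma d q) by [].
rewrite /radc hcut_far// -/(S q) /prof step_eq1// step_eq0; last first.
  by rewrite ler_pdivrMr// mul1r.
by rewrite subr0 !mulr1.
Qed.

Lemma greiner_op_ctest_exact d r q : 0 < d -> 0 < r -> 2 * d < N q -> 2 < S q < r ->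
  greiner_op gamma (ctest d r) q =
  crit_exp n gamma p theta * (crit_exp n gamma p theta + hdim n gamma - 2) *
  (N q `^ (2 * gamma - 1) * S q `^ (al - 1)).
Proof.
move=> d0 r0 Nd /andP[S2 Sr].
have N0 : 0 < N q by apply: lt_trans Nd; rewrite mulr_gt0.
rewrite (@greiner_op_near _ _ _ _ (fun q => 1 * rho gamma q `^ crit_exp n gamma p theta)).
  by rewrite greiner_op_power// mul1r.
have cN := @continuous_sqn R n q.
have cS : {for q, continuous S}.
  have g2 : 0 <= 2 * gamma by move: gamma_ge1; lra.
  exact: (cvgD (ge0_cvg_powR _ (@sqn_ge0 R n) g2 cN)
    (continuous_comp (@continuous_tc R n q) (@exprn_continuous R 2 _))).
near=> x; rewrite mul1r rho_powR ctest_exact//.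
- by apply: ltW; near: x; exact: (cvgr_gt _ cN).
- by apply/andP; split; apply: ltW; near: x; [exact: (cvgr_gt _ cS)|exact: (cvgr_lt _ cS)].
Unshelve. all: by end_near. Qed.

End operator_on_test_functions.

(** * Optimality of the constant *)

Section optimality.
Context (R : realType) (n : nat) (gamma p theta : R).
Hypotheses (gamma_ge1 : 1 <= gamma) (p_ge2 : 2 <= p).
Hypothesis const_ge0 : 0 <= (hdim n gamma - p * (theta + 2)) *
                      (p * theta + hdim n gamma * (p - 1)).
Implicit Types (q : 'rV[R]_(n + n + 1)) (u : 'rV[R]_(n + n + 1) -> R).
Implicit Types (j : 'I_(n + n)) (d r x y : R).

Local Notation mu := (lebesgue_rV (n + n + 1)).
Local Notation N := (@sqn R n).
Local Notation t := (@tc R n).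
Local Notation S := (@rad R n gamma).
Local Notation D := (@hdensity R n gamma).
Local Notation Q := (hdim n gamma : R).
Local Notation ctest := (ctest (n := n) gamma p theta).

Let al : R := crit_exp n gamma p theta / (4 * gamma).
Let g0 : gamma != 0. Proof. by rewrite gt_eqF// (lt_le_trans ltr01). Qed.
Let gp : 0 < gamma. Proof. by rewrite (lt_le_trans ltr01). Qed.
Let p0 : 0 < p. Proof. exact: lt_le_trans p_ge2. Qed.

Let Q4_ge0 : 0 <= Q / (4 * gamma).
Proof. by rewrite divr_ge0 ?addr_ge0 ?mulr_ge0// ltW. Qed.
Lemma le_powRN x y (b : R) : 0 < x -> x <= y -> 0 <= b -> y `^ (- b) <= x `^ (- b).
Proof.
move=> x0 xy b0; have y0 : 0 < y by exact: lt_le_trans xy.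
by rewrite !powRN lef_pV2 ?posrE ?powR_gt0// ge0_ler_powR// nnegrE ltW.
Qed.

(** This is [|grad rho| <= 1], a consequence of [|z|^(4 gamma) <= rho^(4 gamma)]. *)
Lemma hdensity_le q : 0 < N q -> D q <= S q `^ (- (Q / (4 * gamma))).
Proof.
move=> N0; have S0 := rad_gt0 gamma N0.
have g2 : (2 * gamma)^-1 <= 1.
  by rewrite invf_le1 ?mulr_gt0//; move: gamma_ge1; lra.
rewrite /hdensity (gt0_powRD (c := - (Q / (4 * gamma))) (a := 1 - (2 * gamma)^-1)
  (b := - (Q / (4 * gamma) + 1 - (2 * gamma)^-1)) S0); last by ring.
rewrite ler_wpM2r ?powR_ge0//.
have -> : 2 * gamma - 1 = 2 * gamma * (1 - (2 * gamma)^-1) by field.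
rewrite powRrM ge0_ler_powR ?nnegrE ?powR_ge0 ?subr_ge0//; first exact: ltW.
exact: rad_ge.
Qed.

Lemma hdensity_le1 q : 0 < N q -> 1 <= S q -> D q <= 1.
Proof.
move=> N0 S1; apply: le_trans (hdensity_le N0) _.
by apply: le_trans (le_powRN ltr01 S1 Q4_ge0) _; rewrite powR1.
Qed.

Lemma hdensity_ge0 q : 0 <= D q. Proof. by rewrite mulr_ge0 ?powR_ge0. Qed.

Definition zt (a b : R) (i : 'I_(n + n + 1)) : R := if (i < n + n)%N then a else b.

Lemma zt_l a b j : zt a b (lshift 1 j) = a.
Proof. by rewrite /zt /= ltn_ord. Qed.

Lemma zt_r a b k : zt a b (rshift (n + n) k) = b.
Proof. by rewrite /zt /= ltnNge leq_addr. Qed.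

Lemma zt_boxP a b a' b' q : rV_box (zt a b) (zt a' b') q <->
  (forall j, a <= zc j q <= a') /\ b <= t q <= b'.
Proof.
split=> [h|[h1 h2] i].
  by split=> [j|]; [have := h (lshift 1 j); rewrite !zt_l|have := h (idx_t n); rewrite !zt_r].
case: (split_ordP i) => k ->; first by rewrite !zt_l; exact: h1.
by rewrite !zt_r (ord1 k); exact: h2.
Qed.

Lemma lebesgue_zt_box a b a' b' : a <= a' -> b <= b' ->
  mu (rV_box (zt a b) (zt a' b')) = ((a' - a) ^+ (n + n) * (b' - b))%:E.
Proof.
move=> aa bb; rewrite lebesgue_rV_box; last by move=> i; rewrite /zt; case: ifP.
rewrite big_split_ord/= big_ord1 !zt_r; congr (_ * _)%:E.
by under eq_bigr do rewrite !zt_l; rewrite prodr_const card_ord.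
Qed.

Lemma sqr_box x y : 0 <= y -> x ^+ 2 <= y ^+ 2 -> - y <= x <= y.
Proof.
move=> y0 xy; rewrite -ler_norml -(@ler_pXn2r _ 2) ?nnegrE//.
by rewrite real_normK ?num_real.
Qed.

(** The region where no cutoff acts. The strict inequalities make it open, so that the test function
    agrees with the pure power near each of its points and so does the operator. *)
Definition core d r : set 'rV[R]_(n + n + 1) := [set q | 2 * d < N q /\ 2 < S q < r].

Lemma measurable_core d r : measurable (core d r).
Proof.
rewrite (_ : core d r = (setT `&` N @^-1` `]2 * d, +oo[) `&` (setT `&` S @^-1` `]2, r[)).
  apply: measurableI.
  - by apply: measurable_sqn => //; exact: measurable_itv.
  - by apply: measurable_rad => //; exact: measurable_itv.
by rewrite !setTI; apply/seteqP; split => q /=; rewrite !in_itv/= andbT.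
Qed.

Lemma measurable_hdensity E : measurable_fun E (D : _ -> measurableTypeR R).
Proof.
apply: measurable_funM; last exact: measurable_rad_powR.
by apply: (measurableT_comp (measurable_powR _)); exact: measurable_sqn.
Qed.

(** On [core] the integrand is exactly the sharp constant times [D]. The rest of the support, where
    it is at most [C^p D], is covered by three sets: the slab around [z = 0] and the region
    [S <= 2], where [D <= 1], and the shell [r <= S <= 2 r], where [D <= r^(-Q / (4 gamma))]. *)
Lemma rhs_integrand_bound C : 0 <= C ->
  (forall d r q, 0 < d -> d <= 2^-1 -> 1 <= r -> 0 < N q -> 1 <= radc gamma d q ->
    `|greiner_op gamma (ctest d r) q| <= C * (N q `^ (2 * gamma - 1) * S q `^ (al - 1))) ->
  forall (a r : R) (d := a ^+ 2 / 2) q, 0 < a -> a <= 2^-1 -> 1 <= r -> 0 < N q ->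
  `|greiner_op gamma (ctest d r) q| `^ p * rhs_density gamma p theta q <=
  rellich_const n gamma p theta * (D q * \1_(core d r) q) +
  C `^ p * (\1_(rV_box (zt (- a) (- (2 * r))) (zt a (2 * r))) q + \1_(cube 2) q +
    r `^ (- (Q / (4 * gamma))) *
      \1_(rV_box (zt (- ((2 * r) `^ (4 * gamma)^-1)) (- ((2 * r) `^ 2^-1)))
                 (zt ((2 * r) `^ (4 * gamma)^-1) ((2 * r) `^ 2^-1))) q).
Proof.
move=> C0 HC a r d q a0 a1 r1 N0.
have d0 : 0 < d by rewrite divr_gt0// exprn_gt0.
have d1 : d <= 2^-1 by rewrite /d; nra.
have r0 : 0 < r by exact: lt_le_trans r1.
have S0 := rad_gt0 gamma N0.
have Dq0 := hdensity_ge0 q.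
have e30 : 0 <= r `^ (- (Q / (4 * gamma))) by exact: powR_ge0.
set B1 := rV_box _ _; set B2 : set 'rV[R]_(n + n + 1) := cube 2; set B3 := rV_box _ _.
have i0 (B : set 'rV[R]_(n + n + 1)) : 0 <= \1_B q :> R by rewrite indicE.
have K0 := rellich_K_ge0 const_ge0.
have [qP|qP] := boolP (q \in core d r).
  have [Nd Sr] : core d r q by rewrite inE in qP.
  rewrite greiner_op_ctest_exact// crit_expE//.
  rewrite !normrM normrN (ger0_norm K0) !(ger0_norm (powR_ge0 _ _)) rhs_densityE//.
  rewrite indicE qP mulr1 /rellich_const lerDl mulr_ge0 ?powR_ge0//.
  by rewrite !addr_ge0// mulr_ge0.
rewrite [X in D q * X]indicE (negbTE qP) mulr0 mulr0 add0r.
have [off|/not_orP[/negP c1 /negP c2]] :=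
    pselect (radc gamma d q < 1 \/ 2 * r < radc gamma d q).
  rewrite greiner_op_ctest_off// normr0 powR0 ?gt_eqF// mul0r mulr_ge0 ?powR_ge0//.
  by rewrite !addr_ge0// mulr_ge0.
rewrite -leNgt in c1; rewrite -leNgt in c2.
apply: (@le_trans _ _ (C `^ p * D q)).
  rewrite -(rhs_densityE theta gamma_ge1 p_ge2 C0 N0) ler_wpM2r ?rhs_density_ge0//.
  apply: (ge0_ler_powR (ltW p0)); last exact: HC.
    by rewrite nnegrE.
  by rewrite nnegrE !mulr_ge0 ?powR_ge0.
rewrite ler_wpM2l ?powR_ge0//.
have S1 : 1 <= S q by exact: le_trans c1 (radc_le gamma d q).
have D1 := hdensity_le1 N0 S1.
have tr : t q ^+ 2 <= 2 * r by apply: le_trans c2; rewrite /radc lerDr hcut_ge0.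
(* The choice of [d] gives [2 d = a^2], so here every [|z_j|] is at most [a]. *)
have [Nd|Nd] := leP (N q) (2 * d).
  have -> : \1_B1 q = 1 :> R.
    rewrite indicE mem_set//; apply/zt_boxP; split => [j|]; apply: sqr_box.
    - exact: ltW.
    - apply: le_trans (zc_sqr_le_sqn j q) _; apply: le_trans Nd _.
      by rewrite le_eqVlt; apply/orP; left; apply/eqP; rewrite /d; field.
    - by rewrite mulr_ge0// ltW.
    - by apply: le_trans tr _; nra.
  by rewrite -addrA (le_trans D1)// lerDl addr_ge0// mulr_ge0.
have Sc : radc gamma d q = S q by rewrite /radc hcut_far// ltW.
have [S2|S2] := leP (S q) 2.
  have -> : \1_B2 q = 1 :> R.
    rewrite indicE mem_set//.
    have := @radc_bounded _ _ _ gamma_ge1 d 1 q d0 d1 (lexx 1).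
    by rewrite Sc mulr1; exact.
  by rewrite (le_trans D1)// addrAC lerDr addr_ge0// mulr_ge0.
have Sr : r <= S q.
  rewrite leNgt; apply/negP => Sr; move/negP: qP; apply; rewrite inE.
  by split => //; rewrite S2.
rewrite Sc in c2.
have -> : \1_B3 q = 1 :> R.
  rewrite indicE mem_set//; apply/zt_boxP; split => [j|]; apply: sqr_box; rewrite ?powR_ge0//.
  - apply: le_trans (zc_sqr_le_sqn j q) _.
    rewrite -(@powR_mulrn _ ((2 * r) `^ _)) ?powR_ge0// -powRrM.
    have -> : N q = (N q `^ (2 * gamma)) `^ ((4 * gamma)^-1 * 2).
      rewrite -powRrM (_ : 2 * gamma * _ = 1); last by field.
      by rewrite powRr1// ltW.
    rewrite ge0_ler_powR ?nnegrE ?powR_ge0 ?mulr_ge0 ?invr_ge0 ?mulr_ge0 ?(ltW gp) ?(ltW r0)//.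
    by apply: le_trans c2; exact: rad_ge.
  - by rewrite -(@powR_mulrn _ ((2 * r) `^ _)) ?powR_ge0// -powRrM mulVf// powRr1// mulr_ge0// ltW.
rewrite mulr1 (le_trans (hdensity_le N0))//.
rewrite (le_trans (le_powRN r0 Sr Q4_ge0))// lerDr addr_ge0//.
Qed.

End optimality.

(** * Bounded errors against a logarithmically divergent integral *)

Section optimality_estimates.
Context (R : realType) (n : nat) (gamma p theta : R).
Hypotheses (n_gt0 : (0 < n)%N) (gamma_ge1 : 1 <= gamma) (p_ge2 : 2 <= p).
Hypothesis const_ge0 : 0 <= (hdim n gamma - p * (theta + 2)) *
                      (p * theta + hdim n gamma * (p - 1)).
Implicit Types (q : 'rV[R]_(n + n + 1)) (u : 'rV[R]_(n + n + 1) -> R).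
Implicit Types (j : 'I_(n + n)) (d r : R).

Local Notation mu := (lebesgue_rV (n + n + 1)).
Local Notation N := (@sqn R n).
Local Notation t := (@tc R n).
Local Notation S := (@rad R n gamma).
Local Notation D := (@hdensity R n gamma).
Local Notation Q := (hdim n gamma : R).
Local Notation ctest := (ctest (n := n) gamma p theta).
Local Notation core := (@core R n gamma).

Let om : R := Q / (4 * gamma) + 1 - (2 * gamma)^-1.
Let g0 : gamma != 0. Proof. by rewrite gt_eqF// (lt_le_trans ltr01). Qed.
Let gp : 0 < gamma. Proof. by rewrite (lt_le_trans ltr01). Qed.
Let p0 : 0 < p. Proof. exact: lt_le_trans p_ge2. Qed.
Let Q4_ge0 : 0 <= Q / (4 * gamma).
Proof. by rewrite divr_ge0 ?addr_ge0 ?mulr_ge0// ltW. Qed.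
Let om_ge0 : 0 <= om.
Proof.
rewrite /om -addrA addr_ge0// subr_ge0 invf_le1 ?mulr_gt0//.
by move: gamma_ge1; lra.
Qed.

Lemma measurable_hdensityE E : measurable_fun E (fun q => (D q)%:E).
Proof. by apply/measurable_EFinP; exact: measurable_hdensity. Qed.

(** Finiteness is what allows this integral to be subtracted when two constants are compared in
    [rellich_optimality]. *)
Lemma integral_hdensity_core_lty d r : 0 < d -> d <= 2^-1 -> 1 <= r ->
  (\int[mu]_(q in core d r) (D q)%:E < +oo)%E.
Proof.
move=> d0 d1 r1; have mc := @measurable_core R n gamma d r.
have cc : core d r `<=` cube (2 * r).
  move=> q [Nd /andP[_ Sr]]; apply: (radc_bounded gamma_ge1 d0 d1 r1).
  by rewrite /radc hcut_far ?(ltW Nd)//; move: (ltW Sr) r1; rewrite /rad; lra.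
have mcb : measurable (cube (2 * r) : set 'rV[R]_(n + n + 1)) by exact: measurable_rV_box.
apply: (@le_lt_trans _ _ (\int[mu]_(q in core d r) cst 1%E q)%E).
  apply: ge0_le_integral => //.
  - by move=> q _; rewrite lee_fin hdensity_ge0.
  - exact: measurable_hdensityE.
  - move=> q [Nd /andP[S2 _]]; rewrite lee_fin; apply: hdensity_le1 => //.
    + by apply: lt_trans Nd; rewrite mulr_gt0.
    + by apply: le_trans (ltW S2); rewrite ler1n.
rewrite integral_cst// mul1e.
apply: (@le_lt_trans _ _ (mu (cube (2 * r)))); first by apply: le_measure; rewrite ?inE.
apply: lebesgue_rV_box_lty => i.
by move: r1; lra.
Qed.

Lemma rellich_lhs_ctest_ge d r : 0 < d -> d <= 2^-1 -> 1 <= r ->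
  (\int[mu]_(q in core d r) (D q)%:E <= rellich_lhs gamma p theta setT (ctest d r))%E.
Proof.
move=> d0 d1 r1; rewrite rellich_lhsE//.
rewrite [leLHS]integral_mkcond.
apply: (@ge0_le_integral_off _ _ _ mu setT (@hyper0 R n n_gt0)).
- exact: measurable_hyper0.
- exact: hyper0_null.
- by move=> q; rewrite patchE; case: ifP => // _; rewrite lee_fin hdensity_ge0.
- by move=> q; exact: lhs_integrand_ge0.
move=> q _ /sqn_gt0 N0; rewrite patchE; case: ifPn => [|_]; last exact: lhs_integrand_ge0.
rewrite inE => -[Nd /andP[S2 Sr]].
rewrite ctest_exact ?(ltW Nd) ?(ltW S2) ?(ltW Sr)//; last exact: lt_le_trans r1.
rewrite ger0_norm ?powR_ge0// -[X in X `^ p]mul1r lhs_densityE// powR1 mul1r.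
by [].
Qed.

(** The point is that [E] does not depend on [r]. It adds bounds for the weighted volumes of the
    three exceptional sets, the width [a = 1 / (4 r)] of the slab being tuned to its extent along
    [t]. *)
Lemma rellich_rhs_ctest_le : exists2 E : R, 0 <= E & forall r (d := (4 * r)^-1 ^+ 2 / 2),
  1 <= r ->
  (rellich_rhs gamma p theta setT (ctest d r) <=
   (rellich_const n gamma p theta)%:E * \int[mu]_(q in core d r) (D q)%:E + E%:E)%E.
Proof.
have [C C0 HC] := greiner_op_ctest_bound n p theta gamma_ge1.
pose E := C `^ p * (2 + 4 ^+ (n + n + 1) + 2 ^+ (n + n + 1) * 2 `^ (Q / (4 * gamma))).
exists E; first by rewrite mulr_ge0 ?addr_ge0 ?mulr_ge0 ?exprn_ge0 ?powR_ge0.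
move=> r d r1; set a := (4 * r)^-1 in d *.
have r0 : 0 < r by exact: lt_le_trans r1.
have a0 : 0 < a by rewrite invr_gt0 mulr_gt0.
have a1 : a <= 2^-1 by rewrite lef_pV2 ?posrE ?mulr_gt0//; move: r1; lra.
have mc := @measurable_core R n gamma d r.
set KK := rellich_const _ _ _ _.
have KK0 : 0 <= KK by exact: powR_ge0.
have Cp0 := powR_ge0 C p.
have HB q := @rhs_integrand_bound _ _ _ _ _ gamma_ge1 p_ge2 const_ge0 C C0 HC a r q a0 a1 r1.
set B1 := rV_box _ _ in HB; set B2 : set 'rV[R]_(n + n + 1) := cube 2 in HB.
set e3 := r `^ _ in HB.
set B3 := rV_box (zt (- _ `^ _) _) _ in HB.
have e30 : 0 <= e3 by exact: powR_ge0.
have mB1 : measurable B1 by exact: measurable_rV_box.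
have mB2 : measurable B2 by exact: measurable_rV_box.
have mB3 : measurable B3 by exact: measurable_rV_box.
have iB (B : set 'rV[R]_(n + n + 1)) q : 0 <= \1_B q :> R by rewrite indicE.
have mi (B : set 'rV[R]_(n + n + 1)) : measurable B ->
    measurable_fun setT (fun q => (\1_B q : R)%:E).
  by move=> mB; apply/measurable_EFinP; exact: measurable_indic.
have mD1 : measurable_fun setT (fun q => (D q * \1_(core d r) q)%:E).
  apply/measurable_EFinP; apply: measurable_funM; first exact: measurable_hdensity.
  exact: measurable_indic.
have D1_ge0 q : 0 <= D q * \1_(core d r) q by rewrite mulr_ge0 ?hdensity_ge0.
apply: (@le_trans _ _ (\int[mu]_q (KK%:E * (D q * \1_(core d r) q)%:E +
   (C `^ p)%:E * ((\1_B1 q : R)%:E + (\1_B2 q : R)%:E + e3%:E * (\1_B3 q : R)%:E)))%E).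
  rewrite rellich_rhsE//.
  apply: (@ge0_le_integral_off _ _ _ mu setT (@hyper0 R n n_gt0)).
  - exact: measurable_hyper0.
  - exact: hyper0_null.
  - by move=> q; exact: rhs_integrand_ge0.
  - move=> q; rewrite -!EFinM -!EFinD lee_fin.
    apply: addr_ge0; first exact: mulr_ge0.
    by apply: mulr_ge0 => //; rewrite !addr_ge0// mulr_ge0.
  - by move=> q _ /sqn_gt0 N0; rewrite lee_fin; exact: HB.
have i0 (B : set 'rV[R]_(n + n + 1)) q : (0 <= (\1_B q : R)%:E)%E by rewrite lee_fin.
have V (B : set 'rV[R]_(n + n + 1)) : measurable B ->
    (\int[mu]_q (\1_B q : R)%:E)%E = mu B.
  by move=> mB; rewrite integral_indic// setIT.
rewrite ge0_integralD//; last 4 first.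
- by move=> q _; rewrite mule_ge0// lee_fin.
- exact: measurable_funeM.
- by move=> q _; rewrite mule_ge0 ?adde_ge0// mule_ge0// lee_fin.
- apply: measurable_funeM; apply: emeasurable_funD; first by apply: emeasurable_funD; exact: mi.
  by apply: measurable_funeM; exact: mi.
rewrite ge0_integralZl_EFin//; last by move=> q _; rewrite lee_fin.
apply: leeD.
  rewrite lee_wpmul2l ?lee_fin// [leRHS]integral_mkcond.
  rewrite le_eqVlt; apply/orP; left; apply/eqP; apply: eq_integral => q _.
  by rewrite patchE indicE; case: ifP => _; rewrite ?mulr1 ?mulr0.
rewrite ge0_integralZl_EFin//; last 2 first.
- by move=> q _; rewrite !adde_ge0// mule_ge0// lee_fin.
- apply: emeasurable_funD; first by apply: emeasurable_funD; exact: mi.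
  by apply: measurable_funeM; exact: mi.
rewrite ge0_integralD//; last 4 first.
- by move=> q _; rewrite adde_ge0.
- by apply: emeasurable_funD; exact: mi.
- by move=> q _; rewrite mule_ge0// lee_fin.
- by apply: measurable_funeM; exact: mi.
rewrite ge0_integralD//; [|exact: mi|exact: mi].
rewrite ge0_integralZl_EFin//; last exact: mi.
rewrite !V//; clear HB.
have VB1 : (mu B1 <= 2%:E)%E.
  rewrite lebesgue_zt_box; [|by move: (ltW a0); lra|by move: r1; lra].
  rewrite lee_fin opprK [a + a](_ : _ = (2 * r)^-1); last first.
    by rewrite /a; field; rewrite gt_eqF.
  have i2 : (2 * r)^-1 <= 1 by rewrite invf_le1 ?mulr_gt0//; move: r1; lra.
  (* The slab has volume [(2 r)^(-2 n) * 4 r]. As [2 r >= 1] and [2 n >= 1], one factor [(2 r)^-1]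
     is enough and leaves 2. *)
  apply: (@le_trans _ _ ((2 * r)^-1 ^+ 1 * (2 * r - - (2 * r)))).
    rewrite ler_wpM2r//; first by move: r1; lra.
    by apply: ler_wiXn2l => //; [rewrite invr_ge0 mulr_ge0// ltW|rewrite addn_gt0 n_gt0].
  rewrite le_eqVlt; apply/orP; left; apply/eqP; field.
  by rewrite gt_eqF.
have VB2 : (mu B2 <= (4 ^+ (n + n + 1))%:E)%E.
  rewrite lebesgue_rV_box => [|i]; last by lra.
  by rewrite lee_fin prodr_const card_ord (_ : 2 - - 2 = 4)//; lra.
have VB3 : (e3%:E * mu B3 <= (2 ^+ (n + n + 1) * 2 `^ (Q / (4 * gamma)))%:E)%E.
  set X := (2 * r) `^ (4 * gamma)^-1 in B3 mB3 *; set Y := (2 * r) `^ 2^-1 in B3 mB3 *.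
  have X0 : 0 <= X by exact: powR_ge0.
  have Y0 : 0 <= Y by exact: powR_ge0.
  rewrite lebesgue_zt_box; [|by move: X0; lra|by move: Y0; lra].
  rewrite -EFinM lee_fin.
  (* The volume of a box adapted to the dilations scales with the exponent [Q], and the decay [e3]
     of the density on the shell cancels its growth in [r]. *)
  have XY : X ^+ (n + n) * Y = 2 `^ (Q / (4 * gamma)) * r `^ (Q / (4 * gamma)).
    rewrite -powRM ?(ltW r0)// -powR_mulrn// /X /Y -powRrM.
    rewrite !powR_expR ?mulr_gt0// -expRD; congr expR.
    by rewrite /hdim natrD; field.
  have er : e3 * r `^ (Q / (4 * gamma)) = 1 by rewrite /e3 powRN mulVf// gt_eqF// powR_gt0.
  rewrite le_eqVlt; apply/orP; left; apply/eqP.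
  transitivity (2 ^+ (n + n + 1) * (X ^+ (n + n) * Y) * e3).
    have -> : X - - X = 2 * X by ring.
    by rewrite exprMn [2 ^+ (n + n + 1)]exprD; ring.
  by rewrite XY -!mulrA [_ * e3]mulrC er mulr1.
rewrite /E EFinM lee_wpmul2l ?lee_fin//.
by rewrite !EFinD leeD// leeD.
Qed.

(* Disjoint boxes which the dilations permute; [D] has about the same integral on each. *)
Definition dyad k : set 'rV[R]_(n + n + 1) :=
  rV_box (zt (2 ^+ k.+1) 0) (zt (3 / 2 * 2 ^+ k.+1) ((2 ^+ k.+1) `^ (2 * gamma))).

(** Bounds [S / l^(4 gamma)] on the box of scale [l]: there [N <= 2 n (3 l / 2)^2], and
    [t^2 <= l^(4 gamma)] accounts for the 1. *)
Let c3 : R := (9 / 2 * n%:R) `^ (2 * gamma) + 1.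

Lemma dyad_sqn k q : dyad k q ->
  (2 ^+ k.+1) ^+ 2 <= N q /\ N q <= 9 / 2 * n%:R * (2 ^+ k.+1) ^+ 2.
Proof.
move=> /zt_boxP[hz _]; set l : R := 2 ^+ k.+1 in hz *.
have l0 : 0 < l by exact: exprn_gt0.
split.
  apply: le_trans (zc_sqr_le_sqn (lshift n (Ordinal n_gt0)) q).
  have /andP[h _] := hz (lshift n (Ordinal n_gt0)).
  by rewrite ler_pXn2r ?nnegrE ?(ltW l0)// (le_trans (ltW l0)).
apply: (@le_trans _ _ (\sum_(j < n + n) (3 / 2 * l) ^+ 2)).
  apply: ler_sum => j _; have /andP[h1 h2] := hz j.
  have z0 : 0 <= zc j q by exact: le_trans (ltW l0) h1.
  by rewrite ler_pXn2r ?nnegrE//; move: l0; lra.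
rewrite sumr_const card_ord -(mulr_natr _ (n + n)) natrD.
by rewrite le_eqVlt; apply/orP; left; apply/eqP; field.
Qed.

Lemma dyad_rad k q : dyad k q -> 2 < S q /\ S q <= c3 * (2 ^+ k.+1) `^ (4 * gamma).
Proof.
move=> qB; have [N1 N2] := dyad_sqn qB.
have /zt_boxP[_ ht] := qB; set l : R := 2 ^+ k.+1 in N1 N2 ht *.
have l0 : 0 < l by exact: exprn_gt0.
have l2 : 2 <= l by rewrite /l exprS ler_peMr// exprn_ege1// ler1n.
have N4 : 4 <= N q by apply: le_trans N1; nra.
have g1 : 1 <= 2 * gamma by move: gamma_ge1; lra.
have t20 := sqr_ge0 (t q).
split.
  have h : N q <= N q `^ (2 * gamma) by apply: le_powR1 => //; move: N4; lra.
  by rewrite /rad; move: h N4 t20; lra.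
have l4 : (l ^+ 2) `^ (2 * gamma) = l `^ (4 * gamma).
  by rewrite -powR_mulrn ?(ltW l0)// -powRrM; congr (_ `^ _); ring.
rewrite /rad /c3 [leRHS]mulrDl mul1r lerD//.
  have n90 : 0 <= 9 / 2 * n%:R :> R by rewrite mulr_ge0.
  rewrite -l4 -powRM ?sqr_ge0//; apply: ge0_ler_powR => //.
  - by move: g1; lra.
  - by rewrite nnegrE; move: N4; lra.
  - by rewrite nnegrE; apply: le_trans N2; move: N4; lra.
have /andP[t0 t1] := ht.
rewrite (_ : l `^ (4 * gamma) = (l `^ (2 * gamma)) ^+ 2); last first.
  by rewrite -(@powR_mulrn _ (l `^ _)) ?powR_ge0// -powRrM; congr (_ `^ _); ring.
by rewrite ler_pXn2r ?nnegrE ?powR_ge0.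
Qed.

Lemma dyad_core d r k M : d <= 1 -> (k < M)%N -> r = c3 * (2 ^+ M) `^ (4 * gamma) + 1 ->
  dyad k `<=` core d r.
Proof.
move=> d1 kM -> q qB; have [N1 _] := dyad_sqn qB; have [S2 S3] := dyad_rad qB.
have l2 : (2 : R) <= 2 ^+ k.+1 by rewrite exprS ler_peMr// exprn_ege1// ler1n.
split; first by move: d1; nra.
rewrite S2 /=; apply: (le_lt_trans S3); apply: (@le_lt_trans _ _ (c3 * (2 ^+ M) `^ (4 * gamma))).
  rewrite ler_wpM2l ?addr_ge0 ?powR_ge0//; apply: ge0_ler_powR.
  - by rewrite mulr_ge0// ltW.
  - by rewrite nnegrE exprn_ge0.
  - by rewrite nnegrE exprn_ge0.
  - by rewrite ler_eXn2l// ltr1n.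
by rewrite ltrDl.
Qed.

(** With [l = 2^(k + 1)], on a box [D] is at least [c3^(-om) l^(-Q)], while the volume is
    [(l / 2)^(2 n) l^(2 gamma) = 2^(-2 n) l^Q]; the scale [l] cancels. *)
Let kap : R := c3 `^ (- om) * 2^-1 ^+ (n + n).

Lemma dyad_integral k : (kap%:E <= \int[mu]_(q in dyad k) (D q)%:E)%E.
Proof.
set l : R := 2 ^+ k.+1; have l0 : 0 < l by exact: exprn_gt0.
have c30 : 0 < c3 by rewrite ltr_wpDl ?powR_ge0.
have mB : measurable (dyad k) by exact: measurable_rV_box.
apply: (@le_trans _ _ (\int[mu]_(q in dyad k) cst (c3 `^ (- om) * l `^ (- Q))%:E q)%E).
  rewrite integral_cst// [X in (_ * X)%E](_ : _ =
    ((3 / 2 * l - l) ^+ (n + n) * (l `^ (2 * gamma) - 0))%:E); last first.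
    by apply: lebesgue_zt_box; rewrite -/l ?powR_ge0//; move: l0; lra.
  rewrite subr0 -EFinM lee_fin le_eqVlt; apply/orP; left; apply/eqP.
  have lQ : l `^ (- Q) * (l ^+ (n + n) * l `^ (2 * gamma)) = 1.
    rewrite -powR_mulrn ?(ltW l0)// !powR_expR// -!expRD -[RHS]expR0; congr expR.
    by rewrite /hdim natrD; ring.
  transitivity (kap * (l `^ (- Q) * (l ^+ (n + n) * l `^ (2 * gamma)))).
    by rewrite lQ mulr1.
  rewrite /kap (_ : 3 / 2 * l - l = 2^-1 * l) ?exprMn; last by field.
  by ring.
apply: ge0_le_integral => //.
- by move=> q _; rewrite lee_fin mulr_ge0 ?powR_ge0.
- exact: measurable_hdensityE.
move=> q qB; rewrite lee_fin.
have [N1 N2] := dyad_sqn qB; have [S2 S3] := dyad_rad qB; rewrite -/l in N1 N2 S3.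
have S0 : 0 < S q by apply: lt_trans S2.
rewrite /hdensity -/om.
apply: (@le_trans _ _ ((l ^+ 2) `^ (2 * gamma - 1) * (c3 * l `^ (4 * gamma)) `^ (- om))).
  rewrite le_eqVlt; apply/orP; left; apply/eqP.
  rewrite powRM ?powR_ge0 ?(ltW c30)// -powR_mulrn ?(ltW l0)// -!powRrM.
  rewrite mulrCA; congr (_ * _); rewrite !powR_expR// -expRD; congr expR.
  by rewrite /om; field.
apply: ler_pM; rewrite ?powR_ge0//.
  apply: ge0_ler_powR => //.
  - by move: gamma_ge1; lra.
  - by rewrite nnegrE sqr_ge0.
  - by rewrite nnegrE (le_trans _ N1)// sqr_ge0.
exact: le_powRN.
Qed.

Lemma integral_hdensity_core_ge d r M : d <= 1 -> r = c3 * (2 ^+ M) `^ (4 * gamma) + 1 ->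
  ((kap * M%:R)%:E <= \int[mu]_(q in core d r) (D q)%:E)%E.
Proof.
move=> d1 rE; pose U := \big[setU/set0]_(k <- iota 0 M) dyad k.
have mB k : measurable (dyad k) by exact: measurable_rV_box.
apply: (@le_trans _ _ (\int[mu]_(q in U) (D q)%:E)%E); last first.
  apply: ge0_subset_integral.
  - by apply: bigsetU_measurable => k _; exact: mB.
  - exact: measurable_core.
  - exact: measurable_hdensityE.
  - by move=> q _; rewrite lee_fin hdensity_ge0.
  - rewrite /U -bigcup_seq => q [k /=]; rewrite mem_iota add0n => /andP[_ kM].
    exact: (dyad_core d1 kM rE).
rewrite /U ge0_integral_bigsetU ?iota_uniq//; last 3 first.
- apply/trivIsetP => k k' _ _.
  wlog kk : k k' / (k < k')%N.
    move=> H; case: (ltngtP k k') => // kk _; first by apply: H => //; rewrite ltn_eqF.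
    by rewrite setIC; apply: H => //; rewrite ltn_eqF.
  move=> _; apply/seteqP; split => // q [/zt_boxP[h1 _] /zt_boxP[h2 _]].
  have /andP[_ i1] := h1 (lshift n (Ordinal n_gt0)).
  have /andP[i2 _] := h2 (lshift n (Ordinal n_gt0)).
  (* Disjointness shows in one coordinate of [z]: the ranges [[l, 3 l / 2]] at different dyadic
     scales do not meet. *)
  have : (2 : R) ^+ k.+2 <= 2 ^+ k'.+1 by rewrite ler_eXn2l// ltr1n.
  have : 0 < (2 : R) ^+ k.+1 by exact: exprn_gt0.
  by rewrite [2 ^+ k.+2]exprS; move: i1 i2; set x := zc _ _; move=> *; lra.
- exact: measurable_hdensityE.
- by move=> q _; rewrite lee_fin hdensity_ge0.
apply: (@le_trans _ _ (\sum_(k <- iota 0 M) kap%:E)%E).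
  by rewrite sumEFin lee_fin big_const_seq count_predT size_iota iter_addr_0 mulr_natr.
by apply: lee_sum => k _; exact: dyad_integral.
Qed.

Theorem rellich_optimality C :
  (forall u, test_fun u ->
     (C%:E * rellich_lhs gamma p theta setT u <= rellich_rhs gamma p theta setT u)%E) ->
  C <= rellich_const n gamma p theta.
Proof.
move=> HC; rewrite leNgt; apply/negP => KC; set KK := rellich_const _ _ _ _ in KC.
have KK0 : 0 <= KK by exact: powR_ge0.
have C0 : 0 <= C by exact: le_trans (ltW KC).
have [E E0 HE] := rellich_rhs_ctest_le.
have c30 : 0 < c3 by rewrite ltr_wpDl ?powR_ge0.
have kap0 : 0 < kap by rewrite mulr_gt0 ?powR_gt0 ?exprn_gt0.
have k0 : 0 < (C - KK) * kap by rewrite mulr_gt0// subr_gt0.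
(* [M] is the number of boxes needed for the gain [(C - KK) * kap * M] to exceed the error [E], and
   [r] is then taken so large that [core] contains them all. *)
pose M := (Num.trunc (E / ((C - KK) * kap))).+1.
have EM : E < (C - KK) * kap * M%:R by rewrite mulrC -ltr_pdivrMr// truncnS_gt.
pose r := c3 * (2 ^+ M) `^ (4 * gamma) + 1.
have r1 : 1 <= r by rewrite lerDr mulr_ge0 ?powR_ge0// ltW.
have r0 : 0 < r by exact: lt_le_trans r1.
pose d := (4 * r)^-1 ^+ 2 / 2.
have d0 : 0 < d by rewrite divr_gt0// exprn_gt0// invr_gt0 mulr_gt0.
have d1 : d <= 2^-1.
  have a0 : 0 < (4 * r)^-1 by rewrite invr_gt0 mulr_gt0.
  have a1 : (4 * r)^-1 <= 1 by rewrite invf_le1 ?mulr_gt0//; move: r1; lra.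
  by rewrite /d; nra.
have := HC _ (test_fun_ctest n p theta gamma_ge1 d0 d1 r1).
move=> /le_trans /(_ (HE r r1)); rewrite -/KK -/d.
have d2 : d <= 1 by move: d1; lra.
have lo := integral_hdensity_core_ge d2 (erefl r).
have fin := integral_hdensity_core_lty d0 d1 r1.
have lh := rellich_lhs_ctest_ge d0 d1 r1.
move=> /(le_trans (lee_wpmul2l (_ : 0 <= C%:E)%E lh)) => /(_ C0).
(* With a finite value [x >= kap * M] of the integral, [C x <= KK x + E] contradicts the choice of
   [M]. *)
move: lo fin; case: (integral _ _ _) => [x| |]//.
rewrite -!EFinM -EFinD !lee_fin => lo _ h.
have : (C - KK) * (kap * M%:R) <= (C - KK) * x by rewrite ler_wpM2l// subr_ge0 ltW.
by move: EM h; lra.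
Qed.

End optimality_estimates.

Theorem corollary4p2 (R : realType) (n : nat) (gamma p theta : R)
    (n_gt0 : (0 < n)%N) (gamma_ge1 : 1 <= gamma) (p_ge2 : 2 <= p)
    (const_ge0 : 0 <= (hdim n gamma - p * (theta + 2)) *
                      (p * theta + hdim n gamma * (p - 1)))
    (hdim_gt : 2 * p * (2 * gamma - 1) + 4 * (1 - gamma) < hdim n gamma) :
  [/\ (* the inequality *)
      forall u : 'rV[R]_(n + n + 1) -> R, test_fun u ->
        ((rellich_const n gamma p theta)%:E *
           rellich_lhs gamma p theta [set: _] u
         <= rellich_rhs gamma p theta [set: _] u)%E,
      (* optimality of the constant *)
      forall C : R,
        (forall u : 'rV[R]_(n + n + 1) -> R, test_fun u ->
          (C%:E * rellich_lhs gamma p theta [set: _] u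
           <= rellich_rhs gamma p theta [set: _] u)%E) ->
        C <= rellich_const n gamma p theta
    & (* equality for the multiples of rho ^ ((p (theta + 2) - Q) / p) *)
      forall (c : R) (A : set 'rV[R]_(n + n + 1)), measurable A ->
        let v := fun q => c * rho gamma q `^
                   ((p * (theta + 2) - hdim n gamma) / p) in
        ((rellich_const n gamma p theta)%:E * rellich_lhs gamma p theta A v
         = rellich_rhs gamma p theta A v)%E].
Proof.
split.
- exact: rellich_inequality.
- exact: rellich_optimality.
- by move=> c A mA v; exact: rellich_equality.
Qed.
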